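(* Let $n\ge 1$ and $s\in(0,1)$. There exists a constant $C$, depending only on $n$ and $s$, such that the following holds. Let $v\in\operatorname{Dom}(H^s)$ be a strong supersolution of $H^s v=0$ in $B_2\times(-4,0]$, with $v\ge 0$ in $\mathbb{R}^n\times\mathbb{R}$. Then $$\|v\|_{L^1(U^-)}\le C\inf_{U^+}v(x,t),$$ where $$U^-=B_{1/2}\times\left(-1,-\tfrac12\right),\qquad U^+=B_{1/2}\times\left(-\tfrac14,0\right).$$
   Context: $B_r$ is the ball of radius $r$ centered at the origin in $\mathbb{R}^n$. $H^s=(\partial_t-\Delta)^s$ is the fractional heat operator on functions of $(x,t)\in\mathbb{R}^n\times\mathbb{R}$, defined by $\widehat{H^s u}(\xi,\sigma)=\big((2\pi|\xi|)^2+2\pi i\sigma\big)^s\,\hat u(\xi,\sigma)$ (principal branch of the power), where $\hat u$ is the Fourier transform on $\mathbb{R}^{n+1}$ (convention with kernel $e^{-2\pi i(x\cdot\xi+t\sigma)}$). Its domain is $$\operatorname{Dom}(H^s)=\{u\in L^2(\mathbb{R}^{n+1}) : (\xi,\sigma)\mapsto((2\pi|\xi|)^2+2\pi i\sigma)^s\,\hat u(\xi,\sigma)\in L^2(\mathbb{R}^{n+1})\}.$$ $v$ being a strong supersolution of $H^sv=0$ in $B_2\times(-4,0]$ means that the $L^2$ function $H^s v$ satisfies $H^s v\ge 0$ a.e. in $B_2\times(-4,0]$. Since $v$ is only an $L^2$ function, the infimum is the essential infimum. *)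

(* Defs.v *)
(* Analysis is done in MathComp-Analysis over an arbitrary R : realType;
   complex numbers are R[i] from real-closed. *)
From HB Require Import structures.
From mathcomp Require Import all_boot all_order all_algebra.
From mathcomp Require Import all_classical all_reals all_analysis.
From mathcomp Require Import complex.

Set Implicit Arguments.
Unset Strict Implicit.
Unset Printing Implicit Defensive.

Import Order.TTheory GRing.Theory Num.Theory.
Import numFieldNormedType.Exports.

Local Open Scope classical_set_scope.
Local Open Scope complex_scope.
Local Open Scope ring_scope.

(* In the library, the canonical sigma-finite structure of m1 \x m2 is shadowed
   by the one for products of sub-probabilities. *)
Lemma sigma_finite_product d1 d2 (T1 : measurableType d1)
    (T2 : measurableType d2) (R : realType)
    (m1 : {sigma_finite_measure set T1 -> \bar R})
    (m2 : {sigma_finite_measure set T2 -> \bar R}) :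
  sigma_finite setT (m1 \x m2)%E.
Proof.
have /sigma_finiteP[F [TF ndF Foo]] := sigma_finiteT m1.
have /sigma_finiteP[G [TG ndG Goo]] := sigma_finiteT m2.
exists (fun n => F n `*` G n).
  rewrite -setXTT TF TG predeqE => -[x y]; split.
    move=> [/= [n _ Fnx] [k _ Gky]]; exists (maxn n k) => //; split.
    - by move: x Fnx; exact/subsetPset/ndF/leq_maxl.
    - by move: y Gky; exact/subsetPset/ndG/leq_maxr.
  by move=> [n _ []/= ? ?]; split; exists n.
move=> k; have [? ?] := Foo k; have [? ?] := Goo k.
split; first exact: measurableX.
by rewrite product_measure1E// lte_mul_pinfty// ge0_fin_numE.
Qed.

(* R^n with its Borel sigma-algebra (the product one), and R^n x R. *)
Notation Rn R n := (n.-tuple (measurableTypeR R)).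
Notation spacetime R n := ((Rn R n * measurableTypeR R)%type).

Section lebesgue_Rn.
Context {R : realType}.

Section step.
Variables (n : nat) (m : {sigma_finite_measure set (Rn R n) -> \bar R}).

Definition consRn (p : measurableTypeR R * Rn R n) : Rn R n.+1 :=
  [the n.+1.-tuple _ of p.1 :: p.2].

Lemma measurable_consRn : measurable_fun [set: _] consRn.
Proof. exact: (measurable_cons measurable_fst measurable_snd). Qed.

Definition lebesgue_step : set (Rn R n.+1) -> \bar R :=
  pushforward (lebesgue_measure \x m)%E consRn.

Let step0 : lebesgue_step set0 = 0%E.
Proof. by rewrite /lebesgue_step /pushforward preimage_set0 measure0. Qed.

Let step_ge0 A : (0 <= lebesgue_step A)%E.
Proof. exact: (measure_ge0 (lebesgue_measure \x m)%E). Qed.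

Let step_sigma_additive : semi_sigma_additive lebesgue_step.
Proof.
move=> F mF tF mUF.
have mc A : measurable A -> measurable (consRn @^-1` A).
  by move=> mA; rewrite -[X in measurable X]setTI; exact: measurable_consRn.
rewrite /lebesgue_step /pushforward preimage_bigcup.
apply: measure_semi_sigma_additive => [i||]; first exact: mc.
- apply/trivIsetP => /= i j _ _ ij; rewrite -preimage_setI.
  by move/trivIsetP : tF => /(_ _ _ _ _ ij) ->//; rewrite preimage_set0.
- by rewrite -preimage_bigcup; exact: mc.
Qed.

HB.instance Definition _ := isMeasure.Build _ _ _ lebesgue_step
  step0 step_ge0 step_sigma_additive.

Definition unconsRn (x : Rn R n.+1) : measurableTypeR R * Rn R n :=
  (tnth x ord0, [tuple of behead x]).

Let step_sigma_finite : sigma_finite setT lebesgue_step.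
Proof.
have [F UF Fm] : sigma_finite setT (lebesgue_measure \x m)%E.
  exact: sigma_finite_product.
have muncons : measurable_fun [set: _] unconsRn.
  by apply/measurable_fun_pair; [exact: measurable_tnth|exact: measurable_behead].
have consK : cancel consRn unconsRn.
  by move=> [a x]; rewrite /unconsRn /=; congr pair; apply/val_inj.
exists (fun i => unconsRn @^-1` F i).
  by rewrite -preimage_bigcup -UF preimage_setT.
move=> i; have [mF Ffin] := Fm i; split.
  by rewrite -[X in measurable X]setTI; exact: muncons.
rewrite /lebesgue_step /pushforward -comp_preimage.
by rewrite (_ : _ \o _ = id) ?preimage_id//; apply/funext => x; exact: consK.
Qed.

HB.instance Definition _ := Measure_isSigmaFinite.Build _ _ _ lebesgue_step
  step_sigma_finite.

End step.

(* n-dimensional Lebesgue measure, as an iterated product. *)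
Fixpoint lebesgue_Rn (n : nat) : {sigma_finite_measure set (Rn R n) -> \bar R} :=
  match n with
  | 0 => \d_ ([tuple] : Rn R 0)
  | n'.+1 => lebesgue_step (lebesgue_Rn n')
  end.

End lebesgue_Rn.

(* Lebesgue measure on R^n x R = R^(n+1). *)
Section lebesgue_spt.
Context {R : realType} {n : nat}.

Definition lebesgue_spt : set (spacetime R n) -> \bar R :=
  (lebesgue_Rn n \x lebesgue_measure)%E.

HB.instance Definition _ := Measure.on lebesgue_spt.

Let lebesgue_spt_sigma_finite : sigma_finite setT lebesgue_spt.
Proof. exact: sigma_finite_product. Qed.

HB.instance Definition _ := Measure_isSigmaFinite.Build _ _ _ lebesgue_spt
  lebesgue_spt_sigma_finite.

End lebesgue_spt.

Section complex_functions.
Context {R : realType}.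

Definition cmod (z : R[i]) : R := ComplexField.Normc.normc z.

Definition expi (theta : R) : R[i] := cos theta +i* sin theta.

(* Principal argument, in ]-pi, pi]; the value at 0 is irrelevant. *)
Definition carg (z : R[i]) : R :=
  if 0 <= complex.Im z then acos (complex.Re z / cmod z)
  else - acos (complex.Re z / cmod z).

(* Principal branch of z ^ s, s real; 0 ^ s = 0 for s != 0. *)
Definition cpow (z : R[i]) (s : R) : R[i] := (cmod z `^ s)%:C * expi (s * carg z).

Context d (T : measurableType d) (mu : {measure set T -> \bar R}).

Definition cLnorm (p : \bar R) (f : T -> R[i]) : \bar R :=
  ('N[mu]_p[EFin \o (cmod \o f)])%E.

Definition memLp (p : \bar R) (f : T -> R[i]) : Prop :=
  [/\ measurable_fun [set: T] (fun x => complex.Re (f x)),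
      measurable_fun [set: T] (fun x => complex.Im (f x)) &
      (cLnorm p f < +oo)%E].

Definition cintegral (f : T -> R[i]) : R[i] :=
  (\int[mu]_x complex.Re (f x)) +i* (\int[mu]_x complex.Im (f x)).

(* Essential infimum over a subset D; the library's [ess_inf] is over T. *)
Definition ess_inf_on (D : set T) (f : T -> \bar R) : \bar R :=
  ereal_sup [set y | {ae mu, forall x, D x -> (y <= f x)%E}].

End complex_functions.

Section fractional_heat.
Context {R : realType} {n : nat}.
Implicit Types (u w g : spacetime R n -> R[i]) (x xi : Rn R n).

Definition dotp x xi : R := \sum_(i < n) (tnth x i : R) * tnth xi i.

Definition enorm x : R := Num.sqrt (dotp x x).

Definition eball (r : R) : set (Rn R n) := [set x | enorm x < r].

Definition fourierL1 u (zeta : spacetime R n) : R[i] :=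
  cintegral lebesgue_spt (fun z =>
    u z * expi (- (2 * pi * (dotp z.1 zeta.1 + (z.2 : R) * zeta.2)))).

(* [is_fourier u g]: g is (a representative of) the Fourier transform of u in
   L^2(R^(n+1)), i.e. of the continuous extension to L^2 of [fourierL1]
   restricted to the dense subspace of L^1 and L^2 functions. *)
Definition is_fourier u g : Prop :=
  [/\ memLp lebesgue_spt 2%:E u, memLp lebesgue_spt 2%:E g &
    exists u_ : nat -> spacetime R n -> R[i],
      [/\ forall k, memLp lebesgue_spt 1%:E (u_ k) /\
                    memLp lebesgue_spt 2%:E (u_ k),
          cLnorm lebesgue_spt 2%:E (fun z => u_ k z - u z) @[k --> \oo] --> 0%E &
          cLnorm lebesgue_spt 2%:E (fun z => fourierL1 (u_ k) z - g z)
            @[k --> \oo] --> 0%E]].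

Definition heat_symbol (s : R) (zeta : spacetime R n) : R[i] :=
  cpow (((2 * pi * enorm zeta.1) ^+ 2) +i* (2 * pi * zeta.2)) s.

Definition Dom_frac_heat (s : R) u : Prop :=
  memLp lebesgue_spt 2%:E u /\
  exists uh, is_fourier u uh /\
    memLp lebesgue_spt 2%:E (fun zeta => heat_symbol s zeta * uh zeta).

(* [is_frac_heat s u w]: w is (a representative of) the L^2 function H^s u. *)
Definition is_frac_heat (s : R) u w : Prop :=
  exists uh, is_fourier u uh /\
    is_fourier w (fun zeta => heat_symbol s zeta * uh zeta).

(* On R[i], [0 <= w] means that w is real and nonnegative. *)
Definition strong_supersolution (s : R) u (D : set (spacetime R n)) : Prop :=
  exists w, is_frac_heat s u w /\
    {ae lebesgue_spt, forall z, D z -> 0 <= w z}.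

Definition cylinder (r : R) (I : interval R) : set (spacetime R n) :=
  [set z | eball r z.1 /\ ((z.2 : R) \in I)].

End fractional_heat.

(* Main.v *)
Require Import Defs.
From HB Require Import structures.
From mathcomp Require Import all_boot all_order all_algebra.
From mathcomp Require Import all_classical all_reals all_analysis.
From mathcomp Require Import measurable_realfun complex ring lra.

Set Implicit Arguments.
Unset Strict Implicit.
Unset Printing Implicit Defensive.

Import Order.TTheory GRing.Theory Num.Theory.
Import numFieldNormedType.Exports.

Local Open Scope classical_set_scope.
Local Open Scope complex_scope.
Local Open Scope ring_scope.

(* Let [V] be the Gaussian mollification of [v].  Subordination of the symbol,
   [kappa * lambda ^ s = int_0^oo tau ^ -(1 + s) (1 - exp (- tau lambda)) dtau],
   turns [H^s v >= 0] into a lower bound, up to an error that tends to [0] with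
   the width of the Gaussian, on the integral of [tau ^ -(1 + s) (V - P_tau V)],
   where [P_tau] is the caloric average.  The barrier
   [q(x, t) = exp (- |x|^2) + 2 t - 1/4] is positive on [U^+], negative before
   time [-3/8], and satisfies [P_tau q >= q - (4 n + 2) tau].  If [V - a q] were
   negative somewhere, then at a near-minimum [V - P_tau V] would be at most
   [a (4 n + 2) min (1, tau)] minus the heat received from [U^-], which is at least a
   fixed multiple of the mass of [V] there; for [a] a small multiple of that mass
   this contradicts the lower bound.  Hence [V >= a q], and the mollification is
   removed at the end. *)

(** * Measurability and integrability *)

(** The caloric averages look only into the past, so [V] and [a q] can be compared on a half-space
    [t <= - rho] without any data outside it. That half-space is unbounded, and the infimum of
    [V - a q] need not be attained. At a point within [theta] of the infimum one only gets
    [V - P_tau V <= theta + a (4 n + 2) tau], and [theta] times the weight is not integrable at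
    [tau = 0]. This is why [v] is mollified: then also [V - P_tau V <= C min (1, tau)], the defect
    becomes the integral of the weight times [min (theta, C min (1, tau))], and it tends to [0] with
    [theta] by dominated convergence. The constant [C] degenerates with the mollification but does
    not enter the final estimate. The margin [rho > 0] is there because a Gaussian centred near
    [t = 0] sees times at which nothing is known about [H^s v]; for fixed [rho] its tail there
    vanishes with the width, and [rho] tends to [0] only after the mollification has been removed.
    Complex identities are proved for real parts with a free phase; the imaginary part is the real
    part at a shifted phase. *)

Section measurable_rules.
Context d (T : measurableType d) {R : realType}.
Implicit Types (f g : T -> R).
Notation mfun f := (measurable_fun [set: T] f).

Lemma mfun_expR f : mfun f -> mfun (fun x => expR (f x)).
Proof. by move=> mf; apply: measurableT_comp mf; exact: measurable_expR. Qed.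

Lemma mfun_cos f : mfun f -> mfun (fun x => cos (f x)).
Proof. by move=> mf; apply: measurableT_comp mf; apply: continuous_measurable_fun; exact: continuous_cos. Qed.

Lemma mfun_sin f : mfun f -> mfun (fun x => sin (f x)).
Proof. by move=> mf; apply: measurableT_comp mf; apply: continuous_measurable_fun; exact: continuous_sin. Qed.

Lemma mfun_norm f : mfun f -> mfun (fun x => `|f x|).
Proof. by move=> mf; exact: measurableT_comp. Qed.

Lemma mfun_powR f p : mfun f -> mfun (fun x => f x `^ p).
Proof. by move=> mf; exact: (measurableT_comp (measurable_powR p) mf). Qed.

Lemma mfun_add f g : mfun f -> mfun g -> mfun (fun x => f x + g x).
Proof. by move=> mf mg; exact: measurable_funD. Qed.

Lemma mfun_opp f : mfun f -> mfun (fun x => - f x).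
Proof. by move=> mf; exact: measurable_funN. Qed.

Lemma mfun_mul f g : mfun f -> mfun g -> mfun (fun x => f x * g x).
Proof. by move=> mf mg; exact: measurable_funM. Qed.

Lemma mfun_exp f k : mfun f -> mfun (fun x => f x ^+ k).
Proof. by move=> mf; exact: measurable_funX. Qed.

Lemma mfun_min f g : mfun f -> mfun g -> mfun (fun x => Num.min (f x) (g x)).
Proof. by move=> mf mg; exact: measurable_minr. Qed.

Lemma mfun_max f g : mfun f -> mfun g -> mfun (fun x => Num.max (f x) (g x)).
Proof. by move=> mf mg; exact: measurable_maxr. Qed.

Lemma mfun_sum (I : Type) (s : seq I) (h : I -> T -> R) :
  (forall i, mfun (h i)) -> mfun (fun x => \sum_(i <- s) h i x).
Proof. by move=> mh; exact: measurable_sum. Qed.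

Lemma mfun_cst (c : R) : mfun (fun=> c).
Proof. exact: measurable_cst. Qed.

End measurable_rules.

Section integrable_rules.
Context d (T : measurableType d) {R : realType} (mu : {measure set T -> \bar R}).
Implicit Types (f g : T -> R) (D : set T).

Lemma integrableZl_fin D f r : measurable D -> mu.-integrable D (fun x => (f x)%:E) ->
  mu.-integrable D (fun x => (r * f x)%:E).
Proof. by move=> mD; exact: integrableZl. Qed.

Lemma integrableZr_fin D f r : measurable D -> mu.-integrable D (fun x => (f x)%:E) ->
  mu.-integrable D (fun x => (f x * r)%:E).
Proof. by move=> mD /(integrableZl_fin r mD); under eq_fun do rewrite mulrC. Qed.

Lemma integrableD_fin D f g : measurable D -> mu.-integrable D (fun x => (f x)%:E) ->
  mu.-integrable D (fun x => (g x)%:E) -> mu.-integrable D (fun x => (f x + g x)%:E).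
Proof. by move=> mD; exact: integrableD. Qed.

Lemma integrableB_fin D f g : measurable D -> mu.-integrable D (fun x => (f x)%:E) ->
  mu.-integrable D (fun x => (g x)%:E) -> mu.-integrable D (fun x => (f x - g x)%:E).
Proof. by move=> mD; exact: integrableB. Qed.

Lemma integrable_dominated f g : measurable_fun [set: T] f ->
  mu.-integrable setT (fun x => (g x)%:E) -> (forall x, `|f x| <= g x) ->
  mu.-integrable setT (fun x => (f x)%:E).
Proof.
move=> mf ig fg; apply: le_integrable ig => //; first exact/measurable_EFinP.
by move=> x _ /=; rewrite lee_fin (le_trans (fg x))// ler_norm.
Qed.

Lemma integrable_measurable f : mu.-integrable setT (fun x => (f x)%:E) -> measurable_fun [set: T] f.
Proof. by move=> /(measurable_int mu) /measurable_EFinP. Qed.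

End integrable_rules.

Ltac meas := repeat first [ assumption | exact: mfun_cst | exact: measurable_id
  | exact: measurable_fst | exact: measurable_snd | apply: mfun_exp | apply: mfun_cos | apply: mfun_sin
  | apply: mfun_expR | apply: mfun_norm | apply: mfun_powR | apply: mfun_min | apply: mfun_max | apply: mfun_opp
  | apply: mfun_add | apply: mfun_mul | (apply: mfun_sum; move=> ?) ].

(** * Deforming integrals of closed forms *)

Section closed_form.
Context {R : realType}.
Local Notation leb := (@lebesgue_measure R).

Lemma MVT_bound (F dF : R -> R) (e : R) :
  (forall p : R, 0 <= p <= 1 -> is_derive p 1 F (dF p)) ->
  (forall p : R, 0 <= p <= 1 -> `|dF p| <= e) -> `|F 1 - F 0| <= e.
Proof.
move=> dFp dFe.
have lt01 : (0 : R) < 1 by exact: ltr01.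
have oo (x : R) : x \in `]0, 1[ -> 0 <= x <= 1.
  by rewrite in_itv/= => /andP[x0 x1]; rewrite !ltW.
have cc (x : R) : x \in `[0, 1] -> 0 <= x <= 1 by rewrite in_itv.
have dFo (x : R) : x \in `]0, 1[ -> is_derive x 1 F (dF x) by move=> /oo; exact: dFp.
have cF : {within `[0, 1], continuous F}.
  by apply: derivable_within_continuous => x /cc x01; have [] := dFp x x01.
have [c /oo c01 ->] := MVT lt01 dFo cF.
by rewrite subr0 mulr1; exact: dFe.
Qed.

(* If [Phi dx + Psi dp] is closed, the horizontal sides of the rectangle
   contribute at most the vertical ones. *)
Lemma closed_form_variation (a b K e1 e2 : R) (Phi Psi D : R -> R -> R) :
  a < b -> 0 <= K ->
  (forall p : R, `]-1, 2[%classic p -> {within `[a, b], continuous (Phi p)}) ->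
  (forall p : R, `]-1, 2[%classic p -> {within `[a, b], continuous (D p)}) ->
  (forall p x : R, `]-1, 2[%classic p -> `[a, b]%classic x ->
     is_derive p 1 (Phi ^~ x) (D p x)) ->
  (forall p x : R, `]-1, 2[%classic p -> `[a, b]%classic x ->
     is_derive x 1 (Psi p) (D p x)) ->
  (forall p x : R, `]-1, 2[%classic p -> `[a, b]%classic x -> `|D p x| <= K) ->
  (forall p : R, 0 <= p <= 1 -> `|Psi p a| <= e1 /\ `|Psi p b| <= e2) ->
  `| \int[leb]_(x in `[a, b]) Phi 1 x - \int[leb]_(x in `[a, b]) Phi 0 x|
    <= e1 + e2.
Proof.
move=> ab K0 cPhi cD dPhi dPsi DK Psie.
pose F p := \int[leb]_(x in `[a, b]) Phi p x.
have iPhi p : `]-1, 2[%classic p -> leb.-integrable `[a, b] (EFin \o Phi p).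
  by move=> Ip; apply: continuous_compact_integrable; [exact: segment_compact|exact: cPhi].
have p1D p x : `]-1, 2[%classic p -> `[a, b]%classic x -> partial1of2 Phi p x = D p x.
  by move=> Ip Ix; rewrite partial1of2E; exact: (@derive_val _ _ _ _ _ _ _ (dPhi _ _ Ip Ix)).
have iK : leb.-integrable `[a, b] (EFin \o cst K).
  apply: continuous_compact_integrable; first exact: segment_compact.
  by apply: continuous_subspaceT => x; exact: cst_continuous.
(* The open interval []-1, 2[] contains [[0, 1]], so differentiation under the integral is two-sided
   at both ends; the constant [K] is the integrable majorant of the derivative. *)
have dF (p : R) : `]-1, 2[%classic p -> is_derive p 1 F (Psi p b - Psi p a).
  move=> Ip.
  have der (x y : R) : `]-1, 2[%classic x -> `[a, b]%classic y -> derivable (Phi ^~ y) x 1.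
    by move=> Ix Iy; have [] := dPhi _ _ Ix Iy.
  have ub (x y : R) : `]-1, 2[%classic x -> `[a, b]%classic y -> `|partial1of2 Phi x y| <= (cst K : R -> R) y.
    by move=> Ix Iy; rewrite p1D//; exact: DK.
  apply: DeriveDef.
    exact: (@derivable_under_integral _ _ _ leb Phi `[a, b] _ p (-1) 2 Ip iPhi der (cst K)).
  rewrite -derive1E.
  rewrite (@differentiation_under_integral _ _ _ leb Phi `[a, b] _ p (-1) 2 Ip iPhi der (cst K))//.
  rewrite (@eq_Rintegral _ _ _ leb `[a, b] (D p)); last first.
    by move=> x; rewrite inE => Ix; exact: p1D.
  rewrite /Rintegral (@continuous_FTC2 _ (D p) (Psi p))//=.
  - exact: cD.
  - have cP : {within `[a, b], continuous (Psi p)}.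
      by apply: derivable_within_continuous => x xab; have [] := dPsi _ _ Ip xab.
    have [d1 d2 d3] := (continuous_within_itvP (Psi p) ab).1 cP.
    split => //.
    move=> x xab; have [] // := dPsi p x Ip.
    by apply: (subset_itv_oo_cc xab).
  - move=> x xab; rewrite derive1E; exact: (@derive_val _ _ _ _ _ _ _ (dPsi p x Ip (subset_itv_oo_cc xab))).
have sub01 (x : R) : 0 <= x <= 1 -> `]-1, 2[%classic x.
  by move=> /andP[x0 x1]; rewrite /= in_itv/=; apply/andP; split; lra.
apply: (@MVT_bound F (fun p => Psi p b - Psi p a)) => p p01; first exact/dF/sub01.
have [h1 h2] := Psie p p01.
by rewrite (le_trans (ler_normB _ _))// addrC lerD.
Qed.

End closed_form.

Section exhaustion.
Context d (T : measurableType d) {R : realType} (mu : {measure set T -> \bar R}).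

(** Dominated convergence for the restrictions of [f]. The contour arguments are run on compact
    intervals, and this recovers the integral over the whole domain. *)
Lemma Rintegral_exhaustion (D : set T) (A : nat -> set T) (f : T -> R) :
  measurable D -> (forall k, measurable (A k)) -> (forall k, A k `<=` D) ->
  (forall x, D x -> \forall k \near \oo, A k x) ->
  mu.-integrable D (EFin \o f) ->
  \int[mu]_(x in A k) f x @[k --> \oo] --> \int[mu]_(x in D) f x.
Proof.
move=> mD mA AD DA fi; apply: fine_cvg; rewrite fineK; last exact: integrable_fin_num.
rewrite (_ : (fun k => _) = fun k => (\int[mu]_(x in D `&` A k) (EFin \o f) x)%E); last first.
  by apply/funext => k; rewrite setIidr.
under eq_fun do rewrite integral_mkcondr.
have mf := measurable_int mu fi.
apply: (@dominated_cvg _ _ _ mu D mD _ (EFin \o f) (abse \o (EFin \o f))) => //.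
- move=> k; apply/measurable_restrict => //.
  by apply: measurable_funS mf => //; exact: subIsetl.
- move=> x Dx; apply: cvg_near_cst; near=> k.
  rewrite patchE mem_set//.
  by near: k; exact: DA.
- exact: integrable_abse.
- move=> k x Dx; rewrite patchE; case: ifPn => //= _.
  by rewrite normr0 lee_fin.
Unshelve. all: by end_near. Qed.

End exhaustion.

(** * Gaussian integrals on the line and their Fourier transforms *)

Section gauss1.
Context {R : realType}.
Local Notation leb := (@lebesgue_measure R).

(** The integrand is [sqrt (pi / c)] times the normal density of mean [m] and variance
    [1 / (2 c)]. *)
Lemma integral_gauss (c m : R) : 0 < c ->
  leb.-integrable setT (fun x => (expR (- (c * (x - m) ^+ 2)))%:E) /\
  \int[leb]_x expR (- (c * (x - m) ^+ 2)) = Num.sqrt (pi / c).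
Proof.
move=> c0.
pose s := Num.sqrt ((2 * c)^-1).
have s2 : s ^+ 2 = (2 * c)^-1 by rewrite sqr_sqrtr// invr_ge0 mulr_ge0// ltW.
have s0 : s != 0 by rewrite gt_eqF// sqrtr_gt0 invr_gt0 mulr_gt0.
have pic0 : 0 < pi / c by rewrite divr_gt0// pi_gt0.
have cn : c != 0 by rewrite gt_eqF.
have E x : expR (- (c * (x - m) ^+ 2)) = Num.sqrt (pi / c) * normal_pdf m s x.
  rewrite normal_pdfE// /normal_peak /normal_fun s2.
  rewrite [RHS]mulrA -[X in (Num.sqrt X)^-1]mulr_natr.
  have -> : (2 * c)^-1 * pi * 2 = pi / c by field.
  rewrite mulfV ?mul1r ?gt_eqF ?sqrtr_gt0//; congr expR.
  by rewrite -[X in _ / X]mulr_natr; field; rewrite cn.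
have Ef : (fun x => (expR (- (c * (x - m) ^+ 2)))%:E) = (fun x => ((Num.sqrt (pi / c))%:E * (normal_pdf m s x)%:E)%E).
  by apply/funext => x; rewrite E EFinM.
split.
  by rewrite Ef; apply: integrableZl => //; exact: integrable_normal_pdf.
rewrite /Rintegral Ef integralZl//; last exact: integrable_normal_pdf.
by rewrite integral_normal_pdf// mule1.
Qed.

End gauss1.

Section derive_rules.
Context {R : realType}.
Implicit Types (f g : R -> R) (x df dg : R).

Lemma is_derive_expRf f x df :
  is_derive x 1 f df -> is_derive x 1 (fun y => expR (f y)) (expR (f x) * df).
Proof. by move=> fx; have := @is_derive1_comp _ expR f x _ _ (is_derive_expR (f x)) fx. Qed.

Lemma is_derive_cosf f x df :
  is_derive x 1 f df -> is_derive x 1 (fun y => cos (f y)) (- sin (f x) * df).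
Proof. by move=> fx; have := @is_derive1_comp _ cos f x _ _ (is_derive_cos (f x)) fx. Qed.

Lemma is_derive_sinf f x df :
  is_derive x 1 f df -> is_derive x 1 (fun y => sin (f y)) (cos (f x) * df).
Proof. by move=> fx; have := @is_derive1_comp _ sin f x _ _ (is_derive_sin (f x)) fx. Qed.

Lemma is_derive_mulf f g x df dg : is_derive x 1 f df -> is_derive x 1 g dg ->
  is_derive x 1 (fun y => f y * g y) (df * g x + f x * dg).
Proof.
move=> fx gx; have h := @is_deriveM _ _ f g x 1 df dg fx gx.
by apply: is_derive_eq h _; rewrite addrC [_ *: df]mulrC.
Qed.

Lemma is_derive_addf f g x df dg : is_derive x 1 f df -> is_derive x 1 g dg ->
  is_derive x 1 (fun y => f y + g y) (df + dg).
Proof. by move=> fx gx; have := @is_deriveD _ _ _ f g x 1 df dg fx gx. Qed.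

Lemma is_derive_oppf f x df : is_derive x 1 f df ->
  is_derive x 1 (fun y => - f y) (- df).
Proof. by move=> fx; have := @is_deriveN _ _ _ f x 1 df fx. Qed.

Lemma is_derive_sqrf f x df : is_derive x 1 f df ->
  is_derive x 1 (fun y => f y ^+ 2) (2 * f x * df).
Proof.
move=> fx; have h := is_derive_mulf fx fx.
rewrite (_ : (fun y => _) = fun y => f y * f y); last by apply/funext => y; rewrite expr2.
by apply: is_derive_eq h _; ring.
Qed.

Lemma is_derive_cstf (c x : R) : is_derive x 1 (fun=> c) 0.
Proof. exact: is_derive_cst. Qed.

Lemma is_derive_idf x : is_derive x 1 (fun y => y) 1.
Proof. exact: is_derive_id. Qed.

Lemma is_derive_within_continuous f (a b : R) :
  (forall x : R, `[a, b]%classic x -> exists df, is_derive x 1 f df) -> {within `[a, b], continuous f}.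
Proof.
by move=> h; apply: derivable_within_continuous => x /h[df []].
Qed.

Lemma sin_max (x : R) : `|sin x| <= 1.
Proof. by rewrite ler_norml sin_geN1 sin_le1. Qed.

End derive_rules.

Ltac derive_tac := repeat first [exact: is_derive_cstf | exact: is_derive_idf |
  apply: is_derive_addf | apply: is_derive_oppf | apply: is_derive_sqrf | apply: is_derive_expRf
  | apply: is_derive_cosf | apply: is_derive_sinf | apply: is_derive_mulf].

Section gauss1.
Context {R : realType}.
Local Notation leb := (@lebesgue_measure R).

(** With [y = x - m], [Phi p] is the real part of [exp (i e) exp (- c (y - i p k / (2 c)) ^ 2)]: the
    line of integration is shifted from the real axis ([p = 0]) to the height at which the
    oscillation [k] appears ([p = 1]). [Psi] is the component of the closed form along the shift, so
    only its values at [y = N] and [y = - N] enter the error. *)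
Lemma gauss_fourier1_itv (c m k e N : R) : 0 < c -> 0 < N ->
 `|\int[leb]_(x in `[m - N, m + N]) (expR (k ^+ 2 / (4 * c)) * expR (- (c * (x - m) ^+ 2)) * cos (k * (x - m) + e)) -
   \int[leb]_(x in `[m - N, m + N]) (expR (- (c * (x - m) ^+ 2)) * cos e)| <=
 `|k| / c * expR (k ^+ 2 / (4 * c)) * expR (- (c * N ^+ 2)).
Proof.
move=> c0 N0; have cn : c != 0 by rewrite gt_eqF.
pose Phi p x := expR ((p * k) ^+ 2 / (4 * c)) * expR (- (c * (x - m) ^+ 2)) * cos (p * k * (x - m) + e).
pose Psi p x := k / (2 * c) * (expR ((p * k) ^+ 2 / (4 * c)) * expR (- (c * (x - m) ^+ 2))) * sin (p * k * (x - m) + e).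
pose D p x := expR ((p * k) ^+ 2 / (4 * c)) * expR (- (c * (x - m) ^+ 2)) *
  (p * k ^+ 2 / (2 * c) * cos (p * k * (x - m) + e) - k * (x - m) * sin (p * k * (x - m) + e)).
have dPhi (p x : R) : is_derive p 1 (Phi ^~ x) (D p x).
  by apply: is_derive_eq; rewrite /D /GRing.scale/=; field.
have dPhix (p x : R) : exists u, is_derive x 1 (Phi p) u.
  by eexists; rewrite /Phi; cbv beta; derive_tac.
have dDx (p x : R) : exists u, is_derive x 1 (D p) u.
  by eexists; rewrite /D; cbv beta; derive_tac.
have dPsi (p x : R) : is_derive x 1 (Psi p) (D p x).
  by apply: is_derive_eq; rewrite /D /GRing.scale/=; field.
(* A crude bound for [D]: [p ^ 2 <= 4] on []-1, 2[] turns [(p k) ^ 2 / (4 c)] into [k ^ 2 / c]. *)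
pose B := expR (k ^+ 2 / c) * (k ^+ 2 / c + `|k| * N).
have B0 : 0 <= B.
  apply: mulr_ge0; first exact: expR_ge0.
  apply: addr_ge0; first by rewrite divr_ge0 ?sqr_ge0// ltW.
  by rewrite mulr_ge0// ltW.
pose e1 := `|k| / (2 * c) * expR (k ^+ 2 / (4 * c)) * expR (- (c * N ^+ 2)).
have -> : `|k| / c * expR (k ^+ 2 / (4 * c)) * expR (- (c * N ^+ 2)) = e1 + e1.
  by rewrite /e1; field.
have mN : m - N < m + N by lra.
have -> : (fun x => expR (k ^+ 2 / (4 * c)) * expR (- (c * (x - m) ^+ 2)) * cos (k * (x - m) + e)) = Phi 1.
  by apply/funext => x; rewrite /Phi !mul1r.
have -> : (fun x => expR (- (c * (x - m) ^+ 2)) * cos e) = Phi 0.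
  by apply/funext => x; rewrite /Phi !mul0r expr0n/= mul0r expR0 mul1r add0r.
apply: (@closed_form_variation R (m - N) (m + N) B e1 e1 Phi Psi D mN B0) => //.
- by move=> p _; apply: is_derive_within_continuous.
- by move=> p _; apply: is_derive_within_continuous.
- move=> p x; rewrite /= !in_itv/= => /andP[p1 p2] /andP[x1 x2].
  rewrite /D normrM /B ler_pM//.
    rewrite ger0_norm ?mulr_ge0 ?expR_ge0// -[leRHS]mulr1 ler_pM ?expR_ge0//.
      rewrite ler_expR ler_pdivrMr ?mulr_gt0// exprMn.
      have -> : k ^+ 2 / c * (4 * c) = 4 * k ^+ 2 by field.
      by rewrite ler_wpM2r ?sqr_ge0//; nra.
    by rewrite -expR0 ler_expR oppr_le0 mulr_ge0 ?sqr_ge0// ltW.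
  rewrite (le_trans (ler_normB _ _))// lerD//.
    rewrite normrM -[leRHS]mulr1 ler_pM// ?cos_max//.
    rewrite normrM normfV normrM (ger0_norm (sqr_ge0 k)) (@gtr0_norm _ (2 * c)) ?mulr_gt0//.
    rewrite ler_pdivrMr ?mulr_gt0//.
    have -> : k ^+ 2 / c * (2 * c) = 2 * k ^+ 2 by field.
    by rewrite ler_wpM2r ?sqr_ge0// ler_norml; apply/andP; split; lra.
  rewrite normrM -[leRHS]mulr1 ler_pM// ?sin_max// normrM ler_wpM2l//.
  by rewrite ler_norml; apply/andP; split; lra.
- move=> p /andP[p0 p1].
  have E1 (x : R) : (x - m) ^+ 2 = N ^+ 2 -> `|Psi p x| <= e1.
    move=> xN; rewrite /Psi xN !normrM -[leRHS]mulr1 ler_pM// ?sin_max//.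
    rewrite /e1 normfV (@gtr0_norm _ (2 * c)) ?mulr_gt0// !(ger0_norm (expR_ge0 _)).
    have c20 : 0 <= 2 * c by rewrite mulr_ge0// ltW.
    have c40 : 0 <= (4 * c)^-1 by rewrite invr_ge0 mulr_ge0// ltW.
    rewrite mulrA ler_wpM2r ?expR_ge0// ler_wpM2l ?divr_ge0//.
    rewrite ler_expR ler_wpM2r//.
    by rewrite exprMn ler_piMl ?sqr_ge0// expr_le1.
  by split; apply: E1; ring.
Qed.

Lemma integrable_gauss_cos (c m k d : R) : 0 < c ->
  leb.-integrable setT (fun x => (expR (- (c * (x - m) ^+ 2)) * cos (k * x + d))%:E).
Proof.
move=> c0; have [ig _] := integral_gauss m c0.
have mg : measurable_fun [set: R] (fun x : R => expR (- (c * (x - m) ^+ 2)) * cos (k * x + d)).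
  by meas.
apply: le_integrable ig => //; first exact/measurable_EFinP.
move=> x _ /=; rewrite lee_fin normrM -[leRHS]mulr1 ler_pM// cos_max//.
Qed.

Lemma cvg_expR_sqr (c : R) : 0 < c ->
  expR (- (c * j.+1%:R ^+ 2)) @[j --> \oo] --> (0 : R).
Proof.
move=> c0; apply/cvgrPdist_lt => e e0; near=> j.
rewrite sub0r normrN ger0_norm ?expR_ge0//.
have cj : (c * e)^-1 < j.+1%:R.
  have : (c * e)^-1 < j%:R by near: j; exact: nbhs_infty_gtr.
  by move/lt_le_trans; apply; rewrite ler_nat.
have cj2 : e^-1 < c * j.+1%:R ^+ 2.
  apply: (@lt_le_trans _ _ (c * j.+1%:R)).
    by rewrite -ltr_pdivrMl// -invfM.
  by rewrite ler_wpM2l ?(ltW c0)// expr2 ler_peMr// ler1n.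
rewrite expRN invf_plt ?posrE ?expR_gt0//; apply: (lt_le_trans cj2).
by rewrite (le_trans _ (expR_ge1Dx _))// lerDr.
Unshelve. all: by end_near. Qed.

(** The truncated identity holds up to an error of order [exp (- c N ^ 2)], which disappears along
    the intervals of radius [N = j + 1]. *)
Lemma gauss_fourier1 (c m k d : R) : 0 < c ->
  \int[leb]_x (expR (- (c * (x - m) ^+ 2)) * cos (k * x + d)) =
  Num.sqrt (pi / c) * expR (- (k ^+ 2 / (4 * c))) * cos (k * m + d).
Proof.
move=> c0; set e := k * m + d.
have [ig Ig] := integral_gauss m c0.
have ig' := integrable_gauss_cos m k d c0.
have ic : leb.-integrable setT (fun x => (expR (- (c * (x - m) ^+ 2)) * cos e)%:E).
  by have := integrable_gauss_cos m 0 e c0; under eq_fun do rewrite mul0r add0r.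
pose A (j : nat) : set (measurableTypeR R) := `[m - j.+1%:R, m + j.+1%:R]%classic.
have mA j : measurable (A j) by exact: measurable_itv.
have AT j : A j `<=` setT by [].
have Aoo (x : R) : setT x -> \forall j \near \oo, A j x.
  move=> _; near=> j; rewrite /A/= in_itv/=.
  have : `|x - m| < j.+1%:R.
    have : `|x - m| < j%:R by near: j; exact: nbhs_infty_gtr.
    by move/lt_le_trans; apply; rewrite ler_nat.
  by rewrite ltr_norml => /andP[? ?]; apply/andP; split; lra.
have h1 := @Rintegral_exhaustion _ _ _ leb setT A _ measurableT mA AT Aoo ig'.
have h2 := @Rintegral_exhaustion _ _ _ leb setT A _ measurableT mA AT Aoo ic.
pose E := expR (k ^+ 2 / (4 * c)).
suff : E * \int[leb]_x (expR (- (c * (x - m) ^+ 2)) * cos (k * x + d)) = \int[leb]_x (expR (- (c * (x - m) ^+ 2)) * cos e).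
  rewrite RintegralZr// Ig => /(congr1 ( *%R E^-1)).
  rewrite mulrA mulVf ?mul1r ?gt_eqF ?expR_gt0// => ->.
  by rewrite /E -expRN; ring.
apply/eqP; rewrite -subr_eq0 -normr_le0.
pose I1 j := \int[leb]_(x in A j) (expR (- (c * (x - m) ^+ 2)) * cos (k * x + d)).
pose I2 j := \int[leb]_(x in A j) (expR (- (c * (x - m) ^+ 2)) * cos e).
set J1 := \int[leb]_x _; set J2 := \int[leb]_x _.
have h3 : `|E * I1 j - I2 j| @[j --> \oo] --> `|E * J1 - J2|.
  by apply: cvg_norm; apply: cvgB; [apply: cvgM; [exact: cvg_cst|exact: h1]|exact: h2].
have h4 : `|k| / c * E * expR (- (c * j.+1%:R ^+ 2)) @[j --> \oo] --> (0 : R).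
  by rewrite -[X in _ --> X](mulr0 (`|k| / c * E)); apply: cvgM; [exact: cvg_cst|exact: cvg_expR_sqr].
apply: (ler_cvg_to h3 h4); near=> j.
have := gauss_fourier1_itv m k e c0 (ltr0Sn R j).
rewrite -/E => /(le_trans _); apply.
rewrite le_eqVlt; apply/orP; left; apply/eqP; congr (`|_ - _|).
have iA : leb.-integrable (A j) (EFin \o (fun x => expR (- (c * (x - m) ^+ 2)) * cos (k * x + d))).
  by apply: integrableS ig' => //; exact: mA.
rewrite /I1 -(@RintegralZl _ _ _ leb (A j) _ E (mA j) iA).
by apply: eq_Rintegral => x _; rewrite -mulrA /e; congr (_ * (_ * cos _)); ring.
Unshelve. all: by end_near. Qed.
End gauss1.

(** * The subordination formula *)

Section weight.
Context {R : realType} (s : R) (s0 : 0 < s) (s1 : s < 1).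
Local Notation leb := (@lebesgue_measure R).

(** By Fatou's lemma, a uniform bound along an exhaustion suffices for a nonnegative function. *)
Lemma ge0_integrable_exhaustion d (T : measurableType d) (mu : {measure set T -> \bar R})
    (D : set T) (A : nat -> set T) (f : T -> R) (C : R) :
  measurable D -> (forall k, measurable (A k)) -> (forall k, A k `<=` D) ->
  (forall x, D x -> \forall k \near \oo, A k x) ->
  measurable_fun D f -> (forall x, D x -> 0 <= f x) ->
  (forall k, (\int[mu]_(x in A k) (f x)%:E <= C%:E)%E) ->
  mu.-integrable D (EFin \o f).
Proof.
move=> mD mA AD DA mf f0 fC; apply/integrableP; split; first exact/measurable_EFinP.
rewrite (@eq_integral _ _ _ _ _ (EFin \o f)); last first.
  by move=> x; rewrite inE => Dx /=; rewrite ger0_norm// f0.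
apply: (@le_lt_trans _ _ C%:E); last exact: ltry.
have mg k : measurable_fun D ((EFin \o f) \_ (A k)).
  apply/measurable_restrict => //; apply: (@measurable_funS _ _ _ _ D) => //.
  exact/measurable_EFinP.
have g0 k x : D x -> (0 <= ((EFin \o f) \_ (A k)) x)%E.
  by move=> Dx; rewrite patchE; case: ifPn => // _; rewrite lee_fin f0.
have := fatou mu mD mg g0.
rewrite (@eq_integral _ _ _ _ _ (EFin \o f)); last first.
  move=> x; rewrite inE => Dx.
  have h : ((EFin \o f) \_ (A k)) x @[k --> \oo] --> (f x)%:E.
    apply: cvg_near_cst; near=> k; rewrite patchE mem_set//.
    by near: k; exact: DA.
  by rewrite is_cvg_limn_einfE; [exact/cvg_lim|apply/cvg_ex; eexists; exact: h].
move/le_trans; apply.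
rewrite limn_einf_lim; apply: lime_le; first exact: is_cvg_einfs.
apply: nearW => k; apply: ge_ereal_inf; exists (\int[mu]_(x in D) ((EFin \o f) \_ (A k)) x)%E.
  by exists k => /=.
by rewrite -integral_mkcondr setIidr.
Unshelve. all: by end_near. Qed.

Lemma Rintegral_powR (r a b : R) : 0 < a -> a < b -> r + 1 != 0 ->
  (\int[leb]_(x in `[a, b]) (x `^ r)%:E = ((b `^ (r + 1) - a `^ (r + 1)) / (r + 1))%:E)%E.
Proof.
move=> a0 ab r1.
have d1 (x p : R) : 0 < x -> is_derive x 1 (fun y => y `^ p) (p * x `^ (p - 1)).
  by move=> x0; exact: is_derive1_powR.
have d2 (x : R) : `[a, b]%classic x -> is_derive x 1 (fun y => y `^ (r + 1) * (r + 1)^-1) (x `^ r).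
  rewrite /= in_itv/= => /andP[ax _]; have x0 := lt_le_trans a0 ax.
  have h := is_derive_mulf (d1 x (r + 1) x0) (is_derive_cstf (r + 1)^-1 x).
  by apply: is_derive_eq h _; rewrite addrK; field.
have cF : {within `[a, b], continuous (fun y => y `^ (r + 1) * (r + 1)^-1)}.
  by apply: is_derive_within_continuous => x /d2 h; eexists; exact: h.
rewrite (@continuous_FTC2 _ _ (fun y => y `^ (r + 1) * (r + 1)^-1))//.
- by rewrite -EFinB mulrBl.
- apply: is_derive_within_continuous => x; rewrite /= in_itv/= => /andP[ax _].
  by eexists; apply: d1; exact: lt_le_trans ax.
- have [_ h2 h3] := (continuous_within_itvP _ ab).1 cF; split=> //.
  by move=> x /subset_itv_oo_cc /d2[].
- move=> x /subset_itv_oo_cc /d2 h; rewrite derive1E.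
  exact: (@derive_val _ _ _ _ _ _ _ h).
Qed.

(** The density of the jump measure in the subordination formula. The indicator lets all integrals
    in [tau] run over the whole line. *)
Definition jump_weight (x : R) : R := x `^ (- (1 + s)) * \1_`]0, +oo[ x.

Lemma jump_weight_ge0 x : 0 <= jump_weight x.
Proof. by rewrite mulr_ge0// powR_ge0. Qed.

Lemma jump_weight_neg x : x <= 0 -> jump_weight x = 0.
Proof.
move=> x0; rewrite /jump_weight indicE memNset ?mulr0//=.
by rewrite in_itv/= andbT; apply/negP; rewrite -leNgt.
Qed.

Lemma jump_weight_pos x : 0 < x -> jump_weight x = x `^ (- (1 + s)).
Proof.
by move=> x0; rewrite /jump_weight indicE mem_set ?mulr1//= in_itv/= x0.
Qed.

Lemma measurable_jump_weight : measurable_fun [set: measurableTypeR R] jump_weight.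
Proof.
apply: mfun_mul; first by meas.
by apply: measurable_indic; exact: measurable_itv.
Qed.

(** Up to [1] the integrand is [x ^ (- s)], integrable since [s < 1]; beyond [1] it is
    [x ^ (- (1 + s))], integrable since [0 < s]. The two pieces contribute at most [1 / (1 - s)] and
    [1 / s]. *)
Lemma integrable_jump_weight :
  leb.-integrable setT (fun x => (jump_weight x * Num.min 1 x)%:E).
Proof.
have mf : measurable_fun [set: measurableTypeR R] (fun x : measurableTypeR R => jump_weight x * Num.min 1 x).
  by apply: mfun_mul; [exact: measurable_jump_weight|meas].
have f0 x : 0 <= jump_weight x * Num.min 1 x.
  have [x0|x0] := leP x 0; first by rewrite jump_weight_neg// mul0r.
  by rewrite mulr_ge0 ?jump_weight_ge0// le_min ler01 ltW.
pose D : set (measurableTypeR R) := `]0, +oo[%classic.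
have mD : measurable D by exact: measurable_itv.
have fD : (fun x : measurableTypeR R => (jump_weight x * Num.min 1 x)%:E) = (fun x => (jump_weight x * Num.min 1 x)%:E) \_ D.
  apply/funext => x; rewrite patchE; case: ifPn => //.
  rewrite notin_setE /D/= in_itv/= andbT => /negP; rewrite -leNgt => x0.
  by rewrite jump_weight_neg// mul0r.
rewrite fD; apply/(integrable_mkcond _ mD).
pose A (j : nat) : set (measurableTypeR R) := `[j.+2%:R^-1, j.+2%:R]%classic.
have mA j : measurable (A j) by exact: measurable_itv.
have j0 (j : nat) : (0 : R) < j.+2%:R^-1 by rewrite invr_gt0.
have j1 (j : nat) : j.+2%:R^-1 < (1 : R) by rewrite invf_lt1// ltr1n.
have j2 (j : nat) : (1 : R) < j.+2%:R by rewrite ltr1n.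
have mfS (B : set (measurableTypeR R)) : measurable_fun B (fun x : measurableTypeR R => (jump_weight x * Num.min 1 x)%:E).
  by apply: measurable_funTS; exact/measurable_EFinP.
apply: (@ge0_integrable_exhaustion _ _ leb D A _ ((1 - s)^-1 + s^-1)) => //.
- move=> j x; rewrite /A /D/= !in_itv/= andbT => /andP[+ _].
  exact: lt_le_trans.
- move=> x; rewrite /D/= in_itv/= andbT => x0; near=> j; rewrite /A/= in_itv/=; apply/andP; split.
    rewrite invf_ple ?posrE//.
    have : x^-1 < j%:R by near: j; exact: nbhs_infty_gtr.
    by move/ltW/le_trans; apply; rewrite ler_nat -addn2 leq_addr.
  have : x < j%:R by near: j; exact: nbhs_infty_gtr.
  by move/ltW/le_trans; apply; rewrite ler_nat -addn2 leq_addr.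
- exact: measurable_funTS.
move=> j.
have AE : A j = `[j.+2%:R^-1, 1]%classic `|` `]1, j.+2%:R]%classic.
  rewrite /A -itv_bndbnd_setU//= ?bnd_simp ltW//.
rewrite AE ge0_integral_setU//=; last 2 first.
- by move=> x _; rewrite lee_fin f0.
- rewrite disj_set2E; apply/eqP; rewrite -subset0 => x []/=; rewrite !in_itv/= => /andP[_ x1] /andP[].
  by rewrite ltNge x1.
rewrite EFinD; apply: leeD.
  rewrite (@eq_integral _ _ _ _ _ (fun x : measurableTypeR R => (x `^ (- s))%:E)); last first.
    move=> x; rewrite inE/= in_itv/= => /andP[x0 x1].
    have xp := lt_le_trans (j0 j) x0.
    rewrite jump_weight_pos// min_r// -[X in _ * X](powRr1 (ltW xp)) -powRD; last by apply/implyP => _; rewrite gt_eqF.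
    by congr ((_ `^ _)%:E); ring.
  rewrite (Rintegral_powR (j0 j) (j1 j)); last by rewrite gt_eqF// addrC subr_gt0.
  have s1' : 0 < 1 - s by rewrite subr_gt0.
  rewrite lee_fin powR1 (addrC (- s)) ler_pdivrMr// mulVf; last by rewrite gt_eqF.
  by rewrite gerBl powR_ge0.
have h : (\int[leb]_(x in `]1%R, j.+2%:R]) (jump_weight x * Num.min 1 x)%:E <=
  \int[leb]_(x in `[1%R, j.+2%:R]) (jump_weight x * Num.min 1 x)%:E)%E.
  apply: ge0_subset_integral => //=.
  - by move=> x _; rewrite lee_fin f0.
  - by apply: subset_itv; rewrite bnd_simp.
apply: (le_trans h).
rewrite (@eq_integral _ _ _ _ _ (fun x : measurableTypeR R => (x `^ (- (1 + s)))%:E)); last first.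
  move=> x; rewrite inE/= in_itv/= => /andP[x1 _].
  by rewrite jump_weight_pos ?(lt_le_trans ltr01)// min_l// mulr1.
rewrite (Rintegral_powR ltr01 (j2 j)); last by rewrite opprD addrAC addNr add0r oppr_eq0 gt_eqF.
rewrite lee_fin opprD addrAC addNr add0r powR1 -mulrNN opprB -invrN opprK.
rewrite ler_pdivrMr// mulVf; last by rewrite gt_eqF.
by rewrite gerBl powR_ge0.
Unshelve. all: by end_near. Qed.

Lemma cos_lipschitz (c d : R) : `|cos c - cos d| <= `|c - d|.
Proof.
pose F (p : R) := cos (d + p * (c - d)).
have dF (p : R) : is_derive p 1 F (- sin (d + p * (c - d)) * (c - d)).
  by apply: is_derive_eq; rewrite /GRing.scale/=; ring.
have := @MVT_bound R F _ `|c - d| (fun p _ => dF p).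
rewrite /F mul1r mul0r addr0 addrCA subrr addr0; apply => p _.
by rewrite normrM normrN ler_piMl// sin_max.
Qed.

(** The difference is the real part of [exp (i c) (1 - exp (- t (X + i Y)))]. For [t <= 1] the phase
    and the damping factor each change by at most their rate times [t]; for larger [t] the trivial
    bound [2] remains, because [0 <= X]. *)
Lemma cos_jump_bound (X Y c t : R) : 0 <= X -> 0 <= t ->
  `|cos c - expR (- (t * X)) * cos (c - t * Y)| <= (2 + X + `|Y|) * Num.min 1 t.
Proof.
move=> X0 t0.
have tX0 : 0 <= t * X by rewrite mulr_ge0.
have E0 : 0 <= expR (- (t * X)) by exact: expR_ge0.
have E1 : expR (- (t * X)) <= 1 by rewrite -expR0 ler_expR oppr_le0.
have [t1|t1] := leP t 1.
  have -> : cos c - expR (- (t * X)) * cos (c - t * Y) =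
    (cos c - cos (c - t * Y)) + (1 - expR (- (t * X))) * cos (c - t * Y) by ring.
  rewrite (le_trans (ler_normD _ _))//.
  have h1 : `|cos c - cos (c - t * Y)| <= t * `|Y|.
    by rewrite (le_trans (cos_lipschitz _ _))// opprB addrC subrK normrM (ger0_norm t0).
  have h2 : `|(1 - expR (- (t * X))) * cos (c - t * Y)| <= t * X.
    rewrite normrM -[leRHS]mulr1 ler_pM// ?cos_max// ger0_norm ?subr_ge0//.
    by have := expR_ge1Dx (- (t * X)); lra.
  apply: (le_trans (lerD h1 h2)); nra.
rewrite mulr1.
apply: (@le_trans _ _ (1 + 1)).
  rewrite (le_trans (ler_normB _ _))// lerD ?cos_max// normrM -[leRHS]mulr1.
  by rewrite ler_pM// ?cos_max// ger0_norm.
by have := normr_ge0 Y; lra.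
Qed.

Lemma sin_jump_bound (X Y c t : R) : 0 <= X -> 0 <= t ->
  `|sin c - expR (- (t * X)) * sin (c - t * Y)| <= (2 + X + `|Y|) * Num.min 1 t.
Proof.
move=> X0 t0; have := @cos_jump_bound X Y (c - pi / 2) t X0 t0.
have cs (y : R) : cos (y - pi / 2) = sin y by apply: cosBpihalf.
by rewrite -addrA [- (pi / 2) - _]addrC addrA !cs.
Qed.

End weight.

Section jump_integral.
Context {R : realType} (s : R) (s0 : 0 < s) (s1 : s < 1).
Local Notation leb := (@lebesgue_measure R).

Lemma cvg_powR_infty (q : R) : 0 < q -> j.+2%:R `^ (- q) @[j --> \oo] --> (0 : R).
Proof.
move=> q0; apply/cvgrPdist_lt => e e0; near=> j.
rewrite sub0r normrN ger0_norm ?powR_ge0// powRN invf_plt ?posrE ?powR_gt0//.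
have h : (e^-1) `^ (q^-1) < j.+2%:R.
  have : (e^-1) `^ (q^-1) < j%:R by near: j; exact: nbhs_infty_gtr.
  by move/lt_le_trans; apply; rewrite ler_nat -addn2 leq_addr.
have e1 : 0 <= e^-1 by rewrite invr_ge0 ltW.
have -> : e^-1 = ((e^-1) `^ (q^-1)) `^ q by rewrite -powRrM mulVf ?gt_eqF// powRr1.
by apply: gt0_ltr_powR => //; rewrite nnegrE ?powR_ge0.
Unshelve. all: by end_near. Qed.

(** With [lambda = X + i Y] this is the weight times the real part of
    [exp (i c) (1 - exp (- x lambda))]; the free phase [c] makes both parts of a complex identity
    instances of one real identity. *)
Definition jump (X Y c x : R) : R :=
  jump_weight s x * (cos c - expR (- (x * X)) * cos (c - x * Y)).

Lemma jump_le (X Y c x : R) : 0 <= X ->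
  `|jump X Y c x| <= (2 + X + `|Y|) * (jump_weight s x * Num.min 1 x).
Proof.
move=> X0; have [x0|x0] := leP x 0.
  by rewrite /jump jump_weight_neg// !mul0r mulr0 normr0.
rewrite /jump normrM ger0_norm ?jump_weight_ge0// mulrCA ler_wpM2l ?jump_weight_ge0//.
exact: cos_jump_bound (ltW x0).
Qed.

Lemma measurable_jump (X Y c : R) : measurable_fun [set: measurableTypeR R] (jump X Y c).
Proof. by apply: mfun_mul; [exact: measurable_jump_weight|meas]. Qed.

Lemma integrable_jump (X Y c : R) : 0 <= X ->
  leb.-integrable setT (EFin \o jump X Y c).
Proof.
move=> X0; have h := integrableZl measurableT (2 + X + `|Y|) (integrable_jump_weight s0 s1).
apply: le_integrable h => //.
  by apply/measurable_EFinP; exact: measurable_jump.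
by move=> x _ /=; rewrite lee_fin (le_trans (jump_le _ _ _ X0))// ler_norm.
Qed.

(* The constant [kappa] of the subordination formula, which is its value at
   [lambda = 1]. *)
Definition jump_const : R := \int[leb]_x jump 1 0 0 x.

Lemma jump_const_ge0 : 0 <= jump_const.
Proof.
apply: Rintegral_ge0 => x _; have [x0|x0] := leP x 0.
  by rewrite /jump jump_weight_neg// mul0r.
apply: mulr_ge0; first exact: jump_weight_ge0.
rewrite mulr0 subr0 cos0 !mulr1 subr_ge0.
by rewrite -[leRHS]expR0 ler_expR oppr_le0 ltW.
Qed.

Section path.
Variables (rho om c : R).
Hypothesis om_pihalf : - (pi / 2) <= om <= pi / 2.

(** Put [lambda_p = X p - i Y p = exp (p (rho - i om))]. The closed form is the real part of
    [exp (i c)] times the pull-back of [u ^ (- (1 + s)) (1 - exp (- u)) du] along [u = t lambda_p]: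
    [Phi] is its [dt] component, [Psi] its [dp] component, and [A], [B] are the real and imaginary
    parts of [exp (i al) (1 - exp (- t lambda_p))]. *)
Let X p := expR (p * rho) * cos (p * om).
Let Y p := expR (p * rho) * sin (p * om).
Let al p := s * (p * om) + c.
Let A p t := cos (al p) - expR (- (t * X p)) * cos (al p + t * Y p).
Let B p t := sin (al p) - expR (- (t * X p)) * sin (al p + t * Y p).
Let Phi p t := t `^ (- (1 + s)) * (expR (- (s * (p * rho))) * A p t).
Let Psi p t := t `^ (- s) * (expR (- (s * (p * rho))) * (rho * A p t + om * B p t)).
Let D p t := t `^ (- (1 + s)) * (expR (- (s * (p * rho))) *
  (- s * (rho * A p t + om * B p t) + t * expR (- (t * X p)) *
    ((rho * X p - om * Y p) * cos (al p + t * Y p) +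
     (rho * Y p + om * X p) * sin (al p + t * Y p)))).

Let dPhi (p t : R) : is_derive p 1 (Phi ^~ t) (D p t).
Proof.
by apply: is_derive_eq; rewrite /D /A /B /X /Y /al /GRing.scale/=; ring.
Qed.

Let dPsi (p t : R) : 0 < t -> is_derive t 1 (Psi p) (D p t).
Proof.
move=> t0.
have d1 := is_derive1_powR (- s) t0.
pose G u := expR (- (s * (p * rho))) * (rho * A p u + om * B p u).
pose dG := expR (- (s * (p * rho))) * (expR (- (t * X p)) *
    ((rho * X p - om * Y p) * cos (al p + t * Y p) +
     (rho * Y p + om * X p) * sin (al p + t * Y p))).
have d2 : is_derive t 1 G dG.
  by apply: is_derive_eq; rewrite /dG /A /B /GRing.scale/=; ring.
apply: is_derive_eq (is_derive_mulf d1 d2) _.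
have -> : - s - 1 = - (1 + s) by ring.
have -> : t `^ (- s) = t * t `^ (- (1 + s)).
  rewrite -{2}(powRr1 (ltW t0)) -powRD; last by apply/implyP => _; rewrite gt_eqF.
  by congr (_ `^ _); ring.
by rewrite /D /G /dG; ring.
Qed.

(** For [|p| <= 2] this dominates the modulus of [lambda_p] and, since [s < 1], also the factor
    [exp (- s p rho)]. *)
Let rmax := expR (2 * `|rho|).
Let C0 := `|rho| + `|om|.

Let XY_bound p : `|p| <= 2 -> `|X p| <= rmax /\ `|Y p| <= rmax.
Proof.
move=> p2; have h : expR (p * rho) <= rmax.
  rewrite ler_expR (le_trans (ler_norm _))// normrM ler_wpM2r//.
by split; rewrite /X /Y normrM (ger0_norm (expR_ge0 _)) -[leRHS]mulr1 ler_pM// ?cos_max ?sin_max.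
Qed.

Let s_bound p : `|p| <= 2 -> expR (- (s * (p * rho))) <= rmax.
Proof.
move=> p2; rewrite ler_expR (le_trans (ler_norm _))// normrN !normrM (gtr0_norm s0).
rewrite -[leRHS]mul1r; apply: ler_pM; [exact: ltW|by rewrite mulr_ge0|exact: ltW|].
by rewrite ler_wpM2r.
Qed.

Let K a b := a `^ (- (1 + s)) * (rmax * ((C0 * (1 + expR (b * rmax)) + b * expR (b * rmax) * (C0 * rmax + C0 * rmax)))).

Let D_bound a b p t : 0 < a -> `]-1, 2[%classic p -> `[a, b]%classic t -> `|D p t| <= K a b.
Proof.
move=> a0; rewrite /= !in_itv/= => /andP[p1 p2] /andP[at_ tb].
have p2' : `|p| <= 2 by rewrite ler_norml; apply/andP; split; lra.
have [Xb Yb] := XY_bound p2'; have sb := s_bound p2'.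
have t0 := lt_le_trans a0 at_.
have E0 : 0 <= expR (- (t * X p)) by exact: expR_ge0.
have Eb : expR (- (t * X p)) <= expR (b * rmax).
  rewrite ler_expR (le_trans (ler_norm _))// normrN normrM (gtr0_norm t0) ler_pM//.
  exact: ltW.
have Ab : `|A p t| <= 1 + expR (b * rmax).
  rewrite /A (le_trans (ler_normB _ _))// lerD ?cos_max// normrM (ger0_norm E0) -[leRHS]mulr1.
  by rewrite ler_pM ?cos_max.
have Bb : `|B p t| <= 1 + expR (b * rmax).
  rewrite /B (le_trans (ler_normB _ _))// lerD ?sin_max// normrM (ger0_norm E0) -[leRHS]mulr1.
  by rewrite ler_pM ?sin_max.
have r0 : 0 <= rmax by exact: expR_ge0.
rewrite /D /K normrM ger0_norm ?powR_ge0// ler_pM ?powR_ge0//.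
  rewrite !powRN lef_pV2 ?posrE ?powR_gt0//.
  have s10 : 0 <= 1 + s by rewrite addr_ge0// ltW.
  by apply: ge0_ler_powR => //; rewrite nnegrE ltW.
rewrite normrM ger0_norm ?expR_ge0// ler_pM ?expR_ge0//.
rewrite (le_trans (ler_normD _ _))// lerD//.
  rewrite normrM normrN (gtr0_norm s0) -[leRHS]mul1r; apply: ler_pM => //; [exact: ltW|exact: ltW|].
  rewrite (le_trans (ler_normD _ _))// /C0 mulrDl lerD// normrM ler_wpM2l//.
rewrite normrM; apply: ler_pM => //.
  by rewrite normrM (gtr0_norm t0) (ger0_norm E0); apply: ler_pM => //; exact: ltW.
have h (x y z w : R) : `|x| <= rmax -> `|y| <= rmax -> `|w| <= 1 -> z = rho * x + om * y -> `|z * w| <= C0 * rmax.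
  move=> xb yb wb ->; rewrite normrM -[leRHS]mulr1 ler_pM//.
  by rewrite (le_trans (ler_normD _ _))// /C0 mulrDl !normrM lerD// ler_wpM2l.
rewrite (le_trans (ler_normD _ _))// lerD//.
  by apply: (h (X p) (- Y p)) => //; rewrite ?normrN ?cos_max ?mulrN.
by apply: (h (Y p) (X p)) => //; rewrite ?sin_max.
Qed.

(** The angle stays within [pi / 2], so [X p] is nonnegative and [cos_jump_bound] applies. The
    factor [t ^ (- s) min (1, t)] is [t ^ (1 - s)] near [0] and [t ^ (- s)] at infinity, so the
    sides of the contour at both ends vanish in the limit. *)
Let Psi_bound p t : 0 <= p <= 1 -> 0 < t ->
  `|Psi p t| <= rmax * (C0 * (2 + rmax + rmax)) * (t `^ (- s) * Num.min 1 t).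
Proof.
move=> /andP[p0 p1] t0.
have p2' : `|p| <= 2 by rewrite ger0_norm//; lra.
have [Xb Yb] := XY_bound p2'; have sb := s_bound p2'.
have X0 : 0 <= X p.
  rewrite mulr_ge0 ?expR_ge0// cos_ge0_pihalf//.
  have pi0 := pi_gt0 R.
  have omb : `|om| <= pi / 2 by rewrite ler_norml.
  have : `|p * om| <= pi / 2 by rewrite normrM -[leRHS]mul1r ler_pM// ger0_norm.
  by rewrite ler_norml.
have m0 : 0 <= Num.min 1 t by rewrite le_min ler01 ltW.
have le2 : (2 + X p + `|- Y p|) * Num.min 1 t <= (2 + rmax + rmax) * Num.min 1 t.
  by rewrite ler_wpM2r// normrN !lerD// (le_trans (ler_norm _)).
have eY : al p + t * Y p = al p - t * (- Y p) by ring.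
have Ab : `|A p t| <= (2 + rmax + rmax) * Num.min 1 t.
  rewrite (le_trans _ le2)// /A eY.
  exact: cos_jump_bound (ltW t0).
have Bb : `|B p t| <= (2 + rmax + rmax) * Num.min 1 t.
  rewrite (le_trans _ le2)// /B eY.
  exact: sin_jump_bound (ltW t0).
have r0 : 0 <= rmax by exact: expR_ge0.
rewrite /Psi normrM ger0_norm ?powR_ge0// [leRHS]mulrCA ler_wpM2l ?powR_ge0//.
rewrite normrM ger0_norm ?expR_ge0// -mulrA ler_pM ?expR_ge0//.
by rewrite (le_trans (ler_normD _ _))// !normrM /C0 !mulrDl lerD// -mulrA ler_wpM2l.
Qed.

(* Deform [lambda] from [1] to [exp (rho - i om)]. *)
Lemma jump_path :
  \int[leb]_x jump (expR rho * cos om) (- (expR rho * sin om)) (s * om + c) x =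
  expR (s * rho) * cos c * jump_const.
Proof.
have pi0 := pi_gt0 R.
have omb : `|om| <= pi / 2 by rewrite ler_norml.
have X1 : 0 <= expR rho * cos om.
  by rewrite mulr_ge0 ?expR_ge0// cos_ge0_pihalf.
set f1 := jump _ _ _.
pose f0 x := cos c * jump 1 0 0 x.
have if1 : leb.-integrable setT (EFin \o f1) by exact: integrable_jump.
have if0 : leb.-integrable setT (EFin \o f0).
  by apply: integrableZl_fin => //; exact: integrable_jump.
pose DD : set (measurableTypeR R) := `]0, +oo[%classic.
have mD : measurable DD by exact: measurable_itv.
have sD (f : R -> R) : (forall x, x <= 0 -> f x = 0) -> \int[leb]_x f x = \int[leb]_(x in DD) f x.
  move=> fz; rewrite [RHS]Rintegral_mkcond; apply: eq_Rintegral => x _; rewrite patchE; case: ifPn => //.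
  rewrite notin_setE /DD/= in_itv/= andbT => /negP; rewrite -leNgt; exact: fz.
pose AA (j : nat) : set (measurableTypeR R) := `[j.+2%:R^-1, j.+2%:R]%classic.
have mA j : measurable (AA j) by exact: measurable_itv.
have j0 (j : nat) : (0 : R) < j.+2%:R^-1 by rewrite invr_gt0.
have j1 (j : nat) : j.+2%:R^-1 < (1 : R) by rewrite invf_lt1// ltr1n.
have j2 (j : nat) : (1 : R) < j.+2%:R by rewrite ltr1n.
have AD j : AA j `<=` DD.
  by move=> x; rewrite /AA /DD/= !in_itv/= andbT => /andP[+ _]; exact: lt_le_trans.
have Aoo (x : measurableTypeR R) : DD x -> \forall j \near \oo, AA j x.
  rewrite /DD/= in_itv/= andbT => x0; near=> j; rewrite /AA/= in_itv/=; apply/andP; split.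
    rewrite invf_ple ?posrE//.
    have : x^-1 < j%:R by near: j; exact: nbhs_infty_gtr.
    by move/ltW/le_trans; apply; rewrite ler_nat -addn2 leq_addr.
  have : x < j%:R by near: j; exact: nbhs_infty_gtr.
  by move/ltW/le_trans; apply; rewrite ler_nat -addn2 leq_addr.
have h1 := @Rintegral_exhaustion _ _ _ leb DD AA f1 mD mA AD Aoo (integrableS measurableT mD (@subsetT _ _) if1).
have h0 := @Rintegral_exhaustion _ _ _ leb DD AA f0 mD mA AD Aoo (integrableS measurableT mD (@subsetT _ _) if0).
have fz (a b d x : R) : x <= 0 -> jump a b d x = 0.
  by move=> x0; rewrite /jump jump_weight_neg// mul0r.
pose E := expR (- (s * rho)).
suff key : E * \int[leb]_(x in DD) f1 x = \int[leb]_(x in DD) f0 x.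
  rewrite /jump_const sD; last by move=> x; exact: fz.
  rewrite -[LHS](mulKf (lt0r_neq0 (expR_gt0 (- (s * rho))))) -/E key.
  rewrite -[X in _ * X](sD f0); last by move=> x x0; rewrite /f0 fz// mulr0.
  rewrite /f0 RintegralZl//; last exact: integrable_jump.
  by rewrite /E -expRN opprK mulrA.
apply/eqP; rewrite -subr_eq0 -normr_le0.
set J1 := \int[leb]_(x in DD) f1 x; set J0 := \int[leb]_(x in DD) f0 x.
pose I1 j := \int[leb]_(x in AA j) f1 x.
pose I0 j := \int[leb]_(x in AA j) f0 x.
have h3 : `|E * I1 j - I0 j| @[j --> \oo] --> `|E * J1 - J0|.
  by apply: cvg_norm; apply: cvgB; [apply: cvgM; [exact: cvg_cst|exact: h1]|exact: h0].
pose M := rmax * (C0 * (2 + rmax + rmax)).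
have h4 : M * (j.+2%:R `^ (- (1 - s))) + M * (j.+2%:R `^ (- s)) @[j --> \oo] --> (0 : R).
  have -> : (0 : R) = M * 0 + M * 0 by ring.
  apply: cvgD; apply: cvgM; [exact: cvg_cst|apply: cvg_powR_infty|exact: cvg_cst|exact: cvg_powR_infty].
  by rewrite subr_gt0.
apply: (ler_cvg_to h3 h4); near=> j.
have ab := lt_trans (j1 j) (j2 j).
have K0 : 0 <= K j.+2%:R^-1 j.+2%:R.
  have C00 : 0 <= C0 by rewrite addr_ge0.
  have r0 : 0 <= rmax by exact: expR_ge0.
  have j20 : (0 : R) <= j.+2%:R by [].
  have e0 (x : R) : 0 <= expR x by exact: expR_ge0.
  rewrite /K; apply: mulr_ge0; first exact: powR_ge0.
  apply: mulr_ge0 => //; apply: addr_ge0; first by rewrite mulr_ge0// addr_ge0.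
  by apply: mulr_ge0; [exact: mulr_ge0|apply: addr_ge0; exact: mulr_ge0].
have pos p (t : R) : `[j.+2%:R^-1, j.+2%:R]%classic t -> `]-1, 2[%classic p -> 0 < t.
  by rewrite /= in_itv/= => /andP[+ _ _]; exact: lt_le_trans.
have cv := @closed_form_variation R _ _ _ (M * (j.+2%:R `^ (- (1 - s)))) (M * (j.+2%:R `^ (- s))) Phi Psi D ab K0.
have -> : I0 j = \int[leb]_(x in `[j.+2%:R^-1, j.+2%:R]) Phi 0 x.
  apply: eq_Rintegral => x; rewrite inE => xA.
  have x0 : 0 < x by have := AD _ _ xA; rewrite /DD/= in_itv/= andbT.
  have X00 : X 0 = 1 by rewrite /X !mul0r expR0 cos0 mulr1.
  have Y00 : Y 0 = 0 by rewrite /Y !mul0r sin0 mulr0.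
  have al0 : al 0 = c by rewrite /al mul0r mulr0 add0r.
  rewrite /f0 /jump jump_weight_pos// /Phi /A X00 Y00 al0.
  rewrite !(mul0r, mulr0, oppr0, expR0, subr0, addr0, cos0).
  by ring.
have -> : E * I1 j = \int[leb]_(x in `[j.+2%:R^-1, j.+2%:R]) Phi 1 x.
  rewrite -(@RintegralZl _ _ _ leb (AA j) _ E (mA j)); last first.
    by apply: integrableS if1 => //; exact: mA.
  apply: eq_Rintegral => x; rewrite inE => xA.
  have x0 : 0 < x by have := AD _ _ xA; rewrite /DD/= in_itv/= andbT.
  rewrite /f1 /jump jump_weight_pos// /Phi /A /X /Y /al !mul1r /E mulrN opprK.
  by ring.
have M0 : 0 <= M.
  have r0 : 0 <= rmax by exact: expR_ge0.
  by rewrite /M mulr_ge0// mulr_ge0// ?addr_ge0.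
apply: cv.
- move=> p Ip; apply: is_derive_within_continuous => t /pos/(_ Ip) t0.
  have [dG hG] : exists dG, is_derive t 1 (fun t => expR (- (s * (p * rho))) * A p t) dG.
    by eexists; rewrite /A; cbv beta; derive_tac.
  by eexists; exact: is_derive_mulf (is_derive1_powR (- (1 + s)) t0) hG.
- move=> p Ip; apply: is_derive_within_continuous => t /pos/(_ Ip) t0.
  have [dG hG] : exists dG, is_derive t 1 (fun t => expR (- (s * (p * rho))) *
  (- s * (rho * A p t + om * B p t) + t * expR (- (t * X p)) *
    ((rho * X p - om * Y p) * cos (al p + t * Y p) +
     (rho * Y p + om * X p) * sin (al p + t * Y p)))) dG.
    by eexists; rewrite /A /B; cbv beta; derive_tac.
  by eexists; exact: is_derive_mulf (is_derive1_powR (- (1 + s)) t0) hG.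
- by move=> p x _ _; exact: dPhi.
- by move=> p x Ip /pos/(_ Ip); exact: dPsi.
- by move=> p x; exact: D_bound.
- move=> p p01; split.
    apply: (le_trans (Psi_bound p01 (j0 j))); rewrite ler_wpM2l// min_r ?(ltW (j1 j))//.
    rewrite -{1 2}powR_inv1// -powRrM -powRD; last by apply/implyP.
    by rewrite le_eqVlt; apply/orP; left; apply/eqP; congr (_ `^ _); ring.
  apply: (le_trans (Psi_bound p01 (lt_trans ltr01 (j2 j)))).
  by rewrite ler_wpM2l// min_l ?mulr1// ltW// j2.
Unshelve. all: by end_near. Qed.

End path.

Lemma jump_integral (X Y c r om : R) : 0 < r -> 0 <= X -> - (pi / 2) <= om <= pi / 2 ->
  X = r * cos om -> Y = r * sin om ->
  \int[leb]_x jump X Y c x = jump_const * (r `^ s * cos (c + s * om)).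
Proof.
move=> r0 X0 omb Xr Yr.
have omN : - (pi / 2) <= - om <= pi / 2 by move: omb => /andP[h1 h2]; apply/andP; split; lra.
(* [jump_path] ends at [exp (rho - i om)] and uses up the phase [s * om]; reversing the angle and
   adding [s * om] to the phase gives [lambda = r exp (i om)] with phase [c]. *)
have := @jump_path (ln r) (- om) (c + s * om) omN.
rewrite lnK ?posrE// cosN sinN mulrN opprK -Xr -Yr.
have -> : s * - om + (c + s * om) = c by ring.
by move=> ->; rewrite /powR gt_eqF//; ring.
Qed.

End jump_integral.

(** * Gaussians and their Fourier transforms *)

Section fubini_dominated.
Context d1 d2 (T1 : measurableType d1) (T2 : measurableType d2) {R : realType}.
Variables (m1 : {sigma_finite_measure set T1 -> \bar R}) (m2 : {sigma_finite_measure set T2 -> \bar R}).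
Variables (f1 : T1 -> R) (f2 : T2 -> R) (F : T1 * T2 -> R).
Hypothesis i1 : m1.-integrable setT (fun x => (f1 x)%:E).
Hypothesis i2 : m2.-integrable setT (fun x => (f2 x)%:E).
Hypothesis mF : measurable_fun setT F.
Hypothesis Fle : forall x y, `|F (x, y)| <= f1 x * f2 y.

(** The double integrals below have majorants of product form. One such pointwise bound gives
    integrability on the product and of every section, so no exceptional null set enters when
    iterated integrals are taken with real values. *)
Lemma integrable_prod_dominated : (m1 \x m2)%E.-integrable setT (fun z => (F z)%:E).
Proof.
have mFE : measurable_fun setT (EFin \o F) by exact/measurable_EFinP.
apply: (integrable12ltyP m1 m2 mFE).2.
have i1' := integrable_abse i1; have i2' := integrable_abse i2.
have mf1 := integrable_measurable i1; have mf2 := integrable_measurable i2.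
have c2 : (\int[m2]_y `|(f2 y)%:E|)%E \is a fin_num by exact: integrable_fin_num.
have h : (\int[m1]_x (`|(f1 x)%:E| * \int[m2]_y `|(f2 y)%:E|) < +oo)%E.
  rewrite -(fineK c2) ge0_integralZr//.
  - rewrite lte_mul_pinfty ?integral_ge0// ?fin_numM//.
      exact: integrable_fin_num.
    by rewrite ltry.
  - by apply: measurableT_comp => //; exact/measurable_EFinP.
  - by rewrite lee_fin fine_ge0// integral_ge0.
apply: le_lt_trans h; apply: ge0_le_integral => //.
- by move=> x _; exact: integral_ge0.
- by apply: (@measurable_fun_fubini_tonelli_F _ _ _ _ _ m2 (fun z => `|(F z)%:E|%E)) => //; exact: measurableT_comp.
- apply: emeasurable_funM => //; apply: measurableT_comp => //; exact/measurable_EFinP.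
- move=> x _; rewrite -ge0_integralZl//; last by apply: measurableT_comp => //; exact/measurable_EFinP.
  apply: ge0_le_integral => //.
  + by apply: measurableT_comp => //; apply/measurable_EFinP; exact: measurableT_comp.
  + by apply: emeasurable_funM => //; apply: measurableT_comp => //; exact/measurable_EFinP.
  + by move=> y _; rewrite /= lee_fin -normrM (le_trans (Fle x y))// ler_norm.
Qed.

Lemma integrable_section1 x : m2.-integrable setT (fun y => (F (x, y))%:E).
Proof.
apply: (integrable_dominated _ (integrableZl_fin (f1 x) measurableT i2)) => //.
exact: measurableT_comp.
Qed.

Lemma integrable_section2 y : m1.-integrable setT (fun x => (F (x, y))%:E).
Proof.
apply: (integrable_dominated _ (integrableZr_fin (f2 y) measurableT i1)) => //.
exact: measurableT_comp.
Qed.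

Lemma Rfubini1 : \int[(m1 \x m2)%E]_z F z = \int[m1]_x \int[m2]_y F (x, y).
Proof.
rewrite /Rintegral -(integral12_prod_meas1 integrable_prod_dominated) /fubini_F.
congr fine; apply: eq_integral => x _; rewrite fineK//.
exact/integrable_fin_num/integrable_section1.
Qed.

Lemma Rfubini2 : \int[(m1 \x m2)%E]_z F z = \int[m2]_y \int[m1]_x F (x, y).
Proof.
rewrite /Rintegral -(integral21_prod_meas1 integrable_prod_dominated) /fubini_G.
congr fine; apply: eq_integral => y _; rewrite fineK//.
exact/integrable_fin_num/integrable_section2.
Qed.

Lemma integrable_fubini1 : m1.-integrable setT (fun x => (\int[m2]_y F (x, y))%:E).
Proof.
have := integrable_fubini_F integrable_prod_dominated.
apply: eq_integrable => // x _; rewrite /fubini_F /Rintegral fineK//.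
exact/integrable_fin_num/integrable_section1.
Qed.

End fubini_dominated.

Lemma integrable_fubini2 d1 d2 (T1 : measurableType d1) (T2 : measurableType d2) (R : realType)
    (m1 : {sigma_finite_measure set T1 -> \bar R}) (m2 : {sigma_finite_measure set T2 -> \bar R})
    (f1 : T1 -> R) (f2 : T2 -> R) (F : T1 * T2 -> R) :
  m1.-integrable setT (fun x => (f1 x)%:E) -> m2.-integrable setT (fun x => (f2 x)%:E) ->
  measurable_fun setT F -> (forall x y, `|F (x, y)| <= f1 x * f2 y) ->
  m2.-integrable setT (fun y => (\int[m1]_x F (x, y))%:E).
Proof.
move=> i1 i2 mF Fle.
have mF' : measurable_fun setT (fun p : T2 * T1 => F (p.2, p.1)).
  exact: measurableT_comp mF (measurable_fun_pair measurable_snd measurable_fst).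
have Fle' y x : `|F (x, y)| <= f2 y * f1 x by rewrite mulrC; exact: Fle.
exact: (integrable_fubini1 i2 i1 mF' Fle').
Qed.

Section gauss_Rn.
Context {R : realType}.
Local Notation leb := (@lebesgue_measure R).

Definition sqdist {n} (x y : Rn R n) : R := \sum_(i < n) (tnth x i - tnth y i) ^+ 2.

Lemma sqdist_ge0 n (x y : Rn R n) : 0 <= sqdist x y.
Proof. by apply: sumr_ge0 => i _; exact: sqr_ge0. Qed.

Lemma measurable_sqdist n (y : Rn R n) : measurable_fun setT (fun x : Rn R n => sqdist x y).
Proof. by apply: mfun_sum => i; apply: mfun_exp; apply: mfun_add; [exact: measurable_tnth|meas]. Qed.

Lemma measurable_dotp n (y : Rn R n) : measurable_fun setT (fun x : Rn R n => dotp x y).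
Proof. by apply: mfun_sum => i; apply: mfun_mul; [exact: measurable_tnth|meas]. Qed.

Definition gauss_phase n (c : R) (m k : Rn R n) (d : R) (x : Rn R n) : R :=
  expR (- (c * sqdist x m)) * cos (dotp x k + d).

Lemma measurable_gauss_phase n c (m k : Rn R n) d : measurable_fun setT (gauss_phase c m k d).
Proof.
apply: mfun_mul; first by apply: mfun_expR; apply: mfun_opp; apply: mfun_mul; [meas|exact: measurable_sqdist].
by apply: mfun_cos; apply: mfun_add; [exact: measurable_dotp|meas].
Qed.

(** Induction on the dimension along [lebesgue_step], starting from the Dirac mass in dimension [0].
    The phase [d] is free so that the contribution of the first coordinate can be absorbed into it
    before the induction hypothesis is used. *)
Lemma gauss_Rn n (c : R) (m : Rn R n) : 0 < c ->
  (lebesgue_Rn n).-integrable setT (fun x => (expR (- (c * sqdist x m)))%:E) /\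
  forall (k : Rn R n) d, \int[lebesgue_Rn n]_x gauss_phase c m k d x =
    Num.sqrt (pi / c) ^+ n * expR (- (dotp k k / (4 * c))) * cos (dotp m k + d).
Proof.
move=> c0; elim: n m => [|n IH] m.
  have sqdist0 (x : Rn R 0) : sqdist x m = 0 by rewrite /sqdist big_ord0.
  have E : (fun x : Rn R 0 => (expR (- (c * sqdist x m)))%:E) = cst 1%:E.
    by apply/funext => x; rewrite sqdist0 mulr0 oppr0 expR0.
  split; first by rewrite E; apply: finite_measure_integrable_cst.
  move=> k d; rewrite /gauss_phase.
  have E2 : (fun x : Rn R 0 => expR (- (c * sqdist x m)) * cos (dotp x k + d)) = cst (cos d).
    by apply/funext => x; rewrite sqdist0 mulr0 oppr0 expR0 mul1r /dotp big_ord0 add0r.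
  have m1 : lebesgue_Rn 0 [set: Rn R 0] = 1%E by exact: diracT.
  rewrite E2 (etrans (Rintegral_cst _ measurableT (cos d)) (congr1 (fun u => cos d * fine u) m1)).
  rewrite /= mulr1 /dotp !big_ord0 mul0r oppr0 expR0 expr0 !mul1r add0r.
  by [].
have [ig Ig] := IH [tuple of behead m].
have tb (y : Rn R n.+1) i : tnth y (lift ord0 i) = tnth [tuple of behead y] i.
  by rewrite tnth_behead; congr tnth; apply/val_inj; rewrite /= inordK// ltnS.
have sqdistE (x1 : R) (x : Rn R n) : sqdist (consRn (x1, x)) m = (x1 - tnth m ord0) ^+ 2 + sqdist x [tuple of behead m].
  rewrite /sqdist big_ord_recl; congr (_ + _).
  by apply: eq_bigr => i _; rewrite (tb m) /consRn tnthS.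
have dotE (k : Rn R n.+1) (x1 : R) (x : Rn R n) : dotp (consRn (x1, x)) k = x1 * tnth k ord0 + dotp x [tuple of behead k].
  rewrite /dotp big_ord_recl; congr (_ + _).
  by apply: eq_bigr => i _; rewrite (tb k) /consRn tnthS.
have dotE2 (l k : Rn R n.+1) : dotp l k = tnth l ord0 * tnth k ord0 + dotp ([tuple of behead l] : Rn R n) [tuple of behead k].
  rewrite /dotp big_ord_recl; congr (_ + _).
  by apply: eq_bigr => i _; rewrite !tb.
have [ig1 _] := integral_gauss (tnth m ord0) c0.
pose F (k : Rn R n.+1) d (p : measurableTypeR R * Rn R n) := gauss_phase c m k d (consRn p).
have mF k d : measurable_fun setT (F k d).
  by apply: measurableT_comp; [exact: measurable_gauss_phase|exact: measurable_consRn].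
have EF k d (x1 : R) (x : Rn R n) : F k d (x1, x) = expR (- (c * (x1 - tnth m ord0) ^+ 2)) *
   gauss_phase c [tuple of behead m] [tuple of behead k] (tnth k ord0 * x1 + d) x.
  rewrite /F /gauss_phase sqdistE dotE mulrDr opprD expRD -mulrA.
  by congr (_ * (_ * cos _)); ring.
have Fle k d (x1 : measurableTypeR R) (x : Rn R n) : `|F k d (x1, x)| <=
   expR (- (c * (x1 - tnth m ord0) ^+ 2)) * expR (- (c * sqdist x [tuple of behead m])).
  rewrite EF normrM (ger0_norm (expR_ge0 _)) ler_wpM2l ?expR_ge0//.
  by rewrite normrM (ger0_norm (expR_ge0 _)) ler_piMr ?expR_ge0// cos_max.
have iF k d := integrable_prod_dominated ig1 ig (mF k d) (Fle k d).
have mph k d : measurable_fun setT (EFin \o gauss_phase c m k d).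
  by apply/measurable_EFinP; exact: measurable_gauss_phase.
have mexp : measurable_fun setT (EFin \o (fun x : Rn R n.+1 => expR (- (c * sqdist x m)))).
  by apply/measurable_EFinP; apply: mfun_expR; apply: mfun_opp; apply: mfun_mul; [meas|exact: measurable_sqdist].
have ph (k : Rn R n.+1) d : \int[lebesgue_Rn n.+1]_x gauss_phase c m k d x =
    \int[(leb \x lebesgue_Rn n)%E]_p F k d p.
  congr fine; exact: (integral_pushforward (@measurable_consRn R n) (mph k d) (iF k d) measurableT).
have g0 : gauss_phase c m [tuple 0 | _ < n.+1] 0 = (fun x => expR (- (c * sqdist x m))).
  apply/funext => x; rewrite /gauss_phase /dotp big1 ?addr0 ?cos0 ?mulr1// => i _.
  by rewrite tnth_mktuple mulr0.
split.
  have h := integrable_pushforward (@measurable_consRn R n) mexp.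
  apply: h => //; rewrite preimage_setT.
  have := iF [tuple 0 | _ < n.+1] 0.
  by rewrite /F g0.
move=> k d; rewrite ph (Rfubini1 ig1 ig (mF k d) (Fle k d)).
pose K := Num.sqrt (pi / c) ^+ n * expR (- (dotp ([tuple of behead k] : Rn R n) [tuple of behead k] / (4 * c))).
pose e := dotp ([tuple of behead m] : Rn R n) [tuple of behead k] + d.
rewrite (@eq_Rintegral _ _ _ leb _ (fun x1 : measurableTypeR R => K * (expR (- (c * (x1 - tnth m ord0) ^+ 2)) * cos (tnth k ord0 * x1 + e)))); last first.
  move=> x1 _; rewrite (@eq_Rintegral _ _ _ (lebesgue_Rn n) _ (fun x => expR (- (c * (x1 - tnth m ord0) ^+ 2)) *
   gauss_phase c [tuple of behead m] [tuple of behead k] (tnth k ord0 * x1 + d) x)); last first.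
    by move=> x _; exact: EF.
  rewrite RintegralZl//; last first.
    apply: (integrable_dominated _ ig); first exact: measurable_gauss_phase.
    move=> x; rewrite normrM (ger0_norm (expR_ge0 _)) ler_piMr ?expR_ge0// cos_max//.
  rewrite Ig /K /e mulrCA; congr (_ * (_ * cos _)); ring.
rewrite RintegralZl//; last exact: integrable_gauss_cos.
rewrite gauss_fourier1// dotE2 (dotE2 m k) (exprS _ n) /K /e.
have hE (a b : R) : expR (- ((a * a + b) / (4 * c))) = expR (- (a ^+ 2 / (4 * c))) * expR (- (b / (4 * c))).
  by rewrite -expRD; congr expR; ring.
rewrite hE.
have -> : tnth k ord0 * tnth m ord0 + (dotp ([tuple of behead m] : Rn R n) [tuple of behead k] + d) =
  tnth m ord0 * tnth k ord0 + dotp ([tuple of behead m] : Rn R n) [tuple of behead k] + d by ring.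
by ring.
Qed.
End gauss_Rn.

(** * The principal argument on the right half-plane *)

Section carg.
Context {R : realType}.
Local Notation leb := (@lebesgue_measure R).

Lemma cmodE (X Y : R) : cmod (X +i* Y) = Num.sqrt (X ^+ 2 + Y ^+ 2).
Proof. by []. Qed.

Lemma acos_le_pihalf (y : R) : 0 <= y <= 1 -> 0 <= acos y <= pi / 2.
Proof.
move=> /andP[y0 y1].
have y11 : -1 <= y <= 1 by apply/andP; split => //; lra.
have [/andP[a0 api] ca] := acos_def y11.
rewrite a0/= leNgt; apply/negP => h.
have h1 : 0 < acos y - pi / 2 < pi.
  by have := pi_gt0 R; rewrite subr_gt0 h/=; lra.
by have := sin_gt0_pi h1; rewrite sinBpihalf ca oppr_gt0 ltNge y0.
Qed.

(** On the closed right half-plane the principal argument has modulus at most [pi / 2], the range in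
    which [jump_integral] applies. *)
Lemma carg_polar (X Y : R) : 0 <= X -> 0 < cmod (X +i* Y) ->
  [/\ - (pi / 2) <= carg (X +i* Y) <= pi / 2,
      X = cmod (X +i* Y) * cos (carg (X +i* Y)) &
      Y = cmod (X +i* Y) * sin (carg (X +i* Y))].
Proof.
move=> X0 r0; set r := cmod _.
have r2 : r ^+ 2 = X ^+ 2 + Y ^+ 2 by rewrite /r cmodE sqr_sqrtr// addr_ge0 ?sqr_ge0.
have rn : r != 0 by rewrite gt_eqF.
have y01 : 0 <= X / r <= 1.
  rewrite divr_ge0 ?(ltW r0)//= ler_pdivrMr// mul1r -(ler_sqr X0 (ltW r0)) r2.
  by rewrite lerDl sqr_ge0.
have y11 : -1 <= X / r <= 1 by move: y01 => /andP[h1 ->]; rewrite andbT; lra.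
have /andP[a0 a1] := acos_le_pihalf y01.
have [_ ca] := acos_def y11.
have sa : sin (acos (X / r)) = `|Y| / r.
  rewrite sin_acos// expr_div_n -[X in X - _](@mulfV _ (r ^+ 2)) ?expf_neq0// -mulrBl r2 addrC addKr -r2.
  by rewrite -expr_div_n sqrtr_sqr normrM normfV (gtr0_norm r0).
rewrite /carg/= -/r; case: ifPn => Y0.
  split; last 2 first.
  - by rewrite ca mulrC divfK.
  - by rewrite sa ger0_norm// mulrC divfK.
  by rewrite a1 andbT (le_trans _ a0)// oppr_le0 divr_ge0// pi_ge0.
split; last 2 first.
- by rewrite cosN ca mulrC divfK.
- by rewrite sinN sa ltr0_norm ?ltNge// mulrN mulrC divfK// opprK.
by rewrite lerN2 a1/= (le_trans _ (le_trans a0 a1))// oppr_le0.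
Qed.

Lemma jump_integral_cpow (s X Y c : R) : 0 < s -> s < 1 -> 0 <= X ->
  \int[leb]_x jump s X Y c x =
  jump_const s * (cmod (X +i* Y) `^ s * cos (c + s * carg (X +i* Y))).
Proof.
move=> s0 s1 X0; have [r0|r0] := ltP 0 (cmod (X +i* Y)).
  by have [h1 h2 h3] := carg_polar X0 r0; exact: jump_integral h2 h3.
(* For [lambda = 0] the integrand vanishes identically, and so does the right side, because
   [0 ^ s = 0] for [s != 0]. *)
have r00 : cmod (X +i* Y) = 0 by apply/eqP; rewrite eq_le r0 cmodE sqrtr_ge0.
have : X ^+ 2 + Y ^+ 2 <= 0 by rewrite -sqrtr_eq0 -cmodE r00.
move=> XY; have X20 := sqr_ge0 X; have Y20 := sqr_ge0 Y.
have X00 : X = 0 by apply/eqP; rewrite -sqrf_eq0; apply/eqP; lra.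
have Y00 : Y = 0 by apply/eqP; rewrite -sqrf_eq0; apply/eqP; lra.
rewrite r00 powR0 ?gt_eqF// mul0r mulr0 (_ : (fun x => _) = cst 0) ?Rintegral_cst ?mul0r//.
by apply/funext => x; rewrite /jump X00 Y00 !mulr0 oppr0 expR0 mul1r addr0 subrr mulr0.
Qed.

End carg.

Section gauss_spt.
Context {R : realType} {n : nat}.
Local Notation leb := (@lebesgue_measure R).
Implicit Types z k m : spacetime R n.

Definition sqdist_spt z m : R := sqdist z.1 m.1 + ((z.2 : R) - m.2) ^+ 2.
Definition dot_spt z k : R := dotp z.1 k.1 + (z.2 : R) * k.2.

Lemma sqdist_spt_ge0 z m : 0 <= sqdist_spt z m.
Proof. by rewrite addr_ge0 ?sqr_ge0// sqdist_ge0. Qed.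

Lemma measurable_sqdist_spt m : measurable_fun [set: spacetime R n] (sqdist_spt ^~ m).
Proof.
apply: mfun_add; last by meas.
exact: (measurableT_comp (measurable_sqdist m.1) measurable_fst).
Qed.

Lemma measurable_dot_spt k : measurable_fun [set: spacetime R n] (dot_spt ^~ k).
Proof.
apply: mfun_add; last by meas.
exact: (measurableT_comp (measurable_dotp k.1) measurable_fst).
Qed.

Lemma gauss_spt (c : R) m : 0 < c ->
  lebesgue_spt.-integrable setT (fun z => (expR (- (c * sqdist_spt z m)))%:E) /\
  forall k d, \int[lebesgue_spt]_z (expR (- (c * sqdist_spt z m)) * cos (dot_spt z k + d)) =
    Num.sqrt (pi / c) ^+ n.+1 * expR (- (dot_spt k k / (4 * c))) * cos (dot_spt m k + d).
Proof.
move=> c0.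
have [ig Ig] := gauss_Rn m.1 c0.
have [ig1 _] := integral_gauss m.2 c0.
pose F k d (z : spacetime R n) := expR (- (c * sqdist_spt z m)) * cos (dot_spt z k + d).
have mE : measurable_fun [set: spacetime R n] (fun z => expR (- (c * sqdist_spt z m))).
  by apply: mfun_expR; apply: mfun_opp; apply: mfun_mul; [meas|exact: measurable_sqdist_spt].
have mF k d : measurable_fun setT (F k d).
  by apply: mfun_mul => //; apply: mfun_cos; apply: mfun_add; [exact: measurable_dot_spt|meas].
have Ele (x : Rn R n) (t : measurableTypeR R) : `|expR (- (c * sqdist_spt (x, t) m))| <= expR (- (c * sqdist x m.1)) * expR (- (c * ((t : R) - m.2) ^+ 2)).
  by rewrite ger0_norm ?expR_ge0// -expRD /sqdist_spt/= mulrDr opprD.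
have Fle k d (x : Rn R n) (t : measurableTypeR R) : `|F k d (x, t)| <= expR (- (c * sqdist x m.1)) * expR (- (c * ((t : R) - m.2) ^+ 2)).
  by apply: le_trans (Ele x t); rewrite normrM ler_piMr// cos_max.
split; first exact: (integrable_prod_dominated ig ig1 mE Ele).
move=> k d.
transitivity (\int[leb]_t \int[lebesgue_Rn n]_x F k d (x, t)).
  exact: (Rfubini2 ig ig1 (mF k d) (Fle k d)).
pose K := Num.sqrt (pi / c) ^+ n * expR (- (dotp k.1 k.1 / (4 * c))).
rewrite (@eq_Rintegral _ _ _ leb _ (fun t : measurableTypeR R => K * (expR (- (c * ((t : R) - m.2) ^+ 2)) * cos (k.2 * t + (dotp m.1 k.1 + d))))); last first.
  move=> t _; rewrite (@eq_Rintegral _ _ _ (lebesgue_Rn n) _ (fun x => expR (- (c * ((t : R) - m.2) ^+ 2)) *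
    gauss_phase c m.1 k.1 ((k.2 : R) * t + d) x)); last first.
    move=> x _; rewrite /F /gauss_phase /sqdist_spt /dot_spt/= mulrDr opprD expRD -mulrA mulrCA.
    by congr (_ * (_ * cos _)); ring.
  rewrite RintegralZl//; last first.
    apply: (integrable_dominated _ ig); first exact: measurable_gauss_phase.
    by move=> x; rewrite normrM (ger0_norm (expR_ge0 _)) ler_piMr ?expR_ge0// cos_max.
  rewrite Ig /K mulrCA; congr (_ * (_ * cos _)); ring.
rewrite RintegralZl//; last exact: integrable_gauss_cos.
rewrite gauss_fourier1// (exprS _ n) /K /dot_spt.
have hE (a b : R) : expR (- ((b + a * a) / (4 * c))) = expR (- (a ^+ 2 / (4 * c))) * expR (- (b / (4 * c))).
  by rewrite -expRD; congr expR; ring.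
rewrite hE.
have -> : (k.2 : R) * m.2 + (dotp m.1 k.1 + d) = dotp m.1 k.1 + (m.2 : R) * k.2 + d by ring.
by ring.
Qed.

End gauss_spt.

(** * Mollification on the Fourier side *)

Section L2.
Context d (T : measurableType d) {R : realType} (mu : {measure set T -> \bar R}).
Implicit Types (f : T -> R[i]) (h : T -> R).

(* The real part of [w * expi chi]. *)
Definition rephase (w : R[i]) (chi : R) : R := complex.Re w * cos chi - complex.Im w * sin chi.

Lemma cmod_ge0 (w : R[i]) : 0 <= cmod w.
Proof. by case: w => a b; rewrite cmodE sqrtr_ge0. Qed.

Lemma cmod_sqr (w : R[i]) : cmod w ^+ 2 = complex.Re w ^+ 2 + complex.Im w ^+ 2.
Proof. by case: w => a b; rewrite cmodE sqr_sqrtr// addr_ge0 ?sqr_ge0. Qed.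

Lemma rephase_le w chi : `|rephase w chi| <= cmod w.
Proof.
rewrite -ler_sqr ?nnegrE ?cmod_ge0// real_normK ?num_real// cmod_sqr /rephase.
have := cos2Dsin2 chi; set a := complex.Re w; set b := complex.Im w; set x := cos chi; set y := sin chi => xy.
have -> : a ^+ 2 + b ^+ 2 = (a * x - b * y) ^+ 2 + (a * y + b * x) ^+ 2.
  by rewrite -[LHS]mulr1 -xy; ring.
by rewrite lerDl sqr_ge0.
Qed.

Lemma rephaseB w1 w2 chi : rephase (w1 - w2) chi = rephase w1 chi - rephase w2 chi.
Proof. by case: w1 => a b; case: w2 => e k; rewrite /rephase/=; ring. Qed.

Lemma measurable_cmod f : measurable_fun [set: T] (fun x => complex.Re (f x)) ->
  measurable_fun [set: T] (fun x => complex.Im (f x)) -> measurable_fun [set: T] (cmod \o f).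
Proof.
move=> mr mi; rewrite (_ : _ \o _ = fun x => (complex.Re (f x) ^+ 2 + complex.Im (f x) ^+ 2) `^ (2^-1)).
  by meas.
by apply/funext => x; rewrite /= -cmod_sqr powR12_sqrt ?sqr_ge0// sqrtr_sqr ger0_norm// cmod_ge0.
Qed.

Lemma measurable_rephase f chi : measurable_fun [set: T] (fun x => complex.Re (f x)) ->
  measurable_fun [set: T] (fun x => complex.Im (f x)) -> measurable_fun [set: T] chi ->
  measurable_fun [set: T] (fun x => rephase (f x) (chi x)).
Proof. by move=> mr mi mc; rewrite /rephase; meas. Qed.

Lemma Lnorm2_lty h : measurable_fun [set: T] h ->
  mu.-integrable setT (fun x => (h x ^+ 2)%:E) <-> ('N[mu]_2%:E[EFin \o h] < +oo)%E.
Proof.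
move=> mh; have E : (\int[mu]_x `|(h x ^+ 2)%:E| = \int[mu]_x (`|(EFin \o h) x| `^ 2))%E.
  by apply: eq_integral => x _ /=; rewrite ger0_norm ?sqr_ge0// powR_mulrn// real_normK ?num_real.
split.
  by move=> /integrableP[_]; rewrite E unlock => /poweR_lty; exact.
move=> h2; apply/integrableP; split; first by apply/measurable_EFinP; meas.
by rewrite E -powR_Lnorm ?pnatr_eq0//; exact: poweR_lty.
Qed.

Lemma L2_integrable f : memLp mu 2%:E f -> mu.-integrable setT (fun x => (cmod (f x) ^+ 2)%:E).
Proof.
move=> [mr mi]; rewrite /cLnorm => h.
by apply/(Lnorm2_lty (measurable_cmod mr mi)).
Qed.

Lemma L1_integrable f : memLp mu 1%:E f -> mu.-integrable setT (fun x => (cmod (f x))%:E).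
Proof.
move=> [mr mi]; rewrite /cLnorm Lnorm1 => h; apply/integrableP; split => //.
by apply/measurable_EFinP; exact: (measurable_cmod mr mi).
Qed.

Lemma L2_mul (h1 h2 : T -> R) : measurable_fun [set: T] h1 -> measurable_fun [set: T] h2 ->
  mu.-integrable setT (fun x => (h1 x ^+ 2)%:E) -> mu.-integrable setT (fun x => (h2 x ^+ 2)%:E) ->
  mu.-integrable setT (fun x => (h1 x * h2 x)%:E).
Proof.
move=> m1 m2 i1 i2; apply: (integrable_dominated _ (integrableD_fin measurableT i1 i2)); first by meas.
move=> x; rewrite normrM -(real_normK (num_real (h1 x))) -(real_normK (num_real (h2 x))).
have := normr_ge0 (h1 x); have := normr_ge0 (h2 x); nra.
Qed.

(** Pairing with a fixed square-integrable [h] and a unimodular phase is continuous in [L^2], by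
    Hoelder's inequality. This is how identities for the approximating sequence in [is_fourier]
    reach the limit. *)
Lemma rephase_cvg (h chi : T -> R) (f_ : nat -> T -> R[i]) (f : T -> R[i]) :
  measurable_fun [set: T] h -> measurable_fun [set: T] chi ->
  mu.-integrable setT (fun x => (h x ^+ 2)%:E) ->
  (forall k, measurable_fun [set: T] (fun x => complex.Re (f_ k x)) /\
             measurable_fun [set: T] (fun x => complex.Im (f_ k x))) ->
  measurable_fun [set: T] (fun x => complex.Re (f x)) ->
  measurable_fun [set: T] (fun x => complex.Im (f x)) ->
  (forall k, mu.-integrable setT (fun x => (h x * rephase (f_ k x) (chi x))%:E)) ->
  mu.-integrable setT (fun x => (h x * rephase (f x) (chi x))%:E) ->
  cLnorm mu 2%:E (fun x => f_ k x - f x) @[k --> \oo] --> 0%E ->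
  \int[mu]_x (h x * rephase (f_ k x) (chi x)) @[k --> \oo] -->
  \int[mu]_x (h x * rephase (f x) (chi x)).
Proof.
move=> mh mc h2 mfk mr mi ik i0 cv.
have Nh : ('N[mu]_2%:E[EFin \o h] < +oo)%E by apply/Lnorm2_lty.
have mD k : measurable_fun [set: T] (cmod \o (fun x => f_ k x - f x)).
  have [mrk mik] := mfk k; apply: measurable_cmod.
    rewrite (_ : (fun x => _) = fun x => complex.Re (f_ k x) - complex.Re (f x)); first by meas.
    by apply/funext => x; case: (f_ k x) => ? ?; case: (f x).
  rewrite (_ : (fun x => _) = fun x => complex.Im (f_ k x) - complex.Im (f x)); first by meas.
  by apply/funext => x; case: (f_ k x) => ? ?; case: (f x).
have key k : (`|\int[mu]_x (h x * rephase (f_ k x) (chi x)) - \int[mu]_x (h x * rephase (f x) (chi x))|%:E <=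
   'N[mu]_2%:E[EFin \o h] * cLnorm mu 2%:E (fun x => (f_ k x - f x)%R))%E.
  rewrite -(@RintegralB _ _ _ mu setT _ _ measurableT (ik k) i0) EFin_normr_Rintegral//; last exact: (integrableB_fin _ (ik k) i0).
  have mB : measurable_fun [set: T] (fun x => h x * rephase (f_ k x) (chi x) - h x * rephase (f x) (chi x)).
    exact: integrable_measurable (integrableB_fin measurableT (ik k) i0).
  apply: le_trans (le_abse_integral mu measurableT _) _; first exact/measurable_EFinP.
  have c2 : (2 : R)^-1 + 2^-1 = 1 by rewrite [RHS](splitr 1) div1r.
  have H := hoelder mu mh (mD k) (ltr0Sn R 1) (ltr0Sn R 1) c2.
  apply: le_trans H.
  rewrite Lnorm1; apply: ge0_le_integral => //.
  - by apply: measurableT_comp => //; exact/measurable_EFinP.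
  - by apply: measurableT_comp => //; apply/measurable_EFinP; exact: measurable_funM.
  - move=> x _ /=; rewrite lee_fin -mulrBr -rephaseB !normrM ler_wpM2l//.
    by rewrite [leRHS]ger0_norm ?cmod_ge0// rephase_le.
apply/cvgrPdist_le => e e0.
have h0 : ('N[mu]_2%:E[EFin \o h] * cLnorm mu 2%:E (fun x => (f_ k x - f x)%R))%E @[k --> \oo] --> (0%E : \bar R).
  rewrite -[X in _ --> X](mule0 ('N[mu]_2%:E[EFin \o h])%E).
  apply: cvgeZl => //.
  by rewrite ge0_fin_numE// Lnorm_ge0.
move/fine_cvgP : h0 => [h1 /cvgrPdist_le/(_ _ e0) h0].
near=> k.
have := key k.
have hf : ('N[mu]_2%:E[EFin \o h] * cLnorm mu 2%:E (fun x => (f_ k x - f x)%R))%E \is a fin_num by near: k.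
rewrite -(fineK hf) lee_fin distrC => /le_trans; apply.
have : `|0 - fine ('N[mu]_2%:E[EFin \o h] * cLnorm mu 2%:E (fun x => (f_ k x - f x)%R))%E| <= e by near: k.
by rewrite sub0r normrN; apply: le_trans; exact: ler_norm.
Unshelve. all: by end_near. Qed.

End L2.

(** * The multiplication formula for the Fourier transform *)

Section multiplication_formula.
Context {R : realType} {n : nat}.
Local Notation spt := (spacetime R n).
Local Notation mu := (@lebesgue_spt R n).
Implicit Types z m : spt.

Definition origin_spt : spt := ([tuple (0 : R) | _ < n], 0 : R).

Definition freq_gauss (b : R) z : R := expR (- (b * dot_spt z z)).

(* The Fourier transform of [freq_gauss b], centred at [z0]. *)
Definition mollifier (b : R) z0 z : R :=
  Num.sqrt (pi / b) ^+ n.+1 * expR (- (pi ^+ 2 / b * sqdist_spt z z0)).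

Lemma sqdist_spt0 z : sqdist_spt z origin_spt = dot_spt z z.
Proof.
rewrite /sqdist_spt /dot_spt /sqdist /dotp/= subr0 expr2; congr (_ + _).
by apply: eq_bigr => i _; rewrite tnth_mktuple subr0 expr2.
Qed.

Lemma dot_spt_ge0 z : 0 <= dot_spt z z.
Proof. by rewrite -sqdist_spt0 sqdist_spt_ge0. Qed.

Lemma measurable_dot_sptz : measurable_fun [set: spt] (fun z => dot_spt z z).
Proof. by under eq_fun do rewrite -sqdist_spt0; exact: measurable_sqdist_spt. Qed.

Lemma measurable_freq_gauss b : measurable_fun [set: spt] (freq_gauss b).
Proof. by apply: mfun_expR; apply: mfun_opp; apply: mfun_mul; [exact: mfun_cst|exact: measurable_dot_sptz]. Qed.

Lemma freq_gauss_ge0 b z : 0 <= freq_gauss b z.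
Proof. exact: expR_ge0. Qed.

Lemma mollifier_ge0 b z0 z : 0 <= mollifier b z0 z.
Proof. by rewrite mulr_ge0 ?expR_ge0// exprn_ge0// sqrtr_ge0. Qed.

Lemma measurable_mollifier b z0 : measurable_fun [set: spt] (mollifier b z0).
Proof.
apply: mfun_mul; first exact: mfun_cst.
by apply: mfun_expR; apply: mfun_opp; apply: mfun_mul; [exact: mfun_cst|exact: measurable_sqdist_spt].
Qed.

Lemma integrable_freq_gauss b : 0 < b -> mu.-integrable setT (fun z => (freq_gauss b z)%:E).
Proof.
move=> b0; have [h _] := gauss_spt origin_spt b0.
by move: h; under eq_fun do rewrite sqdist_spt0.
Qed.

Lemma integrable_freq_gauss_sqr b : 0 < b -> mu.-integrable setT (fun z => (freq_gauss b z ^+ 2)%:E).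
Proof.
move=> b0; have b20 : 0 < b + b by rewrite addr_gt0.
have := integrable_freq_gauss b20; apply: eq_integrable => // z _.
by rewrite /freq_gauss expr2 -expRD mulrDl opprD.
Qed.

Lemma integrable_mollifier b z0 : 0 < b -> mu.-integrable setT (fun z => (mollifier b z0 z)%:E).
Proof.
move=> b0; have c0 : 0 < pi ^+ 2 / b by rewrite divr_gt0// exprn_gt0// pi_gt0.
by have [h _] := gauss_spt z0 c0; exact: integrableZl_fin.
Qed.

Lemma integrable_mollifier_sqr b z0 : 0 < b -> mu.-integrable setT (fun z => (mollifier b z0 z ^+ 2)%:E).
Proof.
move=> b0; have c0 : 0 < pi ^+ 2 / b by rewrite divr_gt0// exprn_gt0// pi_gt0.
have c20 : 0 < pi ^+ 2 / b + pi ^+ 2 / b by rewrite addr_gt0.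
have [h _] := gauss_spt z0 c20.
have := integrableZl_fin ((Num.sqrt (pi / b) ^+ n.+1) ^+ 2) measurableT h; apply: eq_integrable => // z _.
by rewrite /mollifier exprMn; congr ((_ * _)%:E); rewrite [RHS]expr2 -expRD; congr expR; ring.
Qed.

(** The frequency is [kk = 2 pi (z0 - z)]; it brings the Fourier integral of [freq_gauss] to the
    form treated in [gauss_spt]. *)
Lemma dot_spt_sub z0 z : exists2 kk : spt, forall zeta, dot_spt zeta kk = 2 * pi * (dot_spt z0 zeta - dot_spt z zeta) &
  dot_spt kk kk = (2 * pi) ^+ 2 * sqdist_spt z z0.
Proof.
exists ([tuple 2 * pi * (tnth z0.1 i - tnth z.1 i) | i < n] : Rn R n, 2 * pi * ((z0.2 : R) - z.2)).
  move=> zeta; rewrite /dot_spt /dotp/= opprD addrACA [RHS]mulrDr; congr (_ + _); last by ring.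
  rewrite -sumrB mulr_sumr; apply: eq_bigr => i _; rewrite tnth_mktuple; ring.
rewrite /dot_spt /sqdist_spt /dotp /sqdist/= [RHS]mulrDr; congr (_ + _); last by ring.
rewrite mulr_sumr; apply: eq_bigr => i _; rewrite !tnth_mktuple; ring.
Qed.

Lemma fourier_freq_gauss b z0 z d : 0 < b ->
  \int[mu]_zeta (freq_gauss b zeta * cos (2 * pi * (dot_spt z0 zeta - dot_spt z zeta) + d)) =
  mollifier b z0 z * cos d.
Proof.
move=> b0; have [kk kE k2] := dot_spt_sub z0 z.
have [_ h] := gauss_spt origin_spt b0; have := h kk d.
under eq_Rintegral do rewrite sqdist_spt0 kE.
rewrite /freq_gauss => ->.
rewrite k2 kE /mollifier.
have d0 (y : spt) : dot_spt y origin_spt = 0.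
  by rewrite /dot_spt /dotp/= mulr0 addr0 big1// => i _; rewrite tnth_mktuple mulr0.
rewrite !d0 subrr mulr0 add0r; congr (_ * expR (- _) * _).
by field; rewrite gt_eqF.
Qed.

Lemma dot_sptC z (k : spt) : dot_spt z k = dot_spt k z.
Proof. by rewrite /dot_spt /dotp mulrC; congr (_ + _); apply: eq_bigr => i _; rewrite mulrC. Qed.

Lemma measurable_dot_sptr z0 : measurable_fun [set: spt] (dot_spt z0).
Proof. by rewrite (_ : dot_spt z0 = dot_spt ^~ z0); [exact: measurable_dot_spt|apply/funext => z; exact: dot_sptC]. Qed.

Lemma measurable_dot_spt2 : measurable_fun [set: spt * spt] (fun p => dot_spt p.2 p.1).
Proof.
apply: mfun_add.
  apply: mfun_sum => i; apply: mfun_mul.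
    by apply: measurableT_comp (measurable_tnth i) _; apply: measurableT_comp; [exact: measurable_fst|exact: measurable_snd].
  by apply: measurableT_comp (measurable_tnth i) _; apply: measurableT_comp; [exact: measurable_fst|exact: measurable_fst].
apply: mfun_mul; apply: measurableT_comp; [exact: measurable_snd|exact: measurable_snd|exact: measurable_snd|exact: measurable_fst].
Qed.

Lemma Re_mul_expi (w : R[i]) y : complex.Re (w * expi y) = rephase w y.
Proof. by case: w. Qed.

Lemma Im_mul_expi (w : R[i]) y : complex.Im (w * expi y) = rephase w (y - pi / 2).
Proof. by case: w => a e; rewrite /rephase/= cosBpihalf sinBpihalf; ring. Qed.

Lemma rephaseD (w : R[i]) y e : rephase w y * cos e - rephase w (y - pi / 2) * sin e = rephase w (y + e).
Proof.
by case: w => a u; rewrite /rephase/= cosBpihalf sinBpihalf cosD sinD; ring.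
Qed.

Section L1.
Variable u : spt -> R[i].
Hypothesis uL1 : memLp mu 1%:E u.

(** The real and imaginary parts of the kernel are both values of [rephase], and [rephaseD]
    recombines them into a single phase. *)
Lemma fourierL1_rephase zeta chi :
  mu.-integrable setT (fun z => (rephase (u z) (chi - 2 * pi * dot_spt z zeta))%:E) /\
  rephase (fourierL1 u zeta) chi = \int[mu]_z rephase (u z) (chi - 2 * pi * dot_spt z zeta).
Proof.
have [mr mi _] := uL1; have iu := L1_integrable uL1.
have ir e : mu.-integrable setT (fun z => (rephase (u z) (e - 2 * pi * dot_spt z zeta))%:E).
  apply: (integrable_dominated _ iu) => [|z]; last exact: rephase_le.
  apply: measurable_rephase => //; apply: mfun_add; first exact: mfun_cst.
  by apply: mfun_opp; apply: mfun_mul; [exact: mfun_cst|exact: measurable_dot_spt].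
split=> //; rewrite /fourierL1 /cintegral /rephase/=.
under eq_Rintegral do rewrite Re_mul_expi.
under [X in _ - X * _]eq_Rintegral do rewrite Im_mul_expi.
have i0 := ir 0; have i1 := ir (- (pi / 2)).
rewrite -!RintegralZr//; last 2 first.
- by apply: eq_integrable i1 => // z _; rewrite addrC.
- by apply: eq_integrable i0 => // z _; rewrite add0r.
rewrite -RintegralB//; last 2 first.
- by apply: integrableZr_fin => //; apply: eq_integrable i0 => // z _; rewrite add0r.
- by apply: integrableZr_fin => //; apply: eq_integrable i1 => // z _; rewrite addrC.
by apply: eq_Rintegral => z _; rewrite rephaseD addrC.
Qed.

Lemma measurable_rephase2 b z0 e : measurable_fun [set: spt * spt]
  (fun p => freq_gauss b p.1 * rephase (u p.2) (2 * pi * dot_spt z0 p.1 + e - 2 * pi * dot_spt p.2 p.1)).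
Proof.
have [mr mi _] := uL1.
have m1 : measurable_fun [set: spt * spt] (fst : _ -> spt) by exact: measurable_fst.
have m2 : measurable_fun [set: spt * spt] (snd : _ -> spt) by exact: measurable_snd.
apply: mfun_mul; first exact: (measurableT_comp (measurable_freq_gauss b) m1).
apply: measurable_rephase; [exact: (measurableT_comp mr m2)|exact: (measurableT_comp mi m2)|].
have md := measurable_dot_sptr z0.
apply: mfun_add.
  by apply: mfun_add; [apply: mfun_mul; [exact: mfun_cst|exact: (measurableT_comp md m1)]|exact: mfun_cst].
by apply: mfun_opp; apply: mfun_mul; [exact: mfun_cst|exact: measurable_dot_spt2].
Qed.

Lemma fourierL1_integrable b z0 e : 0 < b ->
  mu.-integrable setT (fun zeta => (freq_gauss b zeta * rephase (fourierL1 u zeta) (2 * pi * dot_spt z0 zeta + e))%:E) /\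
  \int[mu]_zeta (freq_gauss b zeta * rephase (fourierL1 u zeta) (2 * pi * dot_spt z0 zeta + e)) =
  \int[mu]_z \int[mu]_zeta (freq_gauss b zeta * rephase (u z) (2 * pi * dot_spt z0 zeta + e - 2 * pi * dot_spt z zeta)).
Proof.
move=> b0; have iu := L1_integrable uL1; have ig := integrable_freq_gauss b0.
pose F (p : spt * spt) := freq_gauss b p.1 * rephase (u p.2) (2 * pi * (dot_spt z0 p.1) + e - 2 * pi * dot_spt p.2 p.1).
have mF : measurable_fun setT F := measurable_rephase2 b z0 e.
have Fle x y : `|F (x, y)| <= freq_gauss b x * cmod (u y).
  by rewrite /F normrM ger0_norm ?freq_gauss_ge0// ler_wpM2l ?freq_gauss_ge0// rephase_le.
have E1 zeta : freq_gauss b zeta * rephase (fourierL1 u zeta) (2 * pi * dot_spt z0 zeta + e) = \int[mu]_z F (zeta, z).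
  have [ir ->] := fourierL1_rephase zeta (2 * pi * dot_spt z0 zeta + e).
  by rewrite -RintegralZl.
split.
  have := integrable_fubini1 ig iu mF Fle; apply: eq_integrable => // zeta _.
  by rewrite E1.
under eq_Rintegral do rewrite E1.
by rewrite -(Rfubini1 ig iu mF Fle) (Rfubini2 ig iu mF Fle).
Qed.

(** Fubini gives measurability of the transform times a Gaussian, and the Gaussian is divided out.
    Centring at the origin leaves the constant phase [e]. *)
Lemma measurable_fourierL1 :
  measurable_fun [set: spt] (fun zeta => complex.Re (fourierL1 u zeta)) /\
  measurable_fun [set: spt] (fun zeta => complex.Im (fourierL1 u zeta)).
Proof.
have d0 y : dot_spt origin_spt y = 0.
  by rewrite /dot_spt /dotp/= mul0r addr0 big1// => i _; rewrite tnth_mktuple mul0r.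
have key e : measurable_fun [set: spt] (fun zeta => rephase (fourierL1 u zeta) e).
  rewrite (_ : (fun _ => _) = fun zeta => expR (1 * dot_spt zeta zeta) * (freq_gauss 1 zeta * rephase (fourierL1 u zeta) (2 * pi * dot_spt origin_spt zeta + e))).
    apply: mfun_mul.
      by apply: mfun_expR; apply: mfun_mul; [exact: mfun_cst|exact: measurable_dot_sptz].
    by have [h _] := fourierL1_integrable origin_spt e (@ltr01 R); exact: integrable_measurable h.
  apply/funext => zeta; rewrite mulrA -expRD addrN expR0 mul1r d0 mulr0 add0r//.
split.
  by have := key 0; rewrite /rephase cos0 sin0; under eq_fun do rewrite mulr0 subr0 mulr1.
have := key (- (pi / 2)); rewrite /rephase cosN sinN cos_pihalf sin_pihalf.
by under eq_fun do rewrite mulr0 sub0r mulrN opprK mulr1.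
Qed.

Lemma multiplication_formula_L1 b z0 : 0 < b ->
  \int[mu]_zeta (freq_gauss b zeta * rephase (fourierL1 u zeta) (2 * pi * dot_spt z0 zeta + 0)) =
  \int[mu]_z (mollifier b z0 z * rephase (u z) 0).
Proof.
move=> b0; have [_ ->] := fourierL1_integrable z0 0 b0.
apply: eq_Rintegral => z _.
have ic d : mu.-integrable setT (fun zeta => (freq_gauss b zeta * cos (2 * pi * (dot_spt z0 zeta - dot_spt z zeta) + d))%:E).
  apply: (integrable_dominated _ (integrable_freq_gauss b0)).
    apply: mfun_mul; first exact: measurable_freq_gauss.
    apply: mfun_cos; apply: mfun_add; last exact: mfun_cst.
    apply: mfun_mul; first exact: mfun_cst.
    apply: mfun_add; last apply: mfun_opp.
      exact: measurable_dot_sptr.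
    exact: measurable_dot_sptr.
  by move=> zeta; rewrite normrM ger0_norm ?freq_gauss_ge0// ler_piMr ?freq_gauss_ge0// cos_max.
(* The phase [pi / 2] turns the cosine into minus the sine. Its integral against the Gaussian
   carries the factor [cos (pi / 2) = 0], so only the real part of [u] survives. *)
transitivity (\int[mu]_zeta (complex.Re (u z) * (freq_gauss b zeta * cos (2 * pi * (dot_spt z0 zeta - dot_spt z zeta) + 0)) +
   complex.Im (u z) * (freq_gauss b zeta * cos (2 * pi * (dot_spt z0 zeta - dot_spt z zeta) + pi / 2)))).
  apply: eq_Rintegral => zeta _; rewrite /rephase cosDpihalf.
  have -> : 2 * pi * dot_spt z0 zeta + 0 - 2 * pi * dot_spt z zeta = 2 * pi * (dot_spt z0 zeta - dot_spt z zeta) + 0 by ring.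
  by rewrite addr0; ring.
rewrite RintegralD//; [|exact: integrableZl_fin (ic 0)|exact: integrableZl_fin (ic (pi / 2))].
rewrite (@RintegralZl _ _ _ mu setT _ _ measurableT (ic 0)) (fourier_freq_gauss z0 z 0 b0).
rewrite (@RintegralZl _ _ _ mu setT _ _ measurableT (ic (pi / 2))) (fourier_freq_gauss z0 z _ b0) cos_pihalf cos0.
by rewrite /rephase cos0 sin0; ring.
Qed.

End L1.

(** Both sides are pairings with a square-integrable Gaussian, so the [L^1] formula passes to the
    limit along the sequence provided by [is_fourier]. *)
Lemma multiplication_formula (u g : spt -> R[i]) b z0 : is_fourier u g -> 0 < b ->
  \int[mu]_zeta (freq_gauss b zeta * rephase (g zeta) (2 * pi * dot_spt z0 zeta)) =
  \int[mu]_z (mollifier b z0 z * complex.Re (u z)).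
Proof.
move=> [uL2 gL2 [u_ [uk cu cg]]] b0.
have [mru miu _] := uL2; have [mrg mig _] := gL2.
have mchi : measurable_fun [set: spt] (fun zeta => 2 * pi * dot_spt z0 zeta + 0).
  apply: mfun_add; last exact: mfun_cst; apply: mfun_mul; first exact: mfun_cst.
  exact: measurable_dot_sptr.
have rL2 (h chi : spt -> R) (f : spt -> R[i]) : measurable_fun setT h -> measurable_fun setT chi -> memLp mu 2%:E f ->
    mu.-integrable setT (fun x => (h x ^+ 2)%:E) -> mu.-integrable setT (fun x => (h x * rephase (f x) (chi x))%:E).
  move=> mh mc fL2 ih; have [mr mi _] := fL2; apply: L2_mul => //; first exact: measurable_rephase.
  apply: (integrable_dominated _ (L2_integrable fL2)); first by apply: mfun_exp; exact: measurable_rephase.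
  move=> x; rewrite ger0_norm ?sqr_ge0// -(real_normK (num_real (rephase _ _))).
  by rewrite lerXn2r ?nnegrE ?cmod_ge0// rephase_le.
have ih := integrable_freq_gauss_sqr b0; have im := integrable_mollifier_sqr z0 b0.
have c1 := @rephase_cvg _ _ _ mu (freq_gauss b) (fun zeta => 2 * pi * dot_spt z0 zeta + 0) (fun k => fourierL1 (u_ k)) g
  (measurable_freq_gauss b) mchi ih (fun k => measurable_fourierL1 (uk k).1) mrg mig
  (fun k => (fourierL1_integrable (uk k).1 z0 0 b0).1) (rL2 _ _ _ (measurable_freq_gauss b) mchi gL2 ih) cg.
have c2 := @rephase_cvg _ _ _ mu (mollifier b z0) (fun=> 0) u_ u
  (measurable_mollifier b z0) (mfun_cst 0) im (fun k => let: conj _ (And3 a e _) := uk k in conj a e) mru miu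
  (fun k => rL2 _ _ _ (measurable_mollifier b z0) (mfun_cst 0) (uk k).2 im) (rL2 _ _ _ (measurable_mollifier b z0) (mfun_cst 0) uL2 im) cu.
under eq_Rintegral do rewrite -[X in rephase _ X]addr0.
rewrite (_ : (fun z => mollifier b z0 z * complex.Re (u z)) = fun z => mollifier b z0 z * rephase (u z) 0); last first.
  by apply/funext => z; rewrite /rephase cos0 sin0 mulr0 subr0 mulr1.
have e : (fun k => \int[mu]_zeta (freq_gauss b zeta * rephase (fourierL1 (u_ k) zeta) (2 * pi * dot_spt z0 zeta + 0))) =
    fun k => \int[mu]_z (mollifier b z0 z * rephase (u_ k z) 0).
  by apply/funext => k; exact: (multiplication_formula_L1 (uk k).1 z0 b0).
rewrite e in c1.
exact: cvg_unique c1 c2.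
Qed.

End multiplication_formula.

(** * Caloric averages *)

Section heat_average.
Context {R : realType} {n : nat}.
Local Notation spt := (spacetime R n).
Local Notation mu := (@lebesgue_spt R n).
Local Notation lRn := (@lebesgue_Rn R n).

Definition heat_kernel (tau : R) (x y : Rn R n) : R :=
  (Num.sqrt (4 * pi * tau) ^+ n)^-1 * expR (- ((4 * tau)^-1 * sqdist y x)).

Lemma heat_kernel_ge0 tau x y : 0 <= heat_kernel tau x y.
Proof. by rewrite mulr_ge0 ?expR_ge0// invr_ge0 exprn_ge0// sqrtr_ge0. Qed.

Lemma measurable_heat_kernel tau x : measurable_fun [set: Rn R n] (heat_kernel tau x).
Proof.
apply: mfun_mul; first exact: mfun_cst.
by apply: mfun_expR; apply: mfun_opp; apply: mfun_mul; [exact: mfun_cst|exact: measurable_sqdist].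
Qed.

Lemma integrable_heat_kernel tau x : 0 < tau -> lRn.-integrable setT (fun y => (heat_kernel tau x y)%:E).
Proof.
move=> t0; have c0 : 0 < (4 * tau)^-1 by rewrite invr_gt0 mulr_gt0.
by have [h _] := gauss_Rn x c0; exact: integrableZl_fin.
Qed.

Lemma fourier_heat_kernel tau x (xi : Rn R n) d : 0 < tau ->
  lRn.-integrable setT (fun y => (heat_kernel tau x y * cos (2 * pi * dotp y xi + d))%:E) /\
  \int[lRn]_y (heat_kernel tau x y * cos (2 * pi * dotp y xi + d)) =
  expR (- (tau * (4 * pi ^+ 2 * dotp xi xi))) * cos (2 * pi * dotp x xi + d).
Proof.
move=> t0; have c0 : 0 < (4 * tau)^-1 by rewrite invr_gt0 mulr_gt0.
have tn : tau != 0 by rewrite gt_eqF.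
have [h H] := gauss_Rn x c0.
pose k : Rn R n := [tuple 2 * pi * tnth xi i | i < n].
have kE y : dotp y k = 2 * pi * dotp y xi.
  by rewrite /dotp mulr_sumr; apply: eq_bigr => i _; rewrite tnth_mktuple; ring.
have kk : dotp k k = (2 * pi) ^+ 2 * dotp xi xi.
  by rewrite /dotp mulr_sumr; apply: eq_bigr => i _; rewrite tnth_mktuple; ring.
have E y : heat_kernel tau x y * cos (2 * pi * dotp y xi + d) =
    (Num.sqrt (4 * pi * tau) ^+ n)^-1 * gauss_phase (4 * tau)^-1 x k d y.
  by rewrite /heat_kernel /gauss_phase kE mulrA.
have ig : lRn.-integrable setT (fun y => (gauss_phase (4 * tau)^-1 x k d y)%:E).
  apply: (integrable_dominated _ h); first exact: measurable_gauss_phase.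
  by move=> y; rewrite normrM (ger0_norm (expR_ge0 _)) ler_piMr ?expR_ge0// cos_max.
split.
  by have := integrableZl_fin (Num.sqrt (4 * pi * tau) ^+ n)^-1 measurableT ig; apply: eq_integrable => // y _; rewrite E.
under eq_Rintegral do rewrite E.
rewrite (@RintegralZl _ _ _ lRn setT _ _ measurableT ig) H kk kE.
have -> : pi / (4 * tau)^-1 = 4 * pi * tau by field.
rewrite !mulrA mulVf ?mul1r; last first.
  by rewrite expf_neq0// gt_eqF// sqrtr_gt0 !mulr_gt0// pi_gt0.
by congr (expR (- _) * _); field.
Qed.

Lemma heat_kernel_mass tau x : 0 < tau -> \int[lRn]_y heat_kernel tau x y = 1.
Proof.
move=> t0; pose o : Rn R n := [tuple 0 | _ < n].
have o0 y : dotp y o = 0 by rewrite /dotp big1// => i _; rewrite tnth_mktuple mulr0.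
have [_] := fourier_heat_kernel x o 0 t0; rewrite !o0 !mulr0 addr0 oppr0 expR0 cos0 mulr1 => <-.
by apply: eq_Rintegral => y _; rewrite o0 mulr0 addr0 cos0 mulr1.
Qed.

Variables (uh : spt -> R[i]).
Hypothesis uhL2 : memLp mu 2%:E uh.

Definition symbol_re (zeta : spt) : R := 4 * pi ^+ 2 * dotp zeta.1 zeta.1.
Definition symbol_im (zeta : spt) : R := 2 * pi * (zeta.2 : R).

(* By [multiplication_formula] this is the convolution of [u] with the Gaussian
   [mollifier b], where [uh] is the Fourier transform of [u]. *)
Definition mollified (b : R) (z : spt) : R :=
  \int[mu]_zeta (freq_gauss b zeta * rephase (uh zeta) (2 * pi * dot_spt z zeta)).

Lemma dotp_self_ge0 (x : Rn R n) : 0 <= dotp x x.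
Proof. by apply: sumr_ge0 => i _; rewrite -expr2 sqr_ge0. Qed.

Lemma symbol_re_ge0 zeta : 0 <= symbol_re zeta.
Proof. by apply: mulr_ge0; [rewrite mulr_ge0 ?sqr_ge0|exact: dotp_self_ge0]. Qed.

Lemma measurable_symbol_re : measurable_fun [set: spt] symbol_re.
Proof.
apply: mfun_mul; first exact: mfun_cst.
by apply: mfun_sum => i; apply: mfun_mul; exact: (measurableT_comp (measurable_tnth i) measurable_fst).
Qed.

Lemma measurable_symbol_im : measurable_fun [set: spt] symbol_im.
Proof. by apply: mfun_mul; [exact: mfun_cst|exact: measurable_snd]. Qed.

Lemma integrable_gauss_uh b : 0 < b -> mu.-integrable setT (fun zeta => (freq_gauss b zeta * cmod (uh zeta))%:E).
Proof.
move=> b0; have [mr mi _] := uhL2; apply: L2_mul.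
- exact: measurable_freq_gauss.
- exact: (measurable_cmod mr mi).
- exact: integrable_freq_gauss_sqr.
- exact: L2_integrable.
Qed.

Lemma integrable_gauss_rephase b chi : 0 < b -> measurable_fun [set: spt] chi ->
  mu.-integrable setT (fun zeta => (freq_gauss b zeta * rephase (uh zeta) (chi zeta))%:E).
Proof.
move=> b0 mchi; have [mr mi _] := uhL2; apply: (integrable_dominated _ (integrable_gauss_uh b0)).
  by apply: mfun_mul; [exact: measurable_freq_gauss|exact: measurable_rephase].
by move=> zeta; rewrite normrM ger0_norm ?freq_gauss_ge0// ler_wpM2l ?freq_gauss_ge0// rephase_le.
Qed.

Lemma measurable_phase z : measurable_fun [set: spt] (fun zeta => 2 * pi * dot_spt z zeta).
Proof. by apply: mfun_mul; [exact: mfun_cst|exact: measurable_dot_sptr]. Qed.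

Definition heat_avg b tau (z : spt) : R :=
  \int[lRn]_y (heat_kernel tau z.1 y * mollified b (y, (z.2 : R) - tau)).

(** The heat kernel contributes the factor [exp (- tau * symbol_re)] and the time shift the phase
    [- tau * symbol_im]: the caloric average is the Fourier multiplier [exp (- tau lambda)] with
    [lambda = symbol_re + i symbol_im]. *)
Lemma heat_avgE b tau (z : spt) : 0 < b -> 0 < tau ->
  lRn.-integrable setT (fun y => (heat_kernel tau z.1 y * mollified b (y, (z.2 : R) - tau))%:E) /\
  heat_avg b tau z = \int[mu]_zeta (freq_gauss b zeta *
    (expR (- (tau * symbol_re zeta)) * rephase (uh zeta) (2 * pi * dot_spt z zeta - tau * symbol_im zeta))).
Proof.
move=> b0 t0; have [mr mi _] := uhL2.
pose F (p : Rn R n * spt) := heat_kernel tau z.1 p.1 * (freq_gauss b p.2 * rephase (uh p.2) (2 * pi * dot_spt (p.1, (z.2 : R) - tau) p.2)).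
have m1 : measurable_fun [set: Rn R n * spt] (fst : _ -> Rn R n) by exact: measurable_fst.
have m2 : measurable_fun [set: Rn R n * spt] (snd : _ -> spt) by exact: measurable_snd.
have m21 : measurable_fun [set: Rn R n * spt] (fun p => p.2.1 : Rn R n) by exact: (measurableT_comp measurable_fst m2).
have m22 : measurable_fun [set: Rn R n * spt] (fun p => p.2.2 : R) by exact: (measurableT_comp measurable_snd m2).
have mF : measurable_fun setT F.
  apply: mfun_mul; first exact: (measurableT_comp (measurable_heat_kernel tau z.1) m1).
  apply: mfun_mul; first exact: (measurableT_comp (measurable_freq_gauss b) m2).
  apply: measurable_rephase; [exact: (measurableT_comp mr m2)|exact: (measurableT_comp mi m2)|].
  apply: mfun_mul; first exact: mfun_cst.
  apply: mfun_add; last by apply: mfun_mul; [exact: mfun_cst|exact: m22].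
  apply: mfun_sum => i; apply: mfun_mul; first exact: (measurableT_comp (measurable_tnth i) m1).
  exact: (measurableT_comp (measurable_tnth i) m21).
have Fle y zeta : `|F (y, zeta)| <= heat_kernel tau z.1 y * (freq_gauss b zeta * cmod (uh zeta)).
  rewrite /F normrM ger0_norm ?heat_kernel_ge0// ler_wpM2l ?heat_kernel_ge0//.
  by rewrite normrM ger0_norm ?freq_gauss_ge0// ler_wpM2l ?freq_gauss_ge0// rephase_le.
have ik := integrable_heat_kernel z.1 t0; have iu := integrable_gauss_uh b0.
have E1 y : heat_kernel tau z.1 y * mollified b (y, (z.2 : R) - tau) = \int[mu]_zeta F (y, zeta).
  have iy := integrable_gauss_rephase b0 (measurable_phase (y, (z.2 : R) - tau)).
  by rewrite /mollified -(@RintegralZl _ _ _ mu setT _ _ measurableT iy).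
split.
  by have := integrable_fubini1 ik iu mF Fle; apply: eq_integrable => // y _; rewrite E1.
rewrite /heat_avg; under eq_Rintegral do rewrite E1.
rewrite -(Rfubini1 ik iu mF Fle) (Rfubini2 ik iu mF Fle).
apply: eq_Rintegral => zeta _; rewrite /F/=.
pose d := 2 * pi * (((z.2 : R) - tau) * zeta.2).
have [i0 I0] := fourier_heat_kernel z.1 zeta.1 d t0.
have [i1 I1] := fourier_heat_kernel z.1 zeta.1 (d + pi / 2) t0.
transitivity (\int[lRn]_y (freq_gauss b zeta * complex.Re (uh zeta) * (heat_kernel tau z.1 y * cos (2 * pi * dotp y zeta.1 + d)) +
   freq_gauss b zeta * complex.Im (uh zeta) * (heat_kernel tau z.1 y * cos (2 * pi * dotp y zeta.1 + (d + pi / 2))))).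
  apply: eq_Rintegral => y _.
  have -> : 2 * pi * dot_spt (y, (z.2 : R) - tau) zeta = 2 * pi * dotp y zeta.1 + d by rewrite /dot_spt /d/=; ring.
  by rewrite /rephase (addrA (2 * pi * dotp y zeta.1)) cosDpihalf; ring.
rewrite RintegralD//; [|exact: integrableZl_fin i0|exact: integrableZl_fin i1].
rewrite (@RintegralZl _ _ _ lRn setT _ _ measurableT i0) (@RintegralZl _ _ _ lRn setT _ _ measurableT i1) I0 I1.
rewrite (addrA (2 * pi * dotp z.1 zeta.1)) cosDpihalf /rephase -/(symbol_re zeta).
have -> : 2 * pi * dot_spt z zeta - tau * symbol_im zeta = 2 * pi * dotp z.1 zeta.1 + d.
  by rewrite /dot_spt /symbol_im /d; ring.
by ring.
Qed.

End heat_average.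

(** * From caloric averages to the fractional operator *)

Section fractional_identity.
Context {R : realType} {n : nat}.
Local Notation leb := (@lebesgue_measure R).
Local Notation spt := (spacetime R n).
Local Notation mu := (@lebesgue_spt R n).
Variables (s : R) (s0 : 0 < s) (s1 : s < 1).
Variables (uh : spt -> R[i]).
Hypothesis uhL2 : memLp mu 2%:E uh.

(** Chosen so that [2 + symbol_re + |symbol_im|] is at most this constant times [1 + b / 2 * N],
    where [N = dot_spt zeta zeta]; as [1 + y <= exp y], half of the Gaussian absorbs the growth of
    the symbol. *)
Definition symbol_bound (b : R) : R := (2 + 2 * pi) + (4 * pi ^+ 2 + 2 * pi) * (2 / b).

Lemma symbol_bound_ge0 b : 0 < b -> 0 <= symbol_bound b.
Proof.
move=> b0; have p0 : 0 <= pi :> R by exact: pi_ge0.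
have i0 : 0 <= 2 / b by rewrite divr_ge0// ltW.
apply: addr_ge0; first by apply: addr_ge0 => //; rewrite mulr_ge0.
apply: mulr_ge0 => //; apply: addr_ge0; apply: mulr_ge0 => //; exact: sqr_ge0.
Qed.

Lemma symbol_gauss_le b (zeta : spt) : 0 < b ->
  (2 + symbol_re zeta + `|symbol_im zeta|) * freq_gauss b zeta <= symbol_bound b * freq_gauss (b / 2) zeta.
Proof.
move=> b0; have bn : b != 0 by rewrite gt_eqF.
have p0 : 0 <= pi :> R by exact: pi_ge0.
set N := dot_spt zeta zeta; set x := dotp zeta.1 zeta.1; set y : R := zeta.2.
have NE : N = x + y ^+ 2 by rewrite /N /dot_spt expr2.
have x0 : 0 <= x by exact: dotp_self_ge0.
have h1 : 2 + symbol_re zeta + `|symbol_im zeta| <= symbol_bound b * (1 + b / 2 * N).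
  rewrite /symbol_bound /symbol_re /symbol_im -/x -/y normrM ger0_norm ?mulr_ge0//.
  have yb : `|y| <= 1 + y ^+ 2.
    by rewrite -(real_normK (num_real y)); have := normr_ge0 y; nra.
  have y2 := sqr_ge0 y; have N0 : 0 <= N by rewrite NE addr_ge0.
  have -> : (2 + 2 * pi + (4 * pi ^+ 2 + 2 * pi) * (2 / b)) * (1 + b / 2 * N) =
    2 + 2 * pi + (4 * pi ^+ 2 + 2 * pi) * N + ((2 + 2 * pi) * (b / 2 * N) + (4 * pi ^+ 2 + 2 * pi) * (2 / b)) by field.
  have b2 : 0 <= b / 2 by rewrite divr_ge0// ltW.
  have i2 : 0 <= 2 / b by rewrite divr_ge0// ltW.
  have P2 : 0 <= 4 * pi ^+ 2 :> R by rewrite mulr_ge0// sqr_ge0.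
  have P1 : 0 <= 2 * pi :> R by rewrite mulr_ge0.
  have e1 : 0 <= (2 + 2 * pi) * (b / 2 * N) by rewrite mulr_ge0 ?addr_ge0// mulr_ge0.
  have e2 : 0 <= (4 * pi ^+ 2 + 2 * pi) * (2 / b) by rewrite mulr_ge0// addr_ge0.
  have e3 : 2 * pi * `|y| <= 2 * pi * (1 + y ^+ 2) by rewrite ler_wpM2l.
  have e4 : 4 * pi ^+ 2 * x <= 4 * pi ^+ 2 * N by rewrite ler_wpM2l// NE lerDl.
  have e5 : 2 * pi * y ^+ 2 <= 2 * pi * N by rewrite ler_wpM2l// NE lerDr.
  rewrite (mulrDl (4 * pi ^+ 2)); lra.
have -> : freq_gauss (b / 2) zeta = expR (b / 2 * N) * freq_gauss b zeta.
  by rewrite /freq_gauss -expRD -/N; congr expR; field.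
rewrite mulrA ler_wpM2r ?freq_gauss_ge0//; apply: (le_trans h1).
by rewrite ler_wpM2l ?symbol_bound_ge0// expR_ge1Dx.
Qed.

Lemma rephase_cpow (la w : R[i]) chi :
  rephase (cpow la s * w) chi = cmod la `^ s * rephase w (chi + s * carg la).
Proof.
rewrite /cpow; set r := _ `^ _; set th := s * _; case: w => a e.
by rewrite /rephase/= cosD sinD; ring.
Qed.

Lemma rephase_symbol (zeta : spt) (w : R[i]) (chi : R) :
  rephase (heat_symbol s zeta * w) chi =
  cmod (symbol_re zeta +i* symbol_im zeta) `^ s * rephase w (chi + s * carg (symbol_re zeta +i* symbol_im zeta)).
Proof.
rewrite /heat_symbol rephase_cpow.
have -> : (2 * pi * enorm zeta.1) ^+ 2 = symbol_re zeta.
  by rewrite exprMn sqr_sqrtr ?dotp_self_ge0// /symbol_re; ring.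
by [].
Qed.

(** A Lipschitz constant of the caloric averages at [tau = 0], uniform in the point. The summand
    occurs twice, once for the real and once for the imaginary part of [uh]. *)
Definition mollified_lip b : R := \int[mu]_zeta (symbol_bound b * (freq_gauss (b / 2) zeta * cmod (uh zeta)) + symbol_bound b * (freq_gauss (b / 2) zeta * cmod (uh zeta))).

Section fixed_point.
Variables (b : R) (b0 : 0 < b) (z : spt).
Let b20 : 0 < b / 2. Proof. by rewrite divr_gt0. Qed.
Let chi zeta := 2 * pi * dot_spt z zeta.

(** The double integral of [F] is computed in both orders: the inner integral in [zeta] gives the
    weighted difference [V - P_tau V], the one in [tau] gives the fractional power of the symbol. *)
Let F (p : measurableTypeR R * spt) : R := freq_gauss b p.2 *
  (complex.Re (uh p.2) * jump s (symbol_re p.2) (symbol_im p.2) (chi p.2) p.1 +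
   complex.Im (uh p.2) * jump s (symbol_re p.2) (symbol_im p.2) (chi p.2 + pi / 2) p.1).

Let G zeta := symbol_bound b * (freq_gauss (b / 2) zeta * cmod (uh zeta)) + symbol_bound b * (freq_gauss (b / 2) zeta * cmod (uh zeta)).

Let iG : mu.-integrable setT (fun zeta => (G zeta)%:E).
Proof.
have h := integrableZl_fin (symbol_bound b) measurableT (integrable_gauss_uh uhL2 b20).
exact: integrableD_fin.
Qed.

Let G_ge0 zeta : 0 <= G zeta.
Proof.
have h : 0 <= symbol_bound b * (freq_gauss (b / 2) zeta * cmod (uh zeta)).
  by rewrite mulr_ge0 ?symbol_bound_ge0// mulr_ge0 ?freq_gauss_ge0 ?cmod_ge0.
by rewrite addr_ge0.
Qed.

Let mF : measurable_fun setT F.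
Proof.
have [mr mi _] := uhL2.
have m1 : measurable_fun [set: measurableTypeR R * spt] (fst : _ -> measurableTypeR R) by exact: measurable_fst.
have m2 : measurable_fun [set: measurableTypeR R * spt] (snd : _ -> spt) by exact: measurable_snd.
have mj e : measurable_fun [set: measurableTypeR R * spt] (fun p => jump s (symbol_re p.2) (symbol_im p.2) (chi p.2 + e) p.1).
  have mX := measurableT_comp measurable_symbol_re m2; have mY := measurableT_comp measurable_symbol_im m2.
  have mc : measurable_fun [set: measurableTypeR R * spt] (fun p => chi p.2 + e).
    by apply: mfun_add; [exact: (measurableT_comp (measurable_phase z) m2)|exact: mfun_cst].
  apply: mfun_mul; first exact: (measurableT_comp (measurable_jump_weight s) m1).
  apply: mfun_add; first exact: mfun_cos.
  apply: mfun_opp; apply: mfun_mul.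
    by apply: mfun_expR; apply: mfun_opp; apply: mfun_mul.
  by apply: mfun_cos; apply: mfun_add => //; apply: mfun_opp; apply: mfun_mul.
have mj0 := mj 0.
apply: mfun_mul; first exact: (measurableT_comp (measurable_freq_gauss b) m2).
apply: mfun_add; apply: mfun_mul.
- exact: (measurableT_comp mr m2).
- by under eq_fun do rewrite -[chi _]addr0.
- exact: (measurableT_comp mi m2).
- exact: mj.
Qed.

Let Fle tau zeta : `|F (tau, zeta)| <= jump_weight s tau * Num.min 1 tau * G zeta.
Proof.
have hR : `|complex.Re (uh zeta)| <= cmod (uh zeta).
  by have := rephase_le (uh zeta) 0; rewrite /rephase cos0 sin0 mulr0 subr0 mulr1.
have hI : `|complex.Im (uh zeta)| <= cmod (uh zeta).
  by have := rephase_le (uh zeta) (pi / 2); rewrite /rephase cos_pihalf sin_pihalf mulr0 sub0r mulr1 normrN.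
have hj e : `|jump s (symbol_re zeta) (symbol_im zeta) e tau| <= (2 + symbol_re zeta + `|symbol_im zeta|) * (jump_weight s tau * Num.min 1 tau).
  exact: jump_le (symbol_re_ge0 zeta).
have hw : 0 <= jump_weight s tau * Num.min 1 tau.
  have [t0|t0] := leP tau 0; first by rewrite jump_weight_neg// mul0r.
  by rewrite mulr_ge0 ?jump_weight_ge0// le_min ler01 ltW.
have hg := symbol_gauss_le zeta b0.
rewrite /F /G/= normrM (ger0_norm (freq_gauss_ge0 _ _)).
set w := jump_weight s tau * _ in hj hw *; set L := 2 + _ + _ in hj hg *; set M := symbol_bound b in hg *.
set g := freq_gauss b zeta in hg *; set g2 := freq_gauss _ _ in hg *.
set c := cmod _ in hR hI *.
have c0 : 0 <= c by exact: cmod_ge0.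
have g0 : 0 <= g by exact: freq_gauss_ge0.
have step x y : `|x| <= c -> `|y| <= L * w -> g * `|x * y| <= w * (M * (g2 * c)).
  move=> xc yL; rewrite normrM.
  apply: (@le_trans _ _ (g * (c * (L * w)))); first by rewrite ler_wpM2l// ler_pM.
  have -> : g * (c * (L * w)) = (L * g) * (w * c) by ring.
  have -> : w * (M * (g2 * c)) = (M * g2) * (w * c) by ring.
  by rewrite ler_wpM2r// mulr_ge0.
rewrite mulrDr; apply: (@le_trans _ _ (g * `|complex.Re (uh zeta) * jump s (symbol_re zeta) (symbol_im zeta) (chi zeta) tau| + g * `|complex.Im (uh zeta) * jump s (symbol_re zeta) (symbol_im zeta) (chi zeta + pi / 2) tau|)).
  by rewrite -mulrDr ler_wpM2l// ler_normD.
by apply: lerD; apply: step.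
Qed.

Let F_inner tau : \int[mu]_zeta F (tau, zeta) = jump_weight s tau * (mollified uh b z - heat_avg uh b tau z).
Proof.
have [t0|t0] := leP tau 0.
  rewrite jump_weight_neg// mul0r (_ : (fun zeta => _) = cst 0) ?Rintegral_cst ?mul0r//.
  by apply/funext => zeta; rewrite /F /jump/= jump_weight_neg// !mul0r !mulr0 addr0 mulr0.
have [_ ->] := heat_avgE uhL2 z b0 t0.
have i1 := integrable_gauss_rephase uhL2 b0 (measurable_phase z).
have mph : measurable_fun [set: spt] (fun zeta => 2 * pi * dot_spt z zeta - tau * symbol_im zeta).
  apply: mfun_add; first exact: measurable_phase.
  by apply: mfun_opp; apply: mfun_mul; [exact: mfun_cst|exact: measurable_symbol_im].
have i2 : mu.-integrable setT (fun zeta => (freq_gauss b zeta * (expR (- (tau * symbol_re zeta)) * rephase (uh zeta) (2 * pi * dot_spt z zeta - tau * symbol_im zeta)))%:E).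
  have [mr mi _] := uhL2.
  apply: (integrable_dominated _ (integrable_gauss_uh uhL2 b0)).
    apply: mfun_mul; first exact: measurable_freq_gauss.
    apply: mfun_mul; last exact: measurable_rephase.
    by apply: mfun_expR; apply: mfun_opp; apply: mfun_mul; [exact: mfun_cst|exact: measurable_symbol_re].
  move=> zeta; rewrite normrM ger0_norm ?freq_gauss_ge0// ler_wpM2l ?freq_gauss_ge0//.
  rewrite normrM ger0_norm ?expR_ge0// -[leRHS]mul1r ler_pM ?expR_ge0//; last exact: rephase_le.
  by rewrite -expR0 ler_expR oppr_le0 mulr_ge0 ?symbol_re_ge0// ltW.
rewrite /mollified -RintegralB// -(@RintegralZl _ _ _ mu setT _ _ measurableT (integrableB_fin measurableT i1 i2)).
apply: eq_Rintegral => zeta _; rewrite /F /jump/= /rephase -/(chi zeta).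
rewrite cosDpihalf (addrAC (chi zeta)) cosDpihalf; ring.
Qed.

Lemma mollified_lip_ge0 : 0 <= mollified_lip b.
Proof. by apply: Rintegral_ge0 => zeta _; exact: G_ge0. Qed.

(** The majorant [Fle] at fixed [tau], integrated in [zeta] and divided by the positive weight. *)
Lemma mollified_diff_le tau : 0 < tau -> `|mollified uh b z - heat_avg uh b tau z| <= mollified_lip b * Num.min 1 tau.
Proof.
move=> t0; have w0 : 0 < jump_weight s tau by rewrite jump_weight_pos// powR_gt0.
rewrite -(ler_pM2l w0) -{1}(gtr0_norm w0) -normrM -F_inner.
have iF : mu.-integrable setT (fun zeta => (F (tau, zeta))%:E).
  exact: (integrable_section1 iG mF Fle).
apply: le_trans (le_normr_Rintegral measurableT iF) _.
have -> : jump_weight s tau * (mollified_lip b * Num.min 1 tau) = \int[mu]_zeta (jump_weight s tau * Num.min 1 tau * G zeta).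
  by rewrite (@RintegralZl _ _ _ mu setT _ _ measurableT iG) /mollified_lip; ring.
apply: le_Rintegral => //; first exact: integrable_norm iF.
  exact: integrableZl_fin iG.
Qed.

Lemma fractional_identity : memLp mu 2%:E (fun zeta => heat_symbol s zeta * uh zeta) ->
  leb.-integrable setT (fun tau => (jump_weight s tau * (mollified uh b z - heat_avg uh b tau z))%:E) /\
  \int[leb]_tau (jump_weight s tau * (mollified uh b z - heat_avg uh b tau z)) =
  jump_const s * \int[mu]_zeta (freq_gauss b zeta * rephase (heat_symbol s zeta * uh zeta) (2 * pi * dot_spt z zeta)).
Proof.
move=> symbL2; have iw := integrable_jump_weight s0 s1.
split.
  have := integrable_fubini1 iw iG mF Fle; apply: eq_integrable => // tau _.
  by rewrite F_inner.
under eq_Rintegral do rewrite -F_inner.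
rewrite -(Rfubini1 iw iG mF Fle) (Rfubini2 iw iG mF Fle).
have E zeta : \int[leb]_tau F (tau, zeta) = jump_const s * (freq_gauss b zeta * rephase (heat_symbol s zeta * uh zeta) (2 * pi * dot_spt z zeta)).
  have j0 := integrable_jump s0 s1 (symbol_im zeta) (chi zeta) (symbol_re_ge0 zeta).
  have j1 := integrable_jump s0 s1 (symbol_im zeta) (chi zeta + pi / 2) (symbol_re_ge0 zeta).
  rewrite /F/= (@RintegralZl _ _ _ leb setT _ _ measurableT (integrableD_fin measurableT (integrableZl_fin _ measurableT j0) (integrableZl_fin _ measurableT j1))).
  rewrite RintegralD//; [|exact: integrableZl_fin j0|exact: integrableZl_fin j1].
  rewrite (@RintegralZl _ _ _ leb setT _ _ measurableT j0) (@RintegralZl _ _ _ leb setT _ _ measurableT j1).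
  rewrite !jump_integral_cpow ?symbol_re_ge0// rephase_symbol -/(chi zeta) /rephase (addrAC (chi zeta)) cosDpihalf.
  by ring.
under eq_Rintegral do rewrite E.
by rewrite RintegralZl//; exact: (integrable_gauss_rephase symbL2 b0 (measurable_phase z)).
Qed.

End fixed_point.
End fractional_identity.

(** * Masses and heat averages of Gaussians *)

Section gauss_composition.
Context {R : realType} {n : nat}.
Local Notation spt := (spacetime R n).
Local Notation mu := (@lebesgue_spt R n).
Local Notation lRn := (@lebesgue_Rn R n).

Definition scale_Rn (r : R) (x : Rn R n) : Rn R n := [tuple r * tnth x i | i < n].

Lemma sqdist_square (a c : R) (x y : Rn R n) : 0 < a + c ->
  a * sqdist y x + c * dotp y y = (a + c) * sqdist y (scale_Rn (a / (a + c)) x) + a * c / (a + c) * dotp x x.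
Proof.
move=> ac; have acn : a + c != 0 by rewrite gt_eqF.
rewrite /sqdist /dotp !mulr_sumr -!big_split/=; apply: eq_bigr => i _.
by rewrite tnth_mktuple; field.
Qed.

Lemma gauss_Rn_mass (c : R) (m : Rn R n) : 0 < c ->
  \int[lRn]_x expR (- (c * sqdist x m)) = Num.sqrt (pi / c) ^+ n.
Proof.
move=> c0; pose o : Rn R n := [tuple 0 | _ < n].
have o0 y : dotp y o = 0 by rewrite /dotp big1// => i _; rewrite tnth_mktuple mulr0.
have [_ /(_ o 0)] := gauss_Rn m c0; rewrite !o0 mul0r oppr0 expR0 addr0 cos0 !mulr1 => <-.
by apply: eq_Rintegral => y _; rewrite /gauss_phase o0 addr0 cos0 mulr1.
Qed.

Lemma gauss_spt_mass (c : R) (m : spt) : 0 < c ->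
  \int[mu]_z expR (- (c * sqdist_spt z m)) = Num.sqrt (pi / c) ^+ n.+1.
Proof.
move=> c0.
have o0 (y : spt) : dot_spt y origin_spt = 0.
  by rewrite /dot_spt /dotp/= mulr0 addr0 big1// => i _; rewrite tnth_mktuple mulr0.
have [_ /(_ origin_spt 0)] := gauss_spt m c0; rewrite !o0 mul0r oppr0 expR0 addr0 cos0 !mulr1 => <-.
by apply: eq_Rintegral => y _; rewrite o0 addr0 cos0 mulr1.
Qed.

Lemma mollifier_mass (b : R) (z0 : spt) : 0 < b -> \int[mu]_z mollifier b z0 z = 1.
Proof.
move=> b0; have c0 : 0 < pi ^+ 2 / b by rewrite divr_gt0// exprn_gt0// pi_gt0.
have [h _] := gauss_spt z0 c0.
rewrite (@RintegralZl _ _ _ mu setT _ _ measurableT h) gauss_spt_mass//.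
have bn : b != 0 by rewrite gt_eqF.
have pn : pi != 0 :> R by rewrite gt_eqF// pi_gt0.
have pb : 0 <= pi / b by rewrite divr_ge0 ?pi_ge0// ltW.
rewrite -exprMn -sqrtrM//.
have key (p q : R) : p != 0 -> q != 0 -> p / q * (p / (p ^+ 2 / q)) = 1.
  by move=> p0 q0; field; rewrite p0 q0.
rewrite key//.
by rewrite sqrtr1 expr1n.
Qed.

Lemma mollifierC (b : R) (z0 z : spt) : mollifier b z0 z = mollifier b z z0.
Proof.
rewrite /mollifier; congr (_ * expR (- (_ * _))).
rewrite /sqdist_spt /sqdist; congr (_ + _); last by rewrite -sqrrN opprB.
by apply: eq_bigr => i _; rewrite -sqrrN opprB.
Qed.

(** Completing the square gives the exact value [r ^ (n / 2) exp (- r |x| ^ 2)] with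
    [r = 1 / (1 + 4 tau)]. Since [r <= 1], the exponential is at least [exp (- |x| ^ 2)], and [r ^
    (n / 2) >= r ^ n >= 1 - n (1 - r) >= 1 - 4 n tau] by Bernoulli's inequality. *)
Lemma heat_average_gauss (tau : R) (x : Rn R n) : 0 < tau ->
  lRn.-integrable setT (fun y => (heat_kernel tau x y * expR (- dotp y y))%:E) /\
  expR (- dotp x x) - 4 * n%:R * tau <= \int[lRn]_y (heat_kernel tau x y * expR (- dotp y y)).
Proof.
move=> t0; have a0 : 0 < (4 * tau)^-1 by rewrite invr_gt0 mulr_gt0.
have tn : tau != 0 by rewrite gt_eqF.
set a := (4 * tau)^-1 in a0 *.
have an : a != 0 by rewrite gt_eqF.
have a1 : 0 < a + 1 by rewrite addr_gt0.
have a1n : a + 1 != 0 by rewrite gt_eqF.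
have mE : measurable_fun [set: Rn R n] (fun y => heat_kernel tau x y * expR (- dotp y y)).
  apply: mfun_mul; first exact: measurable_heat_kernel.
  by apply: mfun_expR; apply: mfun_opp; apply: mfun_sum => i; apply: mfun_mul; exact: measurable_tnth.
pose r := a / (a + 1).
have E y : heat_kernel tau x y * expR (- dotp y y) =
   (Num.sqrt (pi / a) ^+ n)^-1 * expR (- (r * dotp x x)) * expR (- ((a + 1) * sqdist y (scale_Rn r x))).
  have -> : pi / a = 4 * pi * tau by rewrite /a invrK; ring.
  rewrite /heat_kernel -/a -!mulrA -!expRD; congr (_ * expR _).
  have := sqdist_square x y a1; rewrite mul1r mulr1 -/r => h.
  by rewrite -!opprD h addrC /r !mulrA.
have [ig _] := gauss_Rn (scale_Rn r x) a1.
split.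
  have := integrableZl_fin ((Num.sqrt (pi / a) ^+ n)^-1 * expR (- (r * dotp x x))) measurableT ig.
  by apply: eq_integrable => // y _; rewrite E.
under eq_Rintegral do rewrite E.
rewrite (@RintegralZl _ _ _ lRn setT _ _ measurableT ig) gauss_Rn_mass//.
have r0 : 0 <= r by rewrite divr_ge0// ltW.
have r1 : r <= 1 by rewrite ler_pdivrMr// mul1r lerDl.
have pa : 0 < pi / a by rewrite divr_gt0// pi_gt0.
have -> : (Num.sqrt (pi / a) ^+ n)^-1 * expR (- (r * dotp x x)) * Num.sqrt (pi / (a + 1)) ^+ n =
    Num.sqrt r ^+ n * expR (- (r * dotp x x)).
  have -> : pi / (a + 1) = r * (pi / a).
    have key (p : R) : p / (a + 1) = r * (p / a) by rewrite /r; field; rewrite an a1n.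
    exact: key.
  rewrite (sqrtrM (pi / a) r0) exprMn.
  have : Num.sqrt (pi / a) ^+ n != 0 by rewrite expf_neq0// gt_eqF// sqrtr_gt0.
  by move: (Num.sqrt (pi / a) ^+ n) => S Sn; field.
have x0 := dotp_self_ge0 x.
have h1 : expR (- dotp x x) <= expR (- (r * dotp x x)).
  by rewrite ler_expR lerN2 ler_piMl.
have h2 : r <= Num.sqrt r.
  rewrite -{1}(sqr_sqrtr r0) expr2 ler_piMr ?sqrtr_ge0//.
  by rewrite -sqrtr1 ler_wsqrtr.
have h3 : 1 - 4 * n%:R * tau <= r ^+ n.
  have bern : forall k, 1 - k%:R * (1 - r) <= r ^+ k.
    elim=> [|k IH]; first by rewrite mul0r subr0 expr0.
    rewrite exprS; have rk : 0 <= r ^+ k by rewrite exprn_ge0.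
    have rk1 : r ^+ k <= 1 by rewrite exprn_ile1.
    by rewrite -natr1; nra.
  apply: le_trans (bern n); rewrite lerD2l lerN2.
  have -> : 4 * n%:R * tau = n%:R * (4 * tau) by ring.
  rewrite ler_wpM2l ?ler0n//.
  have -> : 1 - r = (a + 1)^-1 by rewrite /r; field.
  rewrite -[leRHS]invrK -/a lef_pV2 ?posrE//; lra.
have h4 : r ^+ n <= Num.sqrt r ^+ n by rewrite lerXn2r ?nnegrE ?sqrtr_ge0.
have e1 : expR (- dotp x x) <= 1 by rewrite -expR0 ler_expR oppr_le0.
have e0 : 0 < expR (- dotp x x) by exact: expR_gt0.
have tn0 : 0 <= 4 * n%:R * tau by rewrite !mulr_ge0// ltW.
apply: (@le_trans _ _ ((1 - 4 * n%:R * tau) * expR (- dotp x x))); first by nra.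
apply: (@le_trans _ _ (Num.sqrt r ^+ n * expR (- dotp x x))).
  by rewrite ler_wpM2r ?(ltW e0)// (le_trans h3).
by rewrite ler_wpM2l// exprn_ge0// sqrtr_ge0.
Qed.

End gauss_composition.

Section reflection.
Context {R : realType}.
Local Notation leb := (@lebesgue_measure R).

Definition reflect_at (a : R) (x : measurableTypeR R) : measurableTypeR R := a - x.

Lemma measurable_reflect_at a : measurable_fun setT (reflect_at a).
Proof. by apply: mfun_add; [exact: mfun_cst|exact: mfun_opp]. Qed.

HB.instance Definition _ (a : R) := isMeasurableFun.Build _ _ _ _ (reflect_at a) (measurable_reflect_at a).

Lemma lebesgue_measure_reflect (a : R) (A : set (measurableTypeR R)) : measurable A ->
  pushforward leb (reflect_at a) A = leb A.
Proof.
move=> mA; apply/esym; apply: lebesgue_measure_unique => //= _ [[x y]] _ <-.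
rewrite /pushforward (_ : _ @^-1` _ = `[a - y, a - x[%classic); last first.
  apply/seteqP; split => t; rewrite /= /reflect_at !in_itv/= => /andP[h1 h2]; apply/andP; split; lra.
rewrite !lebesgue_measure_itv/= !lte_fin ltrD2l ltrN2; case: ifPn => // _.
by rewrite -!EFinB; congr EFin; ring.
Qed.

(** It serves to read the integral over [tau] of the past mass at time [t - tau] as the total past
    mass. *)
Lemma Rintegral_reflect (a : R) (f : R -> R) :
  leb.-integrable setT (fun x => (f x)%:E) ->
  leb.-integrable setT (fun x => (f (a - x))%:E) /\
  \int[leb]_x f (a - x) = \int[leb]_x f x.
Proof.
move=> fi; have mf := measurable_int leb fi.
have E (g : measurableTypeR R -> \bar R) : (\int[pushforward leb (reflect_at a)]_x g x = \int[leb]_x g x)%E.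
  by apply: eq_measure_integral => A mA _; exact: lebesgue_measure_reflect.
have fi' : leb.-integrable setT (fun x => (f (a - x))%:E).
  apply/integrableP; split.
    exact: (measurableT_comp mf (measurable_reflect_at a)).
  have mabs : measurable_fun [set: measurableTypeR R] (fun x => `|(f x)%:E|%E) by exact: measurableT_comp mf.
  have abs0 : {in [set: measurableTypeR R], forall y, (0 <= `|(f y)%:E|)%E} by [].
  have := ge0_integral_pushforward (measurable_reflect_at a) leb measurableT mabs abs0.
  rewrite E preimage_setT => h.
  by move: fi => /integrableP[_]; rewrite h.
split=> //; congr fine.
have := integral_pushforward (measurable_reflect_at a) mf fi' measurableT.
by rewrite E preimage_setT => ->.
Qed.

End reflection.

Lemma Rintegral_dominated_cvg d (T : measurableType d) (R : realType) (mu : {measure set T -> \bar R})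
    (f_ : nat -> T -> R) (f g : T -> R) :
  (forall k, measurable_fun [set: T] (f_ k)) -> measurable_fun [set: T] f ->
  mu.-integrable setT (fun x => (g x)%:E) -> (forall k x, `|f_ k x| <= g x) ->
  {ae mu, forall x, f_ ^~ x @ \oo --> f x} ->
  \int[mu]_x f_ k x @[k --> \oo] --> \int[mu]_x f x.
Proof.
move=> mf_ mf ig fg cv.
have [//|||//||i_ _ h] := @dominated_convergence _ T R mu setT measurableT (fun k => EFin \o f_ k) (EFin \o f) (EFin \o g).
- by move=> k; exact/measurable_EFinP.
- exact/measurable_EFinP.
- by apply: filterS cv => x cx _; apply/fine_cvgP; split=> //; exact: nearW.
- by apply: aeW => x k _ /=; rewrite lee_fin.
have fi : (\int[mu]_x (f x)%:E)%E \is a fin_num by exact: integrable_fin_num.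
by rewrite -(fineK fi) in h; exact: fine_cvg h.
Qed.

(** Here [v], [X], [E] stand for [V z], its caloric average and the heat gain. Up to [tau = 1/8]
    there is no gain, and the better of the bounds [th + a K tau] and [C tau] is used. Between [1/8]
    and [1], [th <= C / 8] makes [th] the minimum, and [1 <= w] lets the unweighted gain be
    subtracted. From [1] on, [m + L <= X] is used with [q <= 1], because a loss growing like [tau]
    would not be integrable against the weight. *)
Lemma near_min_arith (R : realType) (w th C tau a K v q m L E X : R) :
  0 < w -> (tau <= 1 -> 1 <= w) -> 0 < th -> th <= C / 8 -> 0 < tau -> 0 < C -> 0 <= a -> 2 <= K ->
  q <= 1 -> 0 <= L -> v < a * q + m + th -> a * (q - K * tau) + m + L <= X -> m + L <= X ->
  v - X <= C * Num.min 1 tau -> (8^-1 < tau -> tau < 1 -> E <= L) -> 0 <= E ->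
  (tau <= 8^-1 -> E = 0) -> (1 <= tau -> E = 0) ->
  w * (v - X) <= w * Num.min th (C * Num.min 1 tau) + (a * K) * (w * Num.min 1 tau) - E.
Proof.
move=> w0 w1 th0 thC t0 C0 a0 K0 q1 L0 up XL XL' vX EL E0 E8 E1.
have aK0 : 2 * a <= a * K by rewrite mulrC ler_wpM2l.
have aKt : 0 <= a * K * tau by rewrite mulr_ge0 ?(ltW t0)//; lra.
have [t8|t8] := leP tau 8^-1.
  rewrite (E8 t8) subr0 mulrCA -mulrDr ler_pM2l//.
  have m1 : Num.min 1 tau = tau by apply/min_idPr; lra.
  rewrite m1 in vX *.
  have [h|h] := leP th (C * tau); last by lra.
  by nra.
have -> : Num.min th (C * Num.min 1 tau) = th.
  by apply/min_idPl; apply: (le_trans thC); rewrite ler_pM2l// le_min; apply/andP; split; lra.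
have [t1|t1] := ltP tau 1.
  have Lg := EL t8 t1; have {}w1 := w1 (ltW t1).
  apply: (@le_trans _ _ (w * (th + a * K * tau - E))); first by rewrite ler_pM2l//; lra.
  by nra.
rewrite (E1 t1) subr0 mulr1 (mulrC _ th) -mulrDl mulrC ler_wpM2r ?(ltW w0)//.
have aq : a * q <= a by rewrite ler_piMr.
lra.
Qed.

(** * The near-minimum argument *)

Section near_minimum.
Context {R : realType} {n : nat}.
Local Notation leb := (@lebesgue_measure R).
Local Notation spt := (spacetime R n).
Local Notation mu := (@lebesgue_spt R n).
Local Notation lRn := (@lebesgue_Rn R n).

Lemma measurable_dotp_self : measurable_fun [set: Rn R n] (fun x => dotp x x).
Proof. by apply: mfun_sum => i; apply: mfun_mul; exact: measurable_tnth. Qed.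

Lemma eballE (r : R) (x : Rn R n) : 0 < r -> eball r x <-> dotp x x < r ^+ 2.
Proof.
move=> r0; rewrite /eball/= /enorm -{2}(sqr_sqrtr (dotp_self_ge0 x)) ltr_sqr ?nnegrE ?sqrtr_ge0//.
exact: ltW.
Qed.

Lemma measurable_cylinder (r : R) (I : interval R) : 0 < r -> measurable (cylinder r I : set spt).
Proof.
move=> r0.
have -> : cylinder r I = ((fun z : spt => dotp z.1 z.1) @^-1` `]-oo, r ^+ 2[%classic) `&`
    ((fun z : spt => z.2) @^-1` [set` I]).
  apply/seteqP; split => z [h1 h2]; split => //.
    by rewrite /= in_itv/=; exact: (eballE z.1 r0).1.
  by apply: (eballE z.1 r0).2; move: h1; rewrite /= in_itv.
apply: measurableI.
  rewrite -[X in measurable X]setTI.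
  by apply: (measurableT_comp measurable_dotp_self measurable_fst) => //; exact: measurable_itv.
by rewrite -[X in measurable X]setTI; apply: measurable_snd => //; exact: measurable_itv.
Qed.

Lemma jump_weight_ge1 (s tau : R) : 0 < s -> 0 < tau -> tau <= 1 -> 1 <= jump_weight s tau.
Proof.
move=> s0 t0 t1; rewrite jump_weight_pos// powRN invf_ge1 ?powR_gt0//.
by rewrite -[leRHS](powRr0 tau) ger_powR ?t0// addr_ge0// ltW.
Qed.

Definition past_cylinder : set spt := cylinder 2^-1 `](- 1), (- 2^-1)[%R.

Lemma past_cylinderP z : past_cylinder z -> [/\ dotp z.1 z.1 < 4^-1, -1 < (z.2 : R) & (z.2 : R) < - 2^-1].
Proof.
have h0 : 0 < 2^-1 :> R by rewrite invr_gt0.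
move=> [/(eballE z.1 h0).1 h]; rewrite in_itv/= => /andP[h1 h2]; split => //.
by apply: (lt_le_trans h); rewrite expr2; lra.
Qed.

Definition barrier (z : spt) : R := expR (- dotp z.1 z.1) + 2 * (z.2 : R) - 4^-1.

(** For [|x| ^ 2 < 3], [|y| ^ 2 < 1/4] and [tau] in []1/8, 1[], the exponent comes from
    [|y - x| ^ 2 <= 2 / 4 + 2 * 3 = 13 / 2] and [4 tau > 1/2]; the prefactor is the one at
    [tau = 1]. *)
Definition kernel_lower : R := (Num.sqrt (4 * pi) ^+ n)^-1 * expR (- 13).

Lemma kernel_lower_gt0 : 0 < kernel_lower.
Proof. by rewrite mulr_gt0 ?expR_gt0// invr_gt0 exprn_gt0// sqrtr_gt0 mulr_gt0// pi_gt0. Qed.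

Lemma heat_kernel_lower tau (x y : Rn R n) : 8^-1 < tau -> tau < 1 -> dotp x x < 3 -> dotp y y < 4^-1 ->
  kernel_lower <= heat_kernel tau x y.
Proof.
move=> t8 t1 x3 y4; have t0 : 0 < tau by lra.
have p0 : 0 < pi :> R by exact: pi_gt0.
have hs : sqdist y x <= 2 * dotp y y + 2 * dotp x x.
  rewrite /sqdist /dotp !mulr_sumr -big_split/=; apply: ler_sum => i _.
  have := sqr_ge0 (tnth y i + tnth x i); rewrite -!expr2 => h; nra.
apply: ler_pM; rewrite ?expR_ge0 ?invr_ge0 ?exprn_ge0 ?sqrtr_ge0//.
  rewrite lef_pV2 ?posrE ?exprn_gt0 ?sqrtr_gt0 ?mulr_gt0//.
  by rewrite lerXn2r ?nnegrE ?sqrtr_ge0// ler_wsqrtr// ler_piMr ?mulr_ge0 ?ltW.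
rewrite ler_expR lerN2 mulrC ler_pdivrMr ?mulr_gt0//; lra.
Qed.

Lemma barrier_le1 z : (z.2 : R) <= 0 -> barrier z <= 1.
Proof.
move=> z0; have : expR (- dotp z.1 z.1) <= 1 by rewrite -expR0 ler_expR oppr_le0 dotp_self_ge0.
rewrite /barrier; lra.
Qed.

(** This localises near-minima. If [|x| ^ 2 >= 3] then [exp (- |x| ^ 2) <= 1 / (1 + 3)] and the
    barrier is at most [2 t <= 0]; positivity also forces [1 + 2 t - 1/4 > 0]. *)
Lemma barrier_gt0 z : (z.2 : R) <= 0 -> 0 < barrier z -> dotp z.1 z.1 < 3 /\ - (3 / 8) < (z.2 : R).
Proof.
move=> z0; have h1 : expR (- dotp z.1 z.1) <= 1 by rewrite -expR0 ler_expR oppr_le0 dotp_self_ge0.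
rewrite /barrier => h; split; last by lra.
rewrite ltNge; apply/negP => h3.
have : expR (- dotp z.1 z.1) <= 4^-1.
  rewrite expRN lef_pV2 ?posrE ?expR_gt0//.
  have := expR_ge1Dx (dotp z.1 z.1); lra.
lra.
Qed.

Section obstacle.
Variables (s : R) (s0 : 0 < s) (s1 : s < 1).
Variables (V : spt -> R) (M C eta rho : R).
Hypothesis mV : measurable_fun [set: spt] V.
Hypothesis V0 : forall z, 0 <= V z.
Hypothesis VM : forall z, V z <= M.
Hypothesis C0 : 0 < C.
Hypothesis rho0 : 0 <= rho.

Let A tau (z : spt) : R := \int[lRn]_y (heat_kernel tau z.1 y * V (y, (z.2 : R) - tau)).

Hypothesis VA : forall tau z, 0 < tau -> `|V z - A tau z| <= C * Num.min 1 tau.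
Hypothesis iVA : forall z, leb.-integrable setT (fun tau => (jump_weight s tau * (V z - A tau z))%:E).
(** The integrated inequality is required only where a near-minimum can lie: in the region of
    [barrier_gt0], up to time [- rho]. The error of the mollification is [eta]. *)
Hypothesis jVA : forall z, dotp z.1 z.1 < 3 -> - (3 / 8) < (z.2 : R) -> (z.2 : R) <= - rho ->
  - eta <= \int[leb]_tau (jump_weight s tau * (V z - A tau z)).

Let W (z : spt) : R := V z * \1_past_cylinder z.

Let mP : measurable past_cylinder.
Proof. by apply: measurable_cylinder; rewrite invr_gt0. Qed.

Let mW : measurable_fun [set: spt] W.
Proof. by apply: mfun_mul => //; exact: measurable_indic. Qed.

Let W0 z : 0 <= W z.
Proof. by rewrite mulr_ge0. Qed.

Let M0 : 0 <= M.
Proof. exact: le_trans (V0 origin_spt) (VM origin_spt). Qed.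

(** On the past cylinder [|y| ^ 2 < 1/4] and [t ^ 2 < 1], so these Gaussians give [W] an integrable
    majorant of product form. *)
Let f1 (y : Rn R n) : R := M * (expR 4^-1 * expR (- dotp y y)).
Let f2 (t : measurableTypeR R) : R := expR 1 * expR (- (1 * (t - 0) ^+ 2)).

Let if1 : lRn.-integrable setT (fun y => (f1 y)%:E).
Proof.
apply: integrableZl_fin => //; apply: integrableZl_fin => //.
have [h _] := gauss_Rn ([tuple 0 | _ < n] : Rn R n) (@ltr01 R).
apply: eq_integrable h => // y _; congr (expR (- _))%:E.
by rewrite mul1r; apply: eq_bigr => i _; rewrite tnth_mktuple subr0 expr2.
Qed.

Let if2 : leb.-integrable setT (fun t => (f2 t)%:E).
Proof. by apply: integrableZl_fin => //; have [] := integral_gauss 0 (@ltr01 R). Qed.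

Let Wle (y : Rn R n) (t : measurableTypeR R) : `|W (y, t)| <= f1 y * f2 t.
Proof.
rewrite ger0_norm// /W /f1 /f2 -mulrA -!expRD.
have [/past_cylinderP[/= h1 h2 h3]|h] := pselect (past_cylinder (y, t)).
  rewrite ler_pM//.
  apply: (@le_trans _ _ 1); first by rewrite indicE; case: (_ \in _).
  by rewrite -[X in X <= _]expR0 ler_expR; nra.
by rewrite indicE memNset// mulr0; apply: mulr_ge0 => //; exact: expR_ge0.
Qed.

Let ell (t : measurableTypeR R) : R := \int[lRn]_y W (y, t).

Let ell0 t : 0 <= ell t.
Proof. exact: Rintegral_ge0. Qed.

Let iell : leb.-integrable setT (fun t => (ell t)%:E).
Proof. exact: (integrable_fubini2 if1 if2 mW Wle). Qed.

Let ell_int : \int[leb]_t ell t = \int[mu]_z W z.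
Proof. by rewrite -(Rfubini2 if1 if2 mW Wle). Qed.

Let ell_out t : ~ (-1 < t /\ t < - 2^-1) -> ell t = 0.
Proof.
move=> h; rewrite /ell (_ : (fun y => _) = cst 0) ?Rintegral_cst ?mul0r//.
apply/funext => y; rewrite /W indicE memNset ?mulr0// => /past_cylinderP[_ /= h1 h2].
by apply: h.
Qed.

Let Kw : R := \int[leb]_tau (jump_weight s tau * Num.min 1 tau).
Let K : R := 4 * n%:R + 2.

Let small theta tau : R := jump_weight s tau * Num.min theta (C * Num.min 1 tau).

(* [V] is bounded below by both [m] and [a * barrier + m]; [W] can be added to
   either bound because the barrier is negative on the past cylinder. *)
Let near_min_pointwise (a m theta : R) (z : spt) :
  0 <= a -> m <= 0 -> 0 < theta -> theta <= C / 8 -> (z.2 : R) <= - rho ->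
  dotp z.1 z.1 < 3 -> - (3 / 8) < (z.2 : R) ->
  (forall y : spt, (y.2 : R) <= - rho -> a * barrier y + m <= V y) ->
  V z < a * barrier z + m + theta ->
  forall tau, jump_weight s tau * (V z - A tau z) <=
    small theta tau + (a * K) * (jump_weight s tau * Num.min 1 tau) - kernel_lower * ell ((z.2 : R) - tau).
Proof.
(* Starting from a time in []-3/8, 0]], a step back by [tau] can land in []-1, -1/2[] only if
   [1/8 < tau < 1]. *)
have r8 (x y : R) : - (3 / 8) < x -> y <= 8^-1 -> ~ (-1 < x - y /\ x - y < - 2^-1) by move=> ? ? []; lra.
have r1 (x y : R) : x <= 0 -> 1 <= y -> ~ (-1 < x - y /\ x - y < - 2^-1) by move=> ? ? []; lra.
move=> a0 m0 th0 thC zr x3 t3 low up tau.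
have [t0|t0] := leP tau 0.
  rewrite /small jump_weight_neg// !mul0r mulr0 addr0 ell_out ?mulr0 ?subr0//.
  by move=> [_]; lra.
have w0 : 0 < jump_weight s tau by rewrite jump_weight_pos// powR_gt0.
pose t := (z.2 : R) - tau.
have tr : t <= - rho by rewrite /t; lra.
pose L := \int[lRn]_y (heat_kernel tau z.1 y * W (y, t)).
have z20 : (z.2 : R) <= 0 by move: rho0; lra.
have t20 : t <= 0 by rewrite /t; lra.
have mk := @measurable_heat_kernel R n tau z.1.
have ik := @integrable_heat_kernel R n tau z.1 t0.
have kk := heat_kernel_mass z.1 t0.
have msec (f : spt -> R) : measurable_fun [set: spt] f -> measurable_fun [set: Rn R n] (fun y => f (y, t)).
  by move=> mf; apply: measurableT_comp mf _; exact: measurable_pair2.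
have ikW : lRn.-integrable setT (fun y => (heat_kernel tau z.1 y * W (y, t))%:E).
  apply: (integrable_dominated _ (integrableZr_fin M measurableT ik)).
    by apply: mfun_mul => //; exact: msec.
  move=> y; rewrite ger0_norm ?mulr_ge0 ?heat_kernel_ge0// ler_wpM2l ?heat_kernel_ge0//.
  by rewrite (le_trans _ (VM (y, t)))// ler_piMr// indicE; case: (_ \in _).
have ikV : lRn.-integrable setT (fun y => (heat_kernel tau z.1 y * V (y, t))%:E).
  apply: (integrable_dominated _ (integrableZr_fin M measurableT ik)).
    by apply: mfun_mul => //; exact: msec.
  by move=> y; rewrite ger0_norm ?mulr_ge0 ?heat_kernel_ge0// ler_wpM2l ?heat_kernel_ge0.
have key (h e r : R) : a * (h * e) + h * (a * (2 * r - 4^-1) + m) = h * (a * (e + 2 * r - 4^-1) + m) by ring.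
have bE (y : Rn R n) : barrier (y, t) = expR (- dotp y y) + 2 * t - 4^-1 by [].
have mLA : m + L <= A tau z.
  rewrite -[m]mulr1 -kk -(@RintegralZl _ _ _ lRn setT _ _ measurableT ik) /L.
  rewrite -RintegralD//; last exact: integrableZl_fin.
  apply: le_Rintegral => //; first by apply: integrableD_fin => //; exact: integrableZl_fin.
  move=> y _; rewrite (mulrC m) -mulrDr ler_wpM2l ?heat_kernel_ge0//.
  have W1 : W (y, t) <= V (y, t).
    by rewrite ler_piMr// indicE; case: (_ \in _).
  by move: W1; rewrite -/t; lra.
have [ig hg] := heat_average_gauss z.1 t0.
have iq : lRn.-integrable setT (fun y => (heat_kernel tau z.1 y * (a * barrier (y, t) + m))%:E).
  have := integrableD_fin measurableT (integrableZl_fin a measurableT ig) (integrableZr_fin (a * (2 * t - 4^-1) + m) measurableT ik).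
  by apply: eq_integrable => // y _; congr EFin; rewrite bE; exact: key.
(* Averaging the barrier costs at most [4 n tau] for its Gaussian part and exactly [2 tau] for its
   linear part in time, which is the origin of [K]. *)
have qLA : a * (barrier z - K * tau) + m + L <= A tau z.
  apply: (@le_trans _ _ (\int[lRn]_y (heat_kernel tau z.1 y * (a * barrier (y, t) + m)) + L)).
    rewrite lerD2r.
    have -> : \int[lRn]_y (heat_kernel tau z.1 y * (a * barrier (y, t) + m)) =
      a * (\int[lRn]_y (heat_kernel tau z.1 y * expR (- dotp y y))) + (a * (2 * t - 4^-1) + m).
      have := @RintegralZr _ _ _ lRn setT _ (a * (2 * t - 4^-1) + m) measurableT ik.
      rewrite kk mul1r => <-.
      rewrite -(@RintegralZl _ _ _ lRn setT _ _ measurableT ig) -RintegralD//; [|exact: integrableZl_fin|exact: integrableZr_fin].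
      by apply: eq_Rintegral => y _; rewrite bE key.
    rewrite addrA lerD2r -mulrDr ler_wpM2l//.
    by move: hg; rewrite /barrier /K /t; lra.
  rewrite /L -RintegralD//; apply: le_Rintegral => //; first exact: integrableD_fin.
  move=> y _; rewrite -mulrDr ler_wpM2l ?heat_kernel_ge0//.
  have [hp|hp] := pselect (past_cylinder (y, t)).
    have [/= h1 h2 h3] := past_cylinderP hp.
    have e1 : expR (- dotp y y) <= 1 by rewrite -expR0 ler_expR oppr_le0 dotp_self_ge0.
    have b0 : a * barrier (y, t) <= 0 by rewrite mulr_ge0_le0// /barrier/=; lra.
    by rewrite /W indicE mem_set// mulr1 -/t; lra.
  by rewrite /W indicE memNset// mulr0 addr0; exact: low.
have Lge : 8^-1 < tau -> tau < 1 -> kernel_lower * ell t <= L.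
  move=> t8 t1.
  have iWt : lRn.-integrable setT (fun y => (W (y, t))%:E) by exact: (integrable_section2 if1 mW Wle).
  rewrite /ell -(@RintegralZl _ _ _ lRn setT _ _ measurableT iWt); apply: le_Rintegral => //; first exact: integrableZl_fin.
  move=> y _; have [hp|hp] := pselect (past_cylinder (y, t)); last by rewrite /W indicE memNset// !mulr0.
  have [/= h1 h2 h3] := past_cylinderP hp.
  by rewrite ler_wpM2r// heat_kernel_lower.
have L0 : 0 <= L by apply: Rintegral_ge0 => y _; rewrite mulr_ge0 ?heat_kernel_ge0.
have K0 : 2 <= K by rewrite /K lerDr mulr_ge0.
have e8 : tau <= 8^-1 -> kernel_lower * ell t = 0.
  by move=> t8; rewrite ell_out ?mulr0//; exact: r8.
have e1 : 1 <= tau -> kernel_lower * ell t = 0.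
  by move=> t1; rewrite ell_out ?mulr0//; exact: r1.
apply: (near_min_arith w0 (jump_weight_ge1 s0 t0) th0 thC t0 C0 a0 K0 (barrier_le1 z20) L0 up qLA mLA _ Lge _ e8 e1).
  exact: le_trans (ler_norm _) (VA z t0).
by rewrite mulr_ge0// ltW// kernel_lower_gt0.
Qed.

Let ismall theta : 0 < theta -> leb.-integrable setT (fun tau => (small theta tau)%:E) /\
  forall tau, `|small theta tau| <= C * (jump_weight s tau * Num.min 1 tau).
Proof.
move=> th0.
have h tau : `|small theta tau| <= C * (jump_weight s tau * Num.min 1 tau).
  rewrite /small; have [t0|t0] := leP tau 0; first by rewrite jump_weight_neg// !mul0r mulr0 normr0.
  have w0 := jump_weight_ge0 s tau.
  have m0 : 0 <= C * Num.min 1 tau by rewrite mulr_ge0 ?(ltW C0)// le_min ler01 ltW.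
  rewrite mulrCA ger0_norm; first by rewrite ler_wpM2l// ge_min lexx orbT.
  by rewrite mulr_ge0// le_min m0 ltW.
split=> //; apply: (integrable_dominated _ (integrableZl_fin C measurableT (integrable_jump_weight s0 s1)) h).
by apply: mfun_mul; [exact: measurable_jump_weight|meas].
Qed.

(** Pointwise the integrand is at most a multiple of [1 / (k + 1)], and [C] times the integrable
    weight dominates it. *)
Let small_cvg (th : R) : 0 < th ->
  \int[leb]_tau small (th / k.+1%:R) tau @[k --> \oo] --> (0 : R).
Proof.
move=> th0.
have hk k : 0 < th / k.+1%:R by rewrite divr_gt0.
have -> : (0 : R) = \int[leb]_tau (fun=> 0 : R) tau by rewrite Rintegral_cst ?mul0r.
apply: (@Rintegral_dominated_cvg _ _ _ leb _ _ (fun tau => C * (jump_weight s tau * Num.min 1 tau))).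
- by move=> k; have [/integrable_measurable] := ismall (hk k).
- exact: mfun_cst.
- exact: integrableZl_fin (integrable_jump_weight s0 s1).
- by move=> k tau; have [_] := ismall (hk k).
apply: aeW => tau; have [t0|t0] := leP tau 0.
  by apply: cvg_near_cst; apply: nearW => k; rewrite /small jump_weight_neg// mul0r.
have w0 := jump_weight_ge0 s tau.
suff h : small (th / k.+1%:R) tau @[k --> \oo] --> (0 : R) by exact: h.
apply: (@squeeze_cvgr _ _ _ _ (fun=> 0) (fun k : nat => jump_weight s tau * th * k.+1%:R^-1)).
- apply: nearW => k; apply/andP; split; last by rewrite /small -mulrA ler_wpM2l// ge_min lexx.
  apply: mulr_ge0 => //; rewrite le_min (ltW (hk k))/=; apply: mulr_ge0; first exact: ltW.
  by rewrite le_min ler01 ltW.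
- exact: cvg_cst.
- rewrite -[X in _ --> X](mulr0 (jump_weight s tau * th)); apply: cvgM; [exact: cvg_cst|exact: cvg_harmonic].
Qed.

Lemma obstacle (a : R) : 0 <= a -> a * K * Kw < kernel_lower * \int[mu]_z W z - eta ->
  forall z : spt, (z.2 : R) <= - rho -> a * barrier z <= V z.
Proof.
have key (X S0 b0 c0 : R) : - eta <= X -> X <= S0 + b0 - c0 -> c0 - eta - b0 <= S0 by move=> *; lra.
move=> a0 aK z1 zr1; rewrite leNgt; apply/negP => z1lt.
pose S : set R := [set V z - a * barrier z | z in [set z : spt | (z.2 : R) <= - rho]].
have lbS : lbound S (- a).
  move=> _ [z /= zr <-]; have b1 : barrier z <= 1 by apply: barrier_le1; move: rho0; lra.
  have : a * barrier z <= a by rewrite ler_piMr.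
  by have := V0 z; lra.
have infS : has_inf S by split; [exists (V z1 - a * barrier z1), z1|exists (- a)].
pose m := inf S.
have m0 : m < 0.
  apply: le_lt_trans (_ : V z1 - a * barrier z1 < 0); last by rewrite subr_lt0.
  by apply: ge_inf; [exact: infS.2|exists z1].
have low (y : spt) : (y.2 : R) <= - rho -> a * barrier y + m <= V y.
  move=> yr; rewrite addrC -lerBrDr; apply: ge_inf; [exact: infS.2|by exists y].
(* With slack at most [- m], a near-minimum has [V - a * barrier < 0], hence a positive barrier, and
   [barrier_gt0] locates it. The bound [C / 8] is the one needed in [near_min_arith]. *)
pose th := Num.min (- m) (C / 8).
have th0 : 0 < th by rewrite lt_min oppr_gt0 m0 divr_gt0.
(* The pointwise bound, integrated in [tau] at a near-minimum with slack [th / (k + 1)]. The left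
   side is a fixed positive number, whereas the right side tends to [0] with [k]. *)
have step k : kernel_lower * \int[mu]_z W z - eta - a * K * Kw <= \int[leb]_tau small (th / k.+1%:R) tau.
  have k0 : 0 < th / k.+1%:R by rewrite divr_gt0.
  have k1 : th / k.+1%:R <= th by rewrite ler_piMr ?(ltW th0)// invf_le1// ler1n.
  have [_ [z /= zr <-] zlt] := inf_adherent k0 infS.
  have thm : th <= - m by rewrite ge_min lexx.
  have z20 : (z.2 : R) <= 0 by move: rho0; lra.
  have q0 : 0 < barrier z.
    rewrite ltNge; apply/negP => qle.
    have h : a * barrier z <= 0 by rewrite mulr_ge0_le0.
    have key' (v ab e : R) : 0 <= v -> ab <= 0 -> v - ab < m + e -> e <= - m -> False by move=> *; lra.
    exact: (key' _ _ _ (V0 z) h zlt (le_trans k1 thm)).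
  have [x3 t3] := barrier_gt0 z20 q0.
  have thC : th / k.+1%:R <= C / 8 by rewrite (le_trans k1)// ge_min lexx orbT.
  have zlt' : V z < a * barrier z + m + th / k.+1%:R by move: zlt; rewrite ltrBlDl addrA.
  have pw := near_min_pointwise a0 (ltW m0) k0 thC zr x3 t3 low zlt'.
  have [ism _] := ismall k0.
  have iw := integrable_jump_weight s0 s1.
  have [ir er] := Rintegral_reflect z.2 iell.
  apply: key (jVA x3 t3 zr) _.
  rewrite /Kw -ell_int -er -(@RintegralZl _ _ _ leb setT _ _ measurableT iw) -(@RintegralZl _ _ _ leb setT _ _ measurableT ir).
    have iK := integrableZl_fin (a * K) measurableT iw.
    have i1 := integrableD_fin measurableT ism iK.
    have i2 := integrableZl_fin kernel_lower measurableT ir.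
    rewrite -(@RintegralD _ _ _ leb setT _ _ measurableT ism iK) -(@RintegralB _ _ _ leb setT _ _ measurableT i1 i2).
    exact: (le_Rintegral measurableT (iVA z) (integrableB_fin measurableT i1 i2) (fun tau _ => pw tau)).
have := small_cvg th0.
have e0 : 0 < kernel_lower * \int[mu]_z W z - eta - a * K * Kw by move: aK; lra.
move/cvgrPdist_lt => /(_ _ e0) [k _ /(_ k (leqnn k))] /=.
rewrite sub0r normrN => h; have := le_lt_trans (ler_norm _) h.
by rewrite ltNge step.
Qed.

End obstacle.
End near_minimum.

Lemma Rintegral_ae_ge0 d (T : measurableType d) (R : realType) (mu : {measure set T -> \bar R}) (f : T -> R) :
  mu.-integrable setT (fun x => (f x)%:E) -> {ae mu, forall x, 0 <= f x} -> 0 <= \int[mu]_x f x.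
Proof.
move=> fi f0; have mf := integrable_measurable fi.
have -> : \int[mu]_x f x = \int[mu]_x `|f x|.
  congr fine; apply: ae_eq_integral => //; try by apply/measurable_EFinP; meas.
  by apply: filterS f0 => x fx _; rewrite ger0_norm.
exact: Rintegral_ge0.
Qed.

(** * The supersolution property under mollification *)

Section supersolution_mollified.
Context {R : realType} {n : nat}.
Local Notation spt := (spacetime R n).
Local Notation mu := (@lebesgue_spt R n).

(** From [exp y >= y ^ (k + 1) / (k + 1)!]: the extra power leaves a factor [1 / (j + 1)]. *)
Lemma exprn_expR_cvg0 (k : nat) (c : R) : 0 < c ->
  j.+1%:R ^+ k * expR (- (c * j.+1%:R)) @[j --> \oo] --> (0 : R).
Proof.
move=> c0.
apply: (@squeeze_cvgr _ _ _ _ (fun=> 0) (fun j : nat => k.+1`!%:R / c ^+ k.+1 * j.+1%:R^-1)).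
- apply: nearW => j; apply/andP; split; first by rewrite mulr_ge0 ?expR_ge0// exprn_ge0.
  have j0 : (0 : R) < j.+1%:R by [].
  have h := @expR_ge1Dxn _ (c * j.+1%:R) k (mulr_ge0 (ltW c0) (ltW j0)).
  have f0 : 0 < k.+1`!%:R :> R by rewrite ltr0n fact_gt0.
  have p0 : 0 < (c * j.+1%:R) ^+ k.+1 / k.+1`!%:R by rewrite divr_gt0// exprn_gt0// mulr_gt0.
  have h1 : expR (- (c * j.+1%:R)) <= ((c * j.+1%:R) ^+ k.+1 / k.+1`!%:R)^-1.
    rewrite expRN lef_pV2 ?posrE ?expR_gt0//; apply: le_trans h; lra.
  apply: (@le_trans _ _ (j.+1%:R ^+ k * ((c * j.+1%:R) ^+ k.+1 / k.+1`!%:R)^-1)).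
    by rewrite ler_wpM2l// exprn_ge0.
  rewrite le_eqVlt; apply/orP; left; apply/eqP.
  move: f0 j0; move: (_`!%:R) (j.+1%:R : R) => f x f0 x0.
  rewrite exprMn (exprS x) invfM invrK; field.
  by rewrite !expf_neq0 ?gt_eqF.
- exact: cvg_cst.
- rewrite -[X in _ --> X](mulr0 (k.+1`!%:R / c ^+ k.+1)).
  by apply: cvgM; [exact: cvg_cst|exact: cvg_harmonic].
Qed.

(** In space, [|x| ^ 2 <= 7/6 |x0| ^ 2 + 7 |x - x0| ^ 2 < 7/2 + 7/14 = 4], which fixes the constant
    [14]. In time, a displacement smaller than [r] from a time at most [- r] stays nonpositive. *)
Lemma near_in_cylinder (r : R) (z0 z : spt) : dotp z0.1 z0.1 < 3 -> - (3 / 8) < (z0.2 : R) -> (z0.2 : R) <= - r ->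
  0 < r -> sqdist_spt z z0 < Num.min (14^-1) (r ^+ 2) -> (cylinder 2 `]-4, 0]%R : set spt) z.
Proof.
move=> x3 t3 tr r0; rewrite lt_min => /andP[s14 sr].
have q0 := sqdist_ge0 z.1 z0.1.
have d0 := sqr_ge0 ((z.2 : R) - z0.2).
have two : 0 < 2 :> R by [].
split.
  apply: (eballE z.1 two).2.
  have : dotp z.1 z.1 <= 7 / 6 * dotp z0.1 z0.1 + 7 * sqdist z.1 z0.1.
    rewrite /dotp /sqdist !mulr_sumr -big_split/=; apply: ler_sum => i _.
    have := sqr_ge0 (tnth z0.1 i - 6 * (tnth z.1 i - tnth z0.1 i)); nra.
  by move: s14; rewrite /sqdist_spt expr2; lra.
move: sr s14; rewrite /sqdist_spt in_itv/= => sr s14; apply/andP; split.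
  have key (x y : R) : - (3 / 8) < y -> (x - y) ^+ 2 < 14^-1 -> -4 < x by nra.
  by apply: (key _ z0.2) => //; lra.
have key (x y : R) : y <= - r -> (x - y) ^+ 2 < r ^+ 2 -> x <= 0 by nra.
by apply: (key _ z0.2) => //; lra.
Qed.

(** Beyond squared distance [r], half of the Gaussian exponent gives the exponentially small factor
    and the other half keeps the Gaussian integrable. In the last factor, [1] bounds the mass of the
    remaining Gaussian and [B] is the squared norm of the function tested. *)
Definition tail_bound (r B b : R) : R :=
  (pi / b) ^+ n.+1 * expR (- (pi ^+ 2 * r / 2 / b)) * (1 + B).

(* Where [w] may be negative the Gaussian is small: there
   [mollifier * |w| <= S * (exp (- c * sqdist_spt) + w ^ 2)] with [S] exponentially small. *)
Lemma mollified_lower_bound (w : spt -> R) (D : set spt) (r b : R) (z0 : spt) :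
  0 < r -> 0 < b -> b <= 1 ->
  measurable_fun [set: spt] w -> mu.-integrable setT (fun z => (w z ^+ 2)%:E) ->
  {ae mu, forall z, D z -> 0 <= w z} -> (forall z, sqdist_spt z z0 < r -> D z) ->
  - tail_bound r (\int[mu]_z w z ^+ 2) b <= \int[mu]_z (mollifier b z0 z * w z).
Proof.
move=> r0 b0 b1 mw iw wD rD.
have p0 : 0 < pi :> R by exact: pi_gt0.
pose c := pi ^+ 2 / b.
have c0 : 0 < c by rewrite divr_gt0// exprn_gt0.
have [ig _] := gauss_spt z0 c0.
have mg := gauss_spt_mass z0 c0.
have pb : 1 <= pi / b.
  by rewrite ler_pdivlMr// mul1r (le_trans b1)// (le_trans _ (pi_ge2 R))// ler1n.
have s1 : Num.sqrt (pi / b) <= pi / b.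
  rewrite -{2}(@sqr_sqrtr _ (pi / b)) ?(le_trans ler01)// expr2 ler_pMr ?sqrtr_gt0 ?(lt_le_trans ltr01)//.
  by rewrite -sqrtr1 ler_wsqrtr.
have i2 := integrableD_fin measurableT ig iw.
pose S := Num.sqrt (pi / b) ^+ n.+1 * expR (- (pi ^+ 2 * r / 2 / b)).
have S0 : 0 <= S by rewrite mulr_ge0 ?expR_ge0// exprn_ge0// sqrtr_ge0.
have im : mu.-integrable setT (fun z => (mollifier b z0 z * w z)%:E).
  by apply: L2_mul => //; [exact: measurable_mollifier|exact: integrable_mollifier_sqr].
have pw : {ae mu, forall z, - (S * (expR (- (c * sqdist_spt z z0)) + w z ^+ 2)) <= mollifier b z0 z * w z}.
  apply: filterS wD => z wz.
  have g0 : 0 <= S * (expR (- (c * sqdist_spt z z0)) + w z ^+ 2).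
    by rewrite mulr_ge0// addr_ge0 ?expR_ge0// sqr_ge0.
  have [h|h] := ltP (sqdist_spt z z0) r.
    apply: (@le_trans _ _ 0); first by rewrite oppr_le0.
    by rewrite mulr_ge0 ?mollifier_ge0// wz//; exact: rD.
  have e2 : expR (- (c * sqdist_spt z z0)) = expR (- (c * sqdist_spt z z0 / 2)) ^+ 2.
    by rewrite expr2 -expRD; congr expR; lra.
  have hm : mollifier b z0 z <= S * expR (- (c * sqdist_spt z z0 / 2)).
    rewrite /mollifier /S -[X in _ <= X]mulrA -expRD ler_wpM2l ?exprn_ge0 ?sqrtr_ge0// ler_expR -/c.
    have -> : pi ^+ 2 * r / 2 / b = c * r / 2.
      by rewrite /c; move: (pi ^+ 2) => p; rewrite -!mulrA; congr (_ * _); ring.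
    have : c * r <= c * sqdist_spt z z0 by rewrite ler_pM2l.
    lra.
  have m0 := mollifier_ge0 b z0 z.
  rewrite e2; move: (expR (- (c * sqdist_spt z z0 / 2))) (expR_ge0 (- (c * sqdist_spt z z0 / 2))) hm => e e0 hm.
  have h1 : mollifier b z0 z * `|w z| <= S * e * `|w z| by rewrite ler_wpM2r.
  have h2 : - (mollifier b z0 z * `|w z|) <= mollifier b z0 z * w z.
    by rewrite -mulrN ler_wpM2l// lerNl -normrN ler_norm.
  have h3 : e * `|w z| <= e ^+ 2 + w z ^+ 2.
    rewrite -(real_normK (num_real (w z))); have := normr_ge0 (w z); nra.
  apply: le_trans h2; rewrite lerN2; apply: (le_trans h1); rewrite -mulrA.
  by rewrite ler_wpM2l.
have iS := integrableZl_fin S measurableT i2.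
have : 0 <= \int[mu]_z (mollifier b z0 z * w z + S * (expR (- (c * sqdist_spt z z0)) + w z ^+ 2)).
  apply: Rintegral_ae_ge0; first exact: integrableD_fin.
  by apply: filterS pw => z; rewrite lerNl -subr_ge0 opprK addrC.
rewrite (@RintegralD _ _ _ mu setT _ _ measurableT im iS) -lerBlDr sub0r; apply: le_trans.
rewrite lerN2 (@RintegralZl _ _ _ mu setT _ _ measurableT i2) (@RintegralD _ _ _ mu setT _ _ measurableT ig iw) mg.
have w0 : 0 <= \int[mu]_z w z ^+ 2 by apply: Rintegral_ge0 => z _; exact: sqr_ge0.
rewrite /tail_bound /S; apply: ler_pM => //; first by rewrite addr_ge0// exprn_ge0// sqrtr_ge0.
  by rewrite ler_wpM2r ?expR_ge0// lerXn2r ?nnegrE ?sqrtr_ge0// divr_ge0 ?(ltW p0)// ltW.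
rewrite lerD2r exprn_ile1 ?sqrtr_ge0// -sqrtr1 ler_wsqrtr// ler_pdivrMr// mul1r /c expr2 ler_pdivlMr// ler_pM2l//.
by rewrite (le_trans b1)// (le_trans _ (pi_ge2 R))// ler1n.
Qed.

Lemma tail_bound_cvg0 (r B : R) : 0 < r -> tail_bound r B j.+1%:R^-1 @[j --> \oo] --> (0 : R).
Proof.
move=> r0; have c0 : 0 < pi ^+ 2 * r / 2 by rewrite divr_gt0// mulr_gt0// exprn_gt0// pi_gt0.
have -> : (fun j : nat => tail_bound r B j.+1%:R^-1) =
    (fun j : nat => pi ^+ n.+1 * (1 + B) * (j.+1%:R ^+ n.+1 * expR (- (pi ^+ 2 * r / 2 * j.+1%:R)))).
  apply/funext => j; rewrite /tail_bound !invrK exprMn; move: (pi ^+ n.+1) (expR _) => p e.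
  by ring.
rewrite -[X in _ --> X](mulr0 (pi ^+ n.+1 * (1 + B))).
by apply: cvgM; [exact: cvg_cst|exact: exprn_expR_cvg0].
Qed.

End supersolution_mollified.

(** * Removing the mollification *)

Section generation.
Context {R : realType} {n : nat}.
Local Notation spt := (spacetime R n).

(** Openness in terms of the squared Euclidean distance, the quantity in which the Gaussian tails
    are estimated. *)
Definition sd_open (F : set spt) := forall z, F z -> exists2 r, 0 < r & forall y, sqdist_spt y z < r -> F y.

Let G : set (set spt) := [set F | measurable F /\ sd_open F].

Let openI : setI_closed G.
Proof.
move=> A B [mA oA] [mB oB]; split; first exact: measurableI.
move=> z [/oA[r1 r10 h1] /oB[r2 r20 h2]]; exists (Num.min r1 r2); first by rewrite lt_min r10.
by move=> y; rewrite lt_min => /andP[/h1 ? /h2 ?].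
Qed.

Let half (f : spt -> R) (c : R) : measurable_fun [set: spt] f ->
  (forall y z, (f y - f z) ^+ 2 <= sqdist_spt y z) -> G [set z | f z < c].
Proof.
move=> mf fl; split.
  rewrite (_ : [set z | _] = f @^-1` `]-oo, c[%classic); last first.
    by apply/seteqP; split => z /=; rewrite in_itv.
  by rewrite -[X in measurable X]setTI; apply: mf => //; exact: measurable_itv.
move=> z /= zc; exists ((c - f z) ^+ 2); first by rewrite exprn_gt0// subr_gt0.
by move=> y h; have := le_lt_trans (fl y z) h; nra.
Qed.

Let comp_le i (y z : spt) : (tnth y.1 i - tnth z.1 i) ^+ 2 <= sqdist_spt y z.
Proof.
rewrite /sqdist_spt /sqdist (bigD1 i)//= -addrA lerDl addr_ge0 ?sqr_ge0// sumr_ge0// => j _.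
exact: sqr_ge0.
Qed.

Let time_le (y z : spt) : ((y.2 : R) - z.2) ^+ 2 <= sqdist_spt y z.
Proof. by rewrite /sqdist_spt lerDr sqdist_ge0. Qed.

(* Half-spaces are open, and they generate the product sigma-algebra. *)
Lemma sd_open_generate (F : set spt) : measurable F -> <<s [set A | measurable A /\ sd_open A] >> F.
Proof.
rewrite -/G => mF; pose gT := g_sigma_algebraType G.
have mhalf (f : spt -> R) : measurable_fun [set: spt] f ->
    (forall y z, (f y - f z) ^+ 2 <= sqdist_spt y z) -> measurable_fun [set: gT] (f : gT -> measurableTypeR R).
  move=> mf fl; apply: (measurability _ (RGenInftyO.measurableE R)).
  move=> _ [_ [c ->] <-]; rewrite setTI; apply: sub_sigma_algebra.
  rewrite (_ : _ @^-1` _ = [set z | f z < c]); first exact: half.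
  by apply/seteqP; split => z /=; rewrite in_itv.
have mid : measurable_fun [set: gT] (fun z : gT => (z : spt)).
  rewrite (_ : (fun z => _) = fun z : gT => ((z : spt).1, (z : spt).2)); last by apply/funext => -[].
  apply: measurable_fun_pair.
    apply/measurable_fun_tnthP => i.
    apply: mhalf; last exact: comp_le.
    exact: measurableT_comp (measurable_tnth i) measurable_fst.
  by apply: mhalf; [exact: measurable_snd|exact: time_le].
have := mid measurableT F mF; rewrite setTI.
by [].
Qed.

(** The pi-lambda theorem: measurable open sets are stable under intersection and generate the
    sigma-algebra. *)
Lemma sd_open_ind (H : set (set spt)) : lambda_system setT H ->
  (forall F, measurable F -> sd_open F -> H F) -> forall F, measurable F -> H F.
Proof.
move=> lH GH F mF.
apply: (lambda_system_subset openI lH _ _ (sd_open_generate mF)) => //.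
by move=> A [mA oA]; exact: GH.
Qed.
End generation.

(** * Gaussian smearing of bounded sets and its duality with mollification *)

Section approximation.
Context {R : realType} {n : nat}.
Local Notation spt := (spacetime R n).
Local Notation mu := (@lebesgue_spt R n).

(** The mollifier has mass [1], and its mass beyond squared distance [r] is at most the tail bound
    with [B = 0]. *)
Lemma mollifier_tail (r b : R) (z0 : spt) (A : set spt) : 0 < r -> 0 < b -> b <= 1 -> measurable A ->
  (forall z, sqdist_spt z z0 < r -> A z) ->
  1 - @tail_bound R n r 0 b <= \int[mu]_z (\1_A z * mollifier b z0 z).
Proof.
move=> r0 b0 b1 mA rA.
have p0 : 0 < pi :> R by exact: pi_gt0.
pose c := pi ^+ 2 / b.
have c0 : 0 < c by rewrite divr_gt0// exprn_gt0.
have c20 : 0 < c / 2 by rewrite divr_gt0.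
have [ig _] := gauss_spt z0 c20.
have mg := gauss_spt_mass z0 c20.
have pb : 1 <= pi / b.
  by rewrite ler_pdivlMr// mul1r (le_trans b1)// (le_trans _ (pi_ge2 R))// ler1n.
have s1 : Num.sqrt (pi / b) <= pi / b.
  rewrite -{2}(@sqr_sqrtr _ (pi / b)) ?(le_trans ler01)// expr2 ler_pMr ?sqrtr_gt0 ?(lt_le_trans ltr01)//.
  by rewrite -sqrtr1 ler_wsqrtr.
pose S := Num.sqrt (pi / b) ^+ n.+1 * expR (- (pi ^+ 2 * r / 2 / b)).
have S0 : 0 <= S by rewrite mulr_ge0 ?expR_ge0// exprn_ge0// sqrtr_ge0.
have im := integrable_mollifier z0 b0.
have iA : mu.-integrable setT (fun z => (\1_A z * mollifier b z0 z)%:E).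
  apply: (integrable_dominated _ im).
    by apply: mfun_mul; [exact: measurable_indic|exact: measurable_mollifier].
  move=> z; rewrite ger0_norm; last by rewrite mulr_ge0// mollifier_ge0.
  by rewrite ler_piMl ?mollifier_ge0// indicE; case: (_ \in _).
have iS := integrableZl_fin S measurableT ig.
rewrite lerBlDr -(mollifier_mass z0 b0).
apply: (@le_trans _ _ (\int[mu]_z (\1_A z * mollifier b z0 z + S * expR (- (c / 2 * sqdist_spt z z0))))).
  apply: (le_Rintegral measurableT im (integrableD_fin measurableT iA iS)) => z _.
  have [h|h] := ltP (sqdist_spt z z0) r.
    rewrite indicE mem_set; last exact: rA.
    by rewrite mul1r lerDl mulr_ge0// expR_ge0.
  apply: (@le_trans _ _ (S * expR (- (c / 2 * sqdist_spt z z0)))); last first.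
    by rewrite lerDr mulr_ge0// mollifier_ge0.
  rewrite /mollifier /S -[X in _ <= X]mulrA -expRD ler_wpM2l ?exprn_ge0 ?sqrtr_ge0// ler_expR -/c.
  have -> : pi ^+ 2 * r / 2 / b = c * r / 2.
    by rewrite /c; move: (pi ^+ 2) => p; rewrite -!mulrA; congr (_ * _); ring.
  have : c * r <= c * sqdist_spt z z0 by rewrite ler_pM2l.
  lra.
rewrite (@RintegralD _ _ _ mu setT _ _ measurableT iA iS) lerD2l.
rewrite (@RintegralZl _ _ _ mu setT _ _ measurableT ig) mg /tail_bound addr0 mulr1 /S.
rewrite -[leRHS]mulr1; apply: ler_pM; [exact: S0|exact: exprn_ge0 (sqrtr_ge0 _)| |].
  by rewrite ler_wpM2r ?expR_ge0// lerXn2r ?nnegrE ?sqrtr_ge0// divr_ge0 ?(ltW p0)// ltW.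
have pc : pi / (c / 2) <= 1.
  have -> : pi / (c / 2) = 2 * b / pi.
    by rewrite /c; move: pi p0 => p pp; field; rewrite !gt_eqF.
  by rewrite ler_pdivrMr// mul1r (le_trans _ (pi_ge2 R))// ler_piMr.
by rewrite exprn_ile1 ?sqrtr_ge0// -[leRHS]sqrtr1 ler_wsqrtr.
Qed.

Lemma measurable_sqdist_spt2 : measurable_fun [set: spt * spt] (fun p => sqdist_spt p.2 p.1).
Proof.
apply: mfun_add.
  apply: mfun_sum => i; apply: mfun_exp; apply: mfun_add.
    by apply: measurableT_comp (measurable_tnth i) _; apply: measurableT_comp; [exact: measurable_fst|exact: measurable_snd].
  by apply: mfun_opp; apply: measurableT_comp (measurable_tnth i) _; apply: measurableT_comp; [exact: measurable_fst|exact: measurable_fst].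
apply: mfun_exp; apply: mfun_add; last apply: mfun_opp; apply: measurableT_comp; [exact: measurable_snd|exact: measurable_snd|exact: measurable_snd|exact: measurable_fst].
Qed.

Lemma measurable_mollifier2 b : measurable_fun [set: spt * spt] (fun p => mollifier b p.1 p.2).
Proof.
apply: mfun_mul; first exact: mfun_cst.
by apply: mfun_expR; apply: mfun_opp; apply: mfun_mul; [exact: mfun_cst|exact: measurable_sqdist_spt2].
Qed.

(** A fixed bounded set containing the past and future cylinders; it makes indicators integrable and
    gives majorants uniform in the centre of the mollifier. *)
Definition big_ball : set spt := [set z | dot_spt z z < 4].

Lemma measurable_big_ball : measurable big_ball.
Proof.
rewrite (_ : big_ball = (fun z => dot_spt z z) @^-1` `]-oo, 4[%classic); last first.
  by apply/seteqP; split => z /=; rewrite in_itv.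
by rewrite -[X in measurable X]setTI; apply: measurable_dot_sptz => //; exact: measurable_itv.
Qed.

Lemma indic_big_ball_le (F : set spt) z : F `<=` big_ball -> \1_F z <= expR 4 * freq_gauss 1 z.
Proof.
move=> FQ; rewrite /freq_gauss mul1r -expRD; have [h|h] := pselect (F z); last first.
  by rewrite indicE memNset// expR_ge0.
have := FQ _ h; rewrite /big_ball/= => h4.
by rewrite indicE mem_set// -[X in X <= _]expR0 ler_expR; lra.
Qed.

Lemma integrable_indic_bounded (F : set spt) : measurable F -> F `<=` big_ball ->
  mu.-integrable setT (fun z => (\1_F z)%:E).
Proof.
move=> mF FQ; apply: (integrable_dominated _ (integrableZl_fin (expR 4) measurableT (integrable_freq_gauss (@ltr01 R)))).
  exact: measurable_indic.
by move=> z; rewrite ger0_norm//; exact: indic_big_ball_le.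
Qed.

(** From [|y| ^ 2 <= 2 |y - z| ^ 2 + 2 |z| ^ 2] and [|z| ^ 2 < 4], half of the exponent yields a
    Gaussian in [y] that does not depend on [z], as needed for Fubini. *)
Lemma mollifier_big_ball b (z y : spt) : 0 < b -> big_ball z ->
  mollifier b z y <= Num.sqrt (pi / b) ^+ n.+1 * expR (4 * (pi ^+ 2 / b)) * freq_gauss (pi ^+ 2 / b / 2) y.
Proof.
move=> b0 zQ; have c0 : 0 < pi ^+ 2 / b :> R by rewrite divr_gt0// exprn_gt0// pi_gt0.
rewrite /mollifier /freq_gauss -[X in _ <= X]mulrA -expRD ler_wpM2l ?exprn_ge0 ?sqrtr_ge0// ler_expR.
set c := pi ^+ 2 / b in c0 *.
have : dot_spt y y <= 2 * sqdist_spt y z + 2 * dot_spt z z.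
  rewrite /dot_spt /sqdist_spt /dotp /sqdist !mulrDr addrACA lerD//.
    rewrite !mulr_sumr -big_split/=; apply: ler_sum => i _.
    have := sqr_ge0 (tnth y.1 i - 2 * tnth z.1 i); nra.
  have := sqr_ge0 ((y.2 : R) - 2 * (z.2 : R)); nra.
move: zQ; rewrite /big_ball/= => zQ h.
have : c * dot_spt y y <= c * (2 * sqdist_spt y z + 8) by rewrite ler_pM2l//; lra.
lra.
Qed.

Section fixed_scale.
Variables (b : R) (b0 : 0 < b).
Variables (F : set spt) (mF : measurable F) (FQ : F `<=` big_ball).

Definition smear (G : set spt) (y : spt) : R := \int[mu]_z (\1_G z * mollifier b z y).

Let PF (p : spt * spt) : R := \1_F p.1 * mollifier b p.1 p.2.

Let mPF : measurable_fun setT PF.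
Proof.
apply: mfun_mul; last exact: measurable_mollifier2.
by apply: measurableT_comp; [exact: measurable_indic|exact: measurable_fst].
Qed.

Let f2 (y : spt) : R := Num.sqrt (pi / b) ^+ n.+1 * expR (4 * (pi ^+ 2 / b)) * freq_gauss (pi ^+ 2 / b / 2) y.

Let c20 : 0 < pi ^+ 2 / b / 2.
Proof. by rewrite divr_gt0// divr_gt0// exprn_gt0// pi_gt0. Qed.

Let if2 : mu.-integrable setT (fun y => (f2 y)%:E).
Proof. exact: integrableZl_fin (integrable_freq_gauss c20). Qed.

Let i1 := integrable_indic_bounded mF FQ.

Let PFle z y : `|PF (z, y)| <= \1_F z * f2 y.
Proof.
rewrite /PF/= ger0_norm; last by rewrite mulr_ge0// mollifier_ge0.
have [h|h] := pselect (F z); last by rewrite indicE memNset// !mul0r.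
by rewrite ler_wpM2l//; exact: mollifier_big_ball (FQ h).
Qed.

Lemma integrable_smear : mu.-integrable setT (fun y => (smear F y)%:E).
Proof. exact: (integrable_fubini2 i1 if2 mPF PFle). Qed.

Lemma smear_mass : \int[mu]_y smear F y = \int[mu]_z \1_F z.
Proof.
rewrite -(Rfubini2 i1 if2 mPF PFle) (Rfubini1 i1 if2 mPF PFle).
apply: eq_Rintegral => z _; rewrite /PF/=.
by rewrite (@RintegralZl _ _ _ mu setT _ _ measurableT (integrable_mollifier z b0)) mollifier_mass// mulr1.
Qed.

Lemma smear_section y : mu.-integrable setT (fun z => (\1_F z * mollifier b z y)%:E).
Proof. exact: (integrable_section2 i1 mPF PFle). Qed.

Lemma smear_ge0 y : 0 <= smear F y.
Proof. by apply: Rintegral_ge0 => z _; rewrite mulr_ge0// mollifier_ge0. Qed.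

Lemma smear_le1 y : smear F y <= 1.
Proof.
rewrite -(mollifier_mass y b0); apply: le_Rintegral => //; [exact: smear_section|exact: integrable_mollifier|].
by move=> z _; rewrite mollifierC ler_piMl ?mollifier_ge0// indicE; case: (_ \in _).
Qed.

(** By Fubini the mollification moves from [v] to the indicator of [F]. Convergence of the mollified
    [v] against indicators thus reduces to convergence of [smear F] to [\1_F] in [L^1], which
    involves sets only. *)
Lemma smear_duality (v : spt -> R) : measurable_fun [set: spt] v ->
  mu.-integrable setT (fun z => (v z ^+ 2)%:E) ->
  mu.-integrable setT (fun y => (v y * smear F y)%:E) /\
  \int[mu]_z (\1_F z * \int[mu]_y (mollifier b z y * v y)) = \int[mu]_y (v y * smear F y).
Proof.
move=> mv iv.
have i2 : mu.-integrable setT (fun y => (f2 y * `|v y|)%:E).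
  apply: L2_mul; [exact: integrable_measurable if2|exact: mfun_norm| |].
    have := integrableZl_fin ((Num.sqrt (pi / b) ^+ n.+1 * expR (4 * (pi ^+ 2 / b))) ^+ 2) measurableT (@integrable_freq_gauss_sqr R n _ c20).
    by apply: eq_integrable => // y _; congr EFin; rewrite -exprMn.
  by move: iv; apply: eq_integrable => // y _; congr EFin; rewrite real_normK ?num_real.
pose P (p : spt * spt) := PF p * v p.2.
have mP : measurable_fun setT P by apply: mfun_mul => //; exact: measurableT_comp measurable_snd.
have Ple z y : `|P (z, y)| <= \1_F z * (f2 y * `|v y|).
  by rewrite /P normrM mulrA ler_wpM2r.
have E y : \int[mu]_z P (z, y) = v y * smear F y.
  rewrite /P/= (@RintegralZr _ _ _ mu setT _ _ measurableT (smear_section y)) mulrC//.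
split.
  by have := integrable_fubini2 i1 i2 mP Ple; apply: eq_integrable => // y _; rewrite E.
have -> : \int[mu]_y (v y * smear F y) = \int[mu]_y \int[mu]_z P (z, y) by apply: eq_Rintegral => y _; rewrite E.
rewrite -(Rfubini2 i1 i2 mP Ple) (Rfubini1 i1 i2 mP Ple); apply: eq_Rintegral => z _.
rewrite -RintegralZl//; last by apply: L2_mul => //; [exact: measurable_mollifier|exact: integrable_mollifier_sqr].
by apply: eq_Rintegral => y _; rewrite /P /PF/= mulrA.
Qed.
End fixed_scale.
End approximation.

(** * Convergence of the smeared indicators in [L^1] *)

Section approximate_identity.
Context {R : realType} {n : nat}.
Local Notation spt := (spacetime R n).
Local Notation mu := (@lebesgue_spt R n).
Implicit Types A B F : set spt.

Definition scale (j : nat) : R := j.+1%:R^-1.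

Lemma scale_gt0 j : 0 < scale j. Proof. by rewrite invr_gt0. Qed.

Lemma scale_le1 j : scale j <= 1.
Proof. by rewrite invf_le1// ler1n. Qed.

Definition smear_gap j F : R := \int[mu]_y `|smear (scale j) F y - \1_F y|.

Let Q := @big_ball R n.

Let indic_diff A B y : B `<=` A -> \1_(A `\` B) y = \1_A y - \1_B y :> R.
Proof.
move=> BA; rewrite !indicE; have [hB|hB] := pselect (B y).
  by rewrite memNset ?(mem_set hB) ?(mem_set (BA _ hB)) ?subrr// => -[].
rewrite (memNset hB) subr0; have [hA|hA] := pselect (A y); first by rewrite !mem_set.
by rewrite !memNset// => -[].
Qed.

Let smear_diff b A B y : 0 < b -> measurable A -> measurable B -> A `<=` Q -> B `<=` A ->
  smear b (A `\` B) y = smear b A y - smear b B y.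
Proof.
move=> b0 mA mB AQ BA.
have iA := smear_section b0 mA AQ y.
have iB := smear_section b0 mB (subset_trans BA AQ) y.
rewrite /smear -(@RintegralB _ _ _ mu setT _ _ measurableT iA iB).
by apply: eq_Rintegral => z _; rewrite indic_diff// mulrBl.
Qed.

Let iD j F : measurable F -> F `<=` Q ->
  mu.-integrable setT (fun y => (smear (scale j) F y - \1_F y)%:E).
Proof.
move=> mF FQ; apply: integrableB_fin => //; last exact: integrable_indic_bounded.
exact: (integrable_smear (scale_gt0 j) mF FQ).
Qed.

Let ia j F : measurable F -> F `<=` Q ->
  mu.-integrable setT (fun y => `|smear (scale j) F y - \1_F y|%:E).
Proof. by move=> mF FQ; exact: (integrable_norm (iD j mF FQ)). Qed.

Lemma smear_gap_ge0 j F : 0 <= smear_gap j F.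
Proof. exact: Rintegral_ge0. Qed.

Let gap_diff j A B : measurable A -> measurable B -> A `<=` Q -> B `<=` A ->
  smear_gap j (A `\` B) <= smear_gap j A + smear_gap j B.
Proof.
move=> mA mB AQ BA; have BQ := subset_trans BA AQ.
have mAB : measurable (A `\` B) by exact: measurableD.
have ABQ : A `\` B `<=` Q by move=> z [/AQ].
rewrite /smear_gap -(@RintegralD _ _ _ mu setT _ _ measurableT (ia j mA AQ) (ia j mB BQ)).
apply: (le_Rintegral measurableT (ia j mAB ABQ) (integrableD_fin measurableT (ia j mA AQ) (ia j mB BQ))) => y _.
rewrite (smear_diff y (scale_gt0 j))// indic_diff//.
rewrite (_ : _ - _ - _ = (smear (scale j) A y - \1_A y) - (smear (scale j) B y - \1_B y)); last by ring.
exact: ler_normB.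
Qed.

(** Smearing preserves mass, so passing from [B] to a larger [A] costs at most twice the measure of
    the difference, uniformly in the scale [j]. This gives closure under increasing unions. *)
Let gap_mono j A B : measurable A -> measurable B -> A `<=` Q -> B `<=` A ->
  smear_gap j A <= smear_gap j B + (\int[mu]_z \1_(A `\` B) z + \int[mu]_z \1_(A `\` B) z).
Proof.
move=> mA mB AQ BA; have BQ := subset_trans BA AQ.
have mAB : measurable (A `\` B) by exact: measurableD.
have ABQ : A `\` B `<=` Q by move=> z [/AQ].
have i1 := integrable_indic_bounded mAB ABQ.
have i2 := integrable_smear (scale_gt0 j) mAB ABQ.
have i12 := integrableD_fin measurableT i2 i1.
rewrite -{1}(smear_mass (scale_gt0 j) mAB ABQ) -(@RintegralD _ _ _ mu setT _ _ measurableT i2 i1).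
rewrite /smear_gap -(@RintegralD _ _ _ mu setT _ _ measurableT (ia j mB BQ) i12).
apply: (le_Rintegral measurableT (ia j mA AQ) (integrableD_fin measurableT (ia j mB BQ) i12)) => y _.
have e1 := smear_diff y (scale_gt0 j) mA mB AQ BA; have e2 := @indic_diff A B y BA.
have s0 := smear_ge0 (scale j) (A `\` B) y.
have s1 : 0 <= \1_(A `\` B) y :> R by [].
have -> : smear (scale j) A y - \1_A y = (smear (scale j) B y - \1_B y) + (smear (scale j) (A `\` B) y - \1_(A `\` B) y).
  by rewrite e1 e2; ring.
apply: (le_trans (ler_normD _ _)); rewrite lerD2l (le_trans (ler_normB _ _))//.
by rewrite !ger0_norm.
Qed.

(* Scheffe's argument: [smear] preserves the mass, so it suffices to control the
   positive part of [\1_F - smear F], which tends to [0] because [F] is open. *)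
Let gap_open F : measurable F -> F `<=` Q -> sd_open F -> smear_gap j F @[j --> \oo] --> (0 : R).
Proof.
move=> mF FQ oF.
have i1 := integrable_indic_bounded mF FQ.
pose p j y : R := Num.max (\1_F y - smear (scale j) F y) 0.
have mp j : measurable_fun [set: spt] (p j).
  apply: mfun_max; last exact: mfun_cst.
  by apply: mfun_add; [exact: measurable_indic|apply: mfun_opp; exact: integrable_measurable (integrable_smear (scale_gt0 j) mF FQ)].
have pF j y : `|p j y| <= \1_F y.
  have K0 := smear_ge0 (scale j) F y.
  by rewrite ger0_norm ?le_max ?lexx ?orbT// ge_max; apply/andP; split=> //; lra.
have E j : smear_gap j F = 2 * \int[mu]_y p j y.
  have ip := integrable_dominated (mp j) i1 (pF j).
  have is' := integrable_smear (scale_gt0 j) mF FQ.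
  have -> : 2 * \int[mu]_y p j y = 2 * (\int[mu]_y p j y) + (\int[mu]_y smear (scale j) F y - \int[mu]_z \1_F z).
    by rewrite (smear_mass (scale_gt0 j) mF FQ) subrr addr0.
  rewrite -(@RintegralZl _ _ _ mu setT _ _ measurableT ip) -(@RintegralB _ _ _ mu setT _ _ measurableT is' i1).
  rewrite -(@RintegralD _ _ _ mu setT _ _ measurableT (integrableZl_fin 2 measurableT ip) (integrableB_fin measurableT is' i1)).
  apply: eq_Rintegral => y _; rewrite /p.
  have [h|h] := leP (\1_F y - smear (scale j) F y) 0; last by rewrite ltr0_norm; lra.
  by rewrite ger0_norm; lra.
have -> : (fun j => smear_gap j F) = (fun j => 2 * \int[mu]_y p j y) by apply/funext.
have -> : (0 : R) = 2 * \int[mu]_(y in setT) (fun=> 0 : R) y by rewrite Rintegral_cst// mul0r mulr0.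
apply: cvgM; first exact: cvg_cst.
apply: (Rintegral_dominated_cvg mp _ i1 pF); first exact: mfun_cst.
apply: aeW => y.
suff h : p j y @[j --> \oo] --> (0 : R) by exact: h.
have [Fy|Fy] := pselect (F y); last first.
  apply: cvg_near_cst; apply: nearW => j; rewrite /p indicE memNset// sub0r.
  by apply/max_idPr; rewrite oppr_le0 smear_ge0.
have [r r0 rF] := oF _ Fy.
apply: (@squeeze_cvgr _ _ _ _ (fun=> 0) (fun j : nat => @tail_bound R n r 0 (scale j))).
- apply: nearW => j; rewrite le_max lexx orbT/= ge_max; apply/andP; split.
    have := mollifier_tail r0 (scale_gt0 j) (scale_le1 j) mF rF.
    have -> : \int[mu]_z (\1_F z * mollifier (scale j) y z) = smear (scale j) F y.
      by apply: eq_Rintegral => z _; rewrite mollifierC.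
    by rewrite indicE mem_set// mulr1n; lra.
  by rewrite /tail_bound addr0 mulr1 mulr_ge0 ?expR_ge0// exprn_ge0// divr_ge0 ?pi_ge0// ltW// scale_gt0.
- exact: cvg_cst.
- exact: tail_bound_cvg0.
Qed.

Let Qopen : sd_open Q.
Proof.
move=> z; rewrite /Q /big_ball/= => z4.
have d0 := dot_spt_ge0 z.
(* With [|z| ^ 2 = 4 - 16 e], squared distance below [e ^ 2] gives
   [|y| ^ 2 <= (1 + e) (4 - 15 e) < 4]. *)
pose e := (4 - dot_spt z z) / 16.
have e0 : 0 < e by rewrite divr_gt0// subr_gt0.
exists (e ^+ 2); first by rewrite exprn_gt0.
move=> y h.
have s0 := sqdist_spt_ge0 y z.
(* Young's inequality with parameter [e] *)
have : e * dot_spt y y <= e * (1 + e) * dot_spt z z + (1 + e) * sqdist_spt y z.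
  rewrite /dot_spt /sqdist_spt /dotp /sqdist !mulrDr addrACA lerD//.
    rewrite !mulr_sumr -big_split/=; apply: ler_sum => i _.
    have := sqr_ge0 (e * tnth z.1 i - (tnth y.1 i - tnth z.1 i)); nra.
  have := sqr_ge0 (e * (z.2 : R) - ((y.2 : R) - z.2)); nra.
have e1 : e <= 4^-1 by rewrite /e; lra.
have zE : dot_spt z z = 4 - 16 * e by rewrite /e; lra.
rewrite zE => hh.
have : e * dot_spt y y < e * 4.
  apply: (le_lt_trans hh).
  have : (1 + e) * sqdist_spt y z <= (1 + e) * e ^+ 2 by rewrite ler_wpM2l ?ltW//; lra.
  by nra.
by rewrite ltr_pM2l.
Qed.

(* Dynkin's theorem, starting from open sets. *)
Lemma smear_gap_cvg0 F : measurable F -> F `<=` Q -> smear_gap j F @[j --> \oo] --> (0 : R).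
Proof.
have key (x y z : R) : x <= z / 4 -> y <= z / 4 -> 0 < z -> x + (y + y) <= z by move=> *; lra.
move=> mF FQ; have mQ : measurable Q by exact: measurable_big_ball.
suff h : forall A, measurable A -> measurable A /\ smear_gap j (A `&` Q) @[j --> \oo] --> (0 : R).
  by have [_] := h F mF; rewrite setIidl.
pose H : set (set spt) := [set A | measurable A /\ smear_gap j (A `&` Q) @[j --> \oo] --> (0 : R)].
have squeeze A (g : nat -> R) : (forall j, smear_gap j A <= g j) -> g j @[j --> \oo] --> (0 : R) ->
    smear_gap j A @[j --> \oo] --> (0 : R).
  move=> gA g0; apply: (@squeeze_cvgr _ _ _ _ (fun=> 0) g) => //; last exact: cvg_cst.
  by apply: nearW => j; rewrite smear_gap_ge0 gA.
suff lH : lambda_system setT H.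
  apply: (sd_open_ind lH) => {}A mA oA.
  split=> //; apply: gap_open; [exact: measurableI|by move=> z []|].
  move=> z [/oA[r1 r10 h1] /Qopen[r2 r20 h2]]; exists (Num.min r1 r2); first by rewrite lt_min r10.
  by move=> y; rewrite lt_min => /andP[/h1 ? /h2 ?].
split => //.
- by split=> //; rewrite setTI; apply: gap_open.
- move=> A1 B BA [mA hA] [mB hB]; split; first exact: measurableD.
  have -> : (A1 `\` B) `&` Q = (A1 `&` Q) `\` (B `&` Q).
    by apply/seteqP; split => z /=; tauto.
  apply: (squeeze _ (fun j => smear_gap j (A1 `&` Q) + smear_gap j (B `&` Q))).
    move=> j; apply: gap_diff; [exact: measurableI|exact: measurableI|by move=> z []|exact: setSI].
  by rewrite -[X in _ --> X]addr0; exact: cvgD.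
move=> B ndB HB.
pose U := \bigcup_i B i.
have mB i : measurable (B i) by have [] := HB i.
have mU : measurable U by exact: bigcup_measurable.
split=> //.
have UQ : U `&` Q `<=` Q by move=> z [].
have mUQ : measurable (U `&` Q) by exact: measurableI.
have BU k : B k `&` Q `<=` U `&` Q by apply: setSI => z Bz; exists k.
have mBQ k : measurable (B k `&` Q) by exact: measurableI.
have mD k : measurable ((U `&` Q) `\` (B k `&` Q)) by exact: measurableD.
(* These measures do not depend on the scale, so [k] can be fixed first and the scale sent to [0]
   afterwards for the single set [B k]. *)
have rest : \int[mu]_z \1_((U `&` Q) `\` (B k `&` Q)) z @[k --> \oo] --> (0 : R).
  have -> : (0 : R) = \int[mu]_(y in setT) (fun=> 0 : R) y by rewrite Rintegral_cst// mul0r.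
  apply: (@Rintegral_dominated_cvg _ _ _ mu _ _ (\1_(U `&` Q))).
  - by move=> k; exact: measurable_indic.
  - exact: mfun_cst.
  - exact: integrable_indic_bounded.
  - move=> k z; rewrite ger0_norm// !indicE; have [|] := boolP (z \in _ `\` _); last by rewrite ler0n.
    by rewrite inE => -[h _]; rewrite mem_set.
  apply: aeW => z; apply: cvg_near_cst.
  have [[[k _ Bz] Qz]|h] := pselect ((U `&` Q) z); last first.
    by apply: nearW => k; rewrite indicE memNset// => -[].
  exists k => // l /= kl; rewrite indicE memNset// => -[_]; apply; split=> //.
  by move: (ndB _ _ kl) => /subsetPset; apply.
apply/cvgrPdist_le => e e0.
have e4 : 0 < e / 4 by rewrite divr_gt0.
move/cvgrPdist_le : rest => /(_ _ e4)[k _ /(_ k (leqnn k))] /=.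
rewrite sub0r normrN => hk; have {}hk := le_trans (ler_norm _) hk.
have [_ /cvgrPdist_le/(_ _ e4)] := HB k.
apply: filterS => j; rewrite !sub0r !normrN => hj; have {}hj := le_trans (ler_norm _) hj.
rewrite ger0_norm ?smear_gap_ge0//.
apply: (le_trans (gap_mono j mUQ (mBQ k) UQ (BU k))).
exact: key.
Qed.

End approximate_identity.

Section limit.
Context {R : realType} {n : nat}.
Local Notation spt := (spacetime R n).
Local Notation mu := (@lebesgue_spt R n).

(** After [smear_duality] the difference is at most the integral of [|v| D] with
    [D = |smear F - \1_F| <= 1]. Young's inequality gives [|v| D <= d v ^ 2 + D / d], so [L^1]
    convergence of [D] is enough although [v] is only in [L^2]. *)
Lemma mollified_cvg (v : spt -> R) (F : set spt) : measurable_fun [set: spt] v ->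
  mu.-integrable setT (fun z => (v z ^+ 2)%:E) -> measurable F -> F `<=` big_ball ->
  \int[mu]_z (\1_F z * \int[mu]_y (mollifier (scale j) z y * v y)) @[j --> \oo] -->
  \int[mu]_z (\1_F z * v z).
Proof.
move=> mv iv mF FQ; set B := \int[mu]_z v z ^+ 2.
have B0 : 0 <= B by apply: Rintegral_ge0 => z _; exact: sqr_ge0.
have i1 := integrable_indic_bounded mF FQ.
have i1v : mu.-integrable setT (fun z => (\1_F z * v z)%:E).
  apply: L2_mul => //.
  by move: i1; apply: eq_integrable => // z _; rewrite indicE; case: (_ \in _); rewrite ?expr1n ?expr0n.
apply/cvgrPdist_le => e e0.
pose d := e / (2 * (B + 1)).
have d0 : 0 < d by rewrite divr_gt0// mulr_gt0// ltr_wpDl.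
have e2 : 0 < e / 2 * d by rewrite mulr_gt0// divr_gt0.
move/cvgrPdist_le : (smear_gap_cvg0 mF FQ) => /(_ _ e2); apply: filterS => j.
rewrite sub0r normrN => hj; have {}hj := le_trans (ler_norm _) hj.
have [ivs ->] := smear_duality (scale_gt0 j) mF FQ mv iv.
have s0 := smear_ge0 (scale j) F; have s1 := smear_le1 (scale_gt0 j) mF FQ.
have ism := integrable_smear (scale_gt0 j) mF FQ.
have ig : mu.-integrable setT (fun y => `|smear (scale j) F y - \1_F y|%:E).
  exact: (integrable_norm (integrableB_fin measurableT ism i1)).
have iB := integrableB_fin measurableT i1v ivs.
rewrite -(@RintegralB _ _ _ mu setT _ _ measurableT i1v ivs).
apply: (le_trans (le_normr_Rintegral measurableT iB)).
have iS := integrableD_fin measurableT (integrableZl_fin d measurableT iv) (integrableZl_fin d^-1 measurableT ig).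
apply: (@le_trans _ _ (\int[mu]_z (d * v z ^+ 2 + d^-1 * `|smear (scale j) F z - \1_F z|))).
  apply: (le_Rintegral measurableT (integrable_norm iB) iS) => z _.
  set D := `|smear _ _ _ - _|.
  have D0 : 0 <= D by exact: normr_ge0.
  have D1 : D <= 1.
    have := s0 z; have := s1 z; rewrite /D indicE; case: (z \in F) => h1 h2 /=.
      by rewrite distrC ger0_norm ?subr_ge0// gerBl.
    by rewrite subr0 ger0_norm.
  have E : `|\1_F z * v z - v z * smear (scale j) F z| = `|v z| * D.
    by rewrite /D distrC -normrM; congr (`|_|); ring.
  apply: (@le_trans _ _ (`|v z| * D)); first by rewrite -E.
  rewrite -(real_normK (num_real (v z))); have := normr_ge0 (v z); move: (`|v z|) => x x0.
  have h : x * D <= d * x ^+ 2 + d^-1 * D ^+ 2.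
    have dd : d * d^-1 = 1 by rewrite mulfV// gt_eqF.
    have di0 : 0 < d^-1 by rewrite invr_gt0.
    have : 0 <= d^-1 * (d * x - D) ^+ 2 by rewrite mulr_ge0 ?sqr_ge0// ltW.
    have -> : d^-1 * (d * x - D) ^+ 2 = (d * d^-1) * d * x ^+ 2 - 2 * (d * d^-1) * (x * D) + d^-1 * D ^+ 2 by ring.
    rewrite dd mul1r mulr1; have : 0 <= x * D by rewrite mulr_ge0. lra.
  apply: (le_trans h); rewrite lerD2l ler_wpM2l ?invr_ge0 ?(ltW d0)//.
  by rewrite expr2 ler_piMr.
rewrite (@RintegralD _ _ _ mu setT _ _ measurableT (integrableZl_fin d measurableT iv) (integrableZl_fin d^-1 measurableT ig)).
rewrite (@RintegralZl _ _ _ mu setT _ _ measurableT iv) (@RintegralZl _ _ _ mu setT _ _ measurableT ig).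
rewrite -/B -/(smear_gap j F).
have h1 : d * B <= e / 2.
  have -> : d * B = e / 2 * (B / (B + 1)) by rewrite /d; field; rewrite gt_eqF// ltr_wpDl.
  by rewrite ler_piMr ?divr_ge0 ?(ltW e0)// ler_pdivrMr ?ltr_wpDl// mul1r lerDl.
have h2 : d^-1 * smear_gap j F <= e / 2.
  by rewrite mulrC ler_pdivrMr.
lra.
Qed.

(** Fubini is applied to the function times an integrable Gaussian in [z], which is divided out
    afterwards. *)
Lemma measurable_mollified (uh : spt -> R[i]) (b : R) : memLp mu 2%:E uh -> 0 < b ->
  measurable_fun [set: spt] (mollified uh b).
Proof.
move=> uhL2 b0; have [mr mi _] := uhL2.
have i1 := @integrable_freq_gauss R n 1 ltr01.
have i2 := integrable_gauss_uh uhL2 b0.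
pose F (p : spt * spt) : R := freq_gauss 1 p.1 * (freq_gauss b p.2 * rephase (uh p.2) (2 * pi * dot_spt p.1 p.2)).
have mF : measurable_fun setT F.
  have m1 : measurable_fun [set: spt * spt] (fst : _ -> spt) by exact: measurable_fst.
  have m2 : measurable_fun [set: spt * spt] (snd : _ -> spt) by exact: measurable_snd.
  apply: mfun_mul; first exact: measurableT_comp (measurable_freq_gauss 1) m1.
  apply: mfun_mul; first exact: measurableT_comp (measurable_freq_gauss b) m2.
  apply: measurable_rephase; [exact: measurableT_comp mr m2|exact: measurableT_comp mi m2|].
  apply: mfun_mul; first exact: mfun_cst.
  by under eq_fun do rewrite dot_sptC; exact: measurable_dot_spt2.
have Fle x y : `|F (x, y)| <= freq_gauss 1 x * (freq_gauss b y * cmod (uh y)).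
  rewrite /F/= normrM (ger0_norm (freq_gauss_ge0 _ _)) ler_wpM2l ?freq_gauss_ge0//.
  by rewrite normrM (ger0_norm (freq_gauss_ge0 _ _)) ler_wpM2l ?freq_gauss_ge0// rephase_le.
have := integrable_measurable (integrable_fubini1 i1 i2 mF Fle).
have -> : mollified uh b = fun z => expR (dot_spt z z) * \int[mu]_y F (z, y).
  apply/funext => z; rewrite /F/=.
  rewrite (@RintegralZl _ _ _ mu setT _ _ measurableT (integrable_gauss_rephase uhL2 b0 (measurable_phase z))).
  by rewrite mulrA /freq_gauss mul1r -expRD subrr expR0 mul1r.
by move=> h; apply: mfun_mul => //; apply: mfun_expR; exact: measurable_dot_sptz.
Qed.

End limit.

(** * The lower bound for the supersolution *)

Section weak_harnack.
Context {R : realType} {n : nat}.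
Local Notation leb := (@lebesgue_measure R).
Local Notation spt := (spacetime R n).
Local Notation mu := (@lebesgue_spt R n).
Variables (s : R) (s0 : 0 < s) (s1 : s < 1).
Variables (v : spt -> R) (w uh : spt -> R[i]).
Hypothesis fv : is_fourier (fun z => (v z)%:C) uh.
Hypothesis fw : is_fourier w (fun zeta => heat_symbol s zeta * uh zeta).
Hypothesis w0 : {ae mu, forall z, (cylinder 2 `]-4, 0]%R : set spt) z -> 0 <= w z}.
Hypothesis v0 : {ae mu, forall z, 0 <= v z}.

Let mv : measurable_fun [set: spt] v.
Proof. by have [[]] := fv. Qed.

Let iv : mu.-integrable setT (fun z => (v z ^+ 2)%:E).
Proof.
have [vL2 _ _] := fv; have := L2_integrable vL2; apply: eq_integrable => // z _.
by rewrite cmod_sqr/= expr0n addr0.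
Qed.

Let uhL2 : memLp mu 2%:E uh. Proof. by have [] := fv. Qed.

Let mw : measurable_fun [set: spt] (fun z => complex.Re (w z)).
Proof. by have [[]] := fw. Qed.

Let iw : mu.-integrable setT (fun z => (complex.Re (w z) ^+ 2)%:E).
Proof.
have [wL2 _ _] := fw; apply: (integrable_dominated _ (L2_integrable wL2)); first exact: mfun_exp.
by move=> z; rewrite ger0_norm ?sqr_ge0// cmod_sqr lerDl sqr_ge0.
Qed.

Let mollifiedE b z : 0 < b -> mollified uh b z = \int[mu]_y (mollifier b z y * v y).
Proof. by move=> b0; rewrite /mollified (multiplication_formula z fv b0). Qed.

Let mollified_ge0 b z : 0 < b -> 0 <= mollified uh b z.
Proof.
move=> b0; rewrite mollifiedE//; apply: Rintegral_ae_ge0.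
  by apply: L2_mul => //; [exact: measurable_mollifier|exact: integrable_mollifier_sqr].
by apply: filterS v0 => y vy; rewrite mulr_ge0// mollifier_ge0.
Qed.

Let K : R := 4 * n%:R + 2.
Let Kw : R := \int[leb]_tau (jump_weight s tau * Num.min 1 tau).
Let B := \int[mu]_z complex.Re (w z) ^+ 2.
Let past_mass (b : R) : R := \int[mu]_z (mollified uh b z * \1_past_cylinder z).

(** The instance of [obstacle] for the mollification of [v]. The constant [C] is [mollified_lip]
    plus [1], to be positive. The error [eta] is a Gaussian tail beyond squared radius
    [min (1/14, rho ^ 2)], within which [near_in_cylinder] keeps the centres of interest inside the
    domain of the equation. *)
Lemma mollified_harnack (rho b a : R) : 0 < rho -> 0 < b -> b <= 1 -> 0 <= a ->
  a * K * Kw < @kernel_lower R n * past_mass b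
    - jump_const s * @tail_bound R n (Num.min (14^-1) (rho ^+ 2)) B b ->
  forall z : spt, (z.2 : R) <= - rho -> a * barrier z <= mollified uh b z.
Proof.
move=> rho0 b0 b1 a0 aK.
have [_ symbL2 _] := fw.
have iu := integrable_gauss_uh uhL2 b0.
apply: (obstacle s0 s1 (M := \int[mu]_zeta (freq_gauss b zeta * cmod (uh zeta))) (C := mollified_lip uh b + 1)
  (eta := jump_const s * @tail_bound R n (Num.min (14^-1) (rho ^+ 2)) B b) (rho := rho)) => //.
- exact: measurable_mollified.
- by move=> z; exact: mollified_ge0.
- move=> z; have ir := integrable_gauss_rephase uhL2 b0 (measurable_phase z).
  apply: (le_Rintegral measurableT ir iu) => zeta _.
  by rewrite ler_wpM2l ?freq_gauss_ge0// (le_trans (ler_norm _))// rephase_le.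
- by rewrite ltr_wpDl// mollified_lip_ge0.
- exact: ltW.
- move=> tau z t0; apply: (le_trans (mollified_diff_le s uhL2 b0 z t0)).
  by rewrite ler_wpM2r ?lerDl// le_min ler01 ltW.
- by move=> z; have [] := fractional_identity s0 s1 uhL2 b0 z symbL2.
- move=> z x3 t3 tr; have [_ ->] := fractional_identity s0 s1 uhL2 b0 z symbL2.
  rewrite -mulrN ler_wpM2l ?jump_const_ge0// (multiplication_formula z fw b0).
  apply: (mollified_lower_bound (D := cylinder 2 `]-4, 0]%R)) => //.
  + by rewrite lt_min invr_gt0 exprn_gt0// andbT.
  + by apply: filterS w0 => y wy /wy; case: (w y) => x t; rewrite lecE/= => /andP[].
  + by move=> y; exact: near_in_cylinder.
Qed.

(** A lower bound of the barrier on the future cylinder: [|x| ^ 2 < 1/4] and [t > - 1/4] give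
    [exp (- 1/4) - 1/2 - 1/4], which is positive because [exp y > 1 + y] for [y != 0]. *)
Definition barrier_lower : R := expR (- 4^-1) - 3 / 4.

Lemma barrier_lower_gt0 : 0 < barrier_lower.
Proof.
have h : - 4^-1 != 0 :> R by rewrite oppr_eq0 invr_eq0.
have := expR_gt1Dx h; rewrite /barrier_lower; lra.
Qed.

Let future : set spt := cylinder 2^-1 `](- 4^-1), 0[%R.

Let half0 : 0 < 2^-1 :> R. Proof. by rewrite invr_gt0. Qed.

Let mfuture : measurable future. Proof. exact: measurable_cylinder. Qed.

Let mpast : measurable (@past_cylinder R n). Proof. exact: measurable_cylinder. Qed.

Let futureP z : future z -> dotp z.1 z.1 < 4^-1 /\ - 4^-1 < (z.2 : R) < 0.
Proof.
move=> [/(eballE z.1 half0).1 h]; rewrite in_itv/= => h2; split=> //.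
by apply: (lt_le_trans h); rewrite expr2; lra.
Qed.

Let past_ball : @past_cylinder R n `<=` big_ball.
Proof. by move=> z /past_cylinderP[h1 h2 h3]; rewrite /big_ball/= /dot_spt; nra. Qed.

Let future_ball : future `<=` big_ball.
Proof. by move=> z /futureP[h1 /andP[h2 h3]]; rewrite /big_ball/= /dot_spt; nra. Qed.

Let barrier_future z : future z -> barrier_lower <= barrier z.
Proof.
move=> /futureP[h1 /andP[h2 h3]]; rewrite /barrier /barrier_lower.
have : expR (- 4^-1) <= expR (- dotp z.1 z.1) by rewrite ler_expR lerN2 ltW.
lra.
Qed.

(** The mollifications converge only against indicators, so the bound is tested on the set [F] where
    it fails for [v]. There the limit gives [c |F| <= \int_F v], while [v < c] on [F]; hence [F] is
    null. *)
Lemma limit_harnack (a : R) : 0 <= a ->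
  a * K * Kw < @kernel_lower R n * \int[mu]_z (\1_past_cylinder z * v z) ->
  {ae mu, forall z, future z -> a * barrier_lower <= v z}.
Proof.
move=> a0 aK.
(* The future cylinder lies in [t < 0], so the margins [1 / (i + 1)] exhaust it, at the price of
   countably many null sets. *)
pose rho (i : nat) : R := i.+1%:R^-1.
suff step i : {ae mu, forall z, future z -> (z.2 : R) <= - rho i -> a * barrier_lower <= v z}.
  have := @ae_foralln _ _ _ mu _ step.
  apply: filterS => z hz fz; have [_ /andP[_ z0]] := futureP fz.
  have [i hi] : exists i, rho i <= - (z.2 : R).
    exists (Num.truncn (- (z.2 : R))^-1).
    rewrite /rho invf_ple ?posrE ?oppr_gt0//; apply: ltW.
    by rewrite Num.Theory.truncnS_gt// invr_ge0 ltW// oppr_gt0.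
  by apply: (hz i) => //; rewrite lerNr.
have rho0 : 0 < rho i by rewrite invr_gt0.
pose c := a * barrier_lower.
pose F : set spt := future `&` ([set z | (z.2 : R) <= - rho i] `&` [set z | v z < c]).
have mF : measurable F.
  apply: measurableI => //; apply: measurableI.
    rewrite (_ : [set z | _] = (fun z : spt => z.2) @^-1` `]-oo, - rho i]%classic); last first.
      by apply/seteqP; split => z /=; rewrite in_itv.
    by rewrite -[X in measurable X]setTI; apply: measurable_snd => //; exact: measurable_itv.
  rewrite (_ : [set z | _] = v @^-1` `]-oo, c[%classic); last first.
    by apply/seteqP; split => z /=; rewrite in_itv.
  by rewrite -[X in measurable X]setTI; apply: mv => //; exact: measurable_itv.
have FQ : F `<=` big_ball by move=> z [/future_ball].
have i1 := integrable_indic_bounded mF FQ.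
have r0 : 0 < Num.min (14^-1) (rho i ^+ 2) by rewrite lt_min invr_gt0 exprn_gt0// andbT.
have cpast : past_mass (scale j) @[j --> \oo] --> \int[mu]_z (\1_past_cylinder z * v z).
  have -> : (fun j => past_mass (scale j)) =
      (fun j => \int[mu]_z (\1_past_cylinder z * \int[mu]_y (mollifier (scale j) z y * v y))).
    apply/funext => j; apply: eq_Rintegral => z _.
    by rewrite mollifiedE ?scale_gt0// mulrC.
  exact: mollified_cvg.
have ctail : jump_const s * @tail_bound R n (Num.min (14^-1) (rho i ^+ 2)) B (scale j) @[j --> \oo] --> (0 : R).
  rewrite -[X in _ --> X](mulr0 (jump_const s)).
  by apply: cvgM; [exact: cvg_cst|exact: tail_bound_cvg0].
have ctot : @kernel_lower R n * past_mass (scale j) -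
    jump_const s * @tail_bound R n (Num.min (14^-1) (rho i ^+ 2)) B (scale j) @[j --> \oo] -->
    @kernel_lower R n * \int[mu]_z (\1_past_cylinder z * v z).
  rewrite -[X in _ --> X]subr0; apply: cvgB => //.
  by apply: cvgM; [exact: cvg_cst|exact: cpast].
have cF := mollified_cvg mv iv mF FQ.
have lowF : c * \int[mu]_z \1_F z <= \int[mu]_z (\1_F z * v z).
  apply: (ler_cvg_to (cvg_cst _) cF).
  have gt := cvgr_gt _ ctot _ aK.
  near=> j; have hj : a * K * Kw < @kernel_lower R n * past_mass (scale j) -
    jump_const s * @tail_bound R n (Num.min (14^-1) (rho i ^+ 2)) B (scale j) by near: j; exact: gt.
  have b0 : 0 < scale j :> R := scale_gt0 j; have b1 : scale j <= 1 :> R := scale_le1 j.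
  have hm := mollified_harnack rho0 b0 b1 a0 hj.
  have -> : \int[mu]_z (\1_F z * \int[mu]_y (mollifier (scale j) z y * v y)) = \int[mu]_z (\1_F z * mollified uh (scale j) z).
    by apply: eq_Rintegral => z _; rewrite mollifiedE.
  rewrite -(@RintegralZl _ _ _ mu setT _ _ measurableT i1).
  have mm := measurable_mollified uhL2 b0.
  have iFm : mu.-integrable setT (fun z => (\1_F z * mollified uh (scale j) z)%:E).
    have iu := integrable_gauss_uh uhL2 b0.
    apply: (integrable_dominated _ (integrableZr_fin (\int[mu]_zeta (freq_gauss (scale j) zeta * cmod (uh zeta))) measurableT i1)).
      by apply: mfun_mul => //; exact: measurable_indic.
    move=> z; rewrite ger0_norm; last by rewrite mulr_ge0// mollified_ge0.
    rewrite ler_wpM2l//.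
    have ir := integrable_gauss_rephase uhL2 b0 (measurable_phase z).
    apply: (le_Rintegral measurableT ir iu) => zeta _.
    by rewrite ler_wpM2l ?freq_gauss_ge0// (le_trans (ler_norm _))// rephase_le.
  apply: (le_Rintegral measurableT (integrableZl_fin c measurableT i1) iFm) => z _.
  have [Fz|Fz] := pselect (F z); last by rewrite indicE memNset// mulr0 mul0r.
  rewrite mulrC ler_wpM2l//; have [fz [/= zr _]] := Fz.
  by apply: le_trans (hm z zr); rewrite ler_wpM2l// barrier_future.
have i1v : mu.-integrable setT (fun z => (\1_F z * v z)%:E).
  apply: L2_mul => //.
  by move: i1; apply: eq_integrable => // z _; rewrite indicE; case: (_ \in _); rewrite ?expr1n ?expr0n.
pose h z := c * \1_F z - \1_F z * v z.
have ih : mu.-integrable setT (fun z => (h z)%:E) by apply: integrableB_fin => //; exact: integrableZl_fin.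
have h0 z : 0 <= h z.
  rewrite /h; have [Fz|Fz] := pselect (F z); last by rewrite indicE memNset// mulr0 mul0r subr0.
  have [_ [_ /= vz]] := Fz; by rewrite indicE mem_set// mulr1 mul1r subr_ge0 ltW.
have Ih : (\int[mu]_z `|(h z)%:E|)%E = 0%E.
  have -> : (\int[mu]_z `|(h z)%:E|)%E = (\int[mu]_z h z)%:E.
    rewrite /Rintegral fineK ?integrable_fin_num//.
    by apply: eq_integral => z _; rewrite gee0_abs// lee_fin.
  congr EFin; apply/eqP; rewrite eq_le Rintegral_ge0// andbT.
  rewrite /h (@RintegralB _ _ _ mu setT _ _ measurableT (integrableZl_fin c measurableT i1) i1v).
  by rewrite (@RintegralZl _ _ _ mu setT _ _ measurableT i1) subr_le0.
have := (ae_eq_integral_abs mu measurableT (measurable_int mu ih)).1 Ih.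
apply: filterS => z /(_ I) /= [hz] fz zr; rewrite leNgt; apply/negP => vz.
have Fz : F z by [].
by move: hz; rewrite /h indicE mem_set// mulr1 mul1r => /eqP; rewrite subr_eq0 => /eqP cv; move: vz; rewrite -/c cv ltxx.
Unshelve. all: by end_near. Qed.

End weak_harnack.

Theorem theorem1p3 (R : realType) (n : nat) (s : R)
    (hn : (1 <= n)%N) (hs0 : 0 < s) (hs1 : s < 1) :
  exists C : R,
    forall v : spacetime R n -> R,
      Dom_frac_heat s (fun z => (v z)%:C) ->
      strong_supersolution s (fun z => (v z)%:C) (cylinder 2 `]-4, 0]) ->
      {ae lebesgue_spt, forall z : spacetime R n, 0 <= v z} ->
      (\int[lebesgue_spt]_(z in (cylinder 2^-1 `](- 1), (- 2^-1)[)%R) `|v z|%:E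
        <= C%:E * ess_inf_on lebesgue_spt (cylinder 2^-1 `](- 4^-1), 0[)%R
                    (fun z => (v z)%:E))%E.
Proof.
set Kw := \int[@lebesgue_measure R]_tau (jump_weight s tau * Num.min 1 tau).
have Kw0 : 0 <= Kw.
  apply: Rintegral_ge0 => tau _; have [t0|t0] := leP tau 0; first by rewrite jump_weight_neg// mul0r.
  by rewrite mulr_ge0 ?jump_weight_ge0// le_min ler01 ltW.
(* Replacing [Kw] by [Kw + 1] makes [D] strictly positive, so that one can divide by it. *)
set D := (4 * n%:R + 2) * (Kw + 1).
have D0 : 0 < D by rewrite mulr_gt0// ltr_wpDl// mulr_ge0.
have g0 : 0 < @kernel_lower R n := kernel_lower_gt0.
have c0 : 0 < @barrier_lower R := barrier_lower_gt0.
exists (D / (@kernel_lower R n * @barrier_lower R)) => v _ [w [[uh [fv fw]] wD]] v0.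
set C := D / _.
have C0 : 0 < C by rewrite divr_gt0// mulr_gt0.
set future := (cylinder 2^-1 `](- 4^-1), 0[)%R.
have [vL2 _ _] := fv; have [mv _ _] := vL2.
have mP : measurable (@past_cylinder R n) by apply: measurable_cylinder; rewrite invr_gt0.
have ball : @past_cylinder R n `<=` big_ball.
  by move=> z /past_cylinderP[h1 h2 h3]; rewrite /big_ball/= /dot_spt; nra.
have i1 := integrable_indic_bounded mP ball.
have i1v : lebesgue_spt.-integrable setT (fun z => (\1_(@past_cylinder R n) z * v z)%:E).
  apply: L2_mul => //.
    by move: i1; apply: eq_integrable => // z _; rewrite indicE; case: (_ \in _); rewrite ?expr1n ?expr0n.
  by have := L2_integrable vL2; apply: eq_integrable => // z _; rewrite cmod_sqr/= expr0n addr0.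
set L := \int[lebesgue_spt]_z (\1_(@past_cylinder R n) z * v z).
(* Nonnegativity of [v] holds only almost everywhere, so the absolute value is removed through an
   almost everywhere equality. *)
have -> : (\int[lebesgue_spt]_(z in (cylinder 2^-1 `](- 1), (- 2^-1)[)%R) `|v z|%:E)%E = L%:E.
  rewrite /L /Rintegral fineK ?integrable_fin_num// [LHS]integral_mkcond -[cylinder _ _]/(@past_cylinder R n).
  apply: ae_eq_integral => //.
  - apply/(measurable_restrictT _ mP)/measurable_funTS; apply/measurable_EFinP; exact: mfun_norm.
  - exact: measurable_int i1v.
  apply: filterS v0 => z vz _; rewrite patchE indicE.
  by case: (z \in past_cylinder); rewrite ?mul1r ?mul0r// ger0_norm.
set e := ess_inf_on _ _ _.
have eP (r : R) : {ae lebesgue_spt, forall z, future z -> r <= v z} -> (r%:E <= e)%E.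
  by move=> h; apply: ereal_sup_ubound; apply: filterS h => z h /h; rewrite lee_fin.
have e0 : (0 <= e)%E by apply: eP; apply: filterS v0 => z vz _.
(* If the essential infimum is [+oo] the right side is [+oo] because [C > 0]; the value [-oo] is
   excluded by [0 <= e]. *)
case: (e) eP e0 => [r||//] eP e0; last by rewrite gt0_muley ?lte_fin ?leey.
rewrite -EFinM lee_fin leNgt; apply/negP => CrL.
have r0 : 0 <= r by rewrite -lee_fin.
(* Every [a < A] satisfies the hypothesis of [limit_harnack]. If [C r < L] then
   [r / barrier_lower < A], and a value of [a] strictly between gives the lower bound
   [a * barrier_lower > r] on the future cylinder, against the choice of [r]. *)
pose A := @kernel_lower R n * L / D.
have rA : r / @barrier_lower R < A.
  rewrite /A ltr_pdivrMr// -(ltr_pM2l C0).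
  have -> // : C * (@kernel_lower R n * L / D * @barrier_lower R) = L.
  rewrite /C; move: (@barrier_lower R) (kernel_lower) D0 g0 c0 => c g D0 g0 c0.
  by field; rewrite !gt_eqF.
pose a := (r / @barrier_lower R + A) / 2.
have ra : r / @barrier_lower R < a by rewrite /a; lra.
have aA : a < A by rewrite /a; lra.
have a0 : 0 <= a by apply: le_trans (ltW ra); rewrite divr_ge0// ltW.
have aK : a * (4 * n%:R + 2) * Kw < @kernel_lower R n * L.
  apply: (@le_lt_trans _ _ (a * D)).
    by rewrite /D -mulrA ler_wpM2l// ler_wpM2l ?lerDl// addr_ge0// mulr_ge0.
  by rewrite -ltr_pdivlMr.
have := eP _ (limit_harnack hs0 hs1 fv fw wD v0 a0 aK).
by rewrite lee_fin leNgt -ltr_pdivrMr// ra.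
Qed.
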